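(* Let $K$ be a field of any characteristic, and let $\eta$ be a finitely supported probability measure on $\mathrm{Aff}(K)^2$, supported on pairs $(g_1,g_2)$ with a common linear part $a(g_1)=a(g_2)$. Assume that $\eta\{g:\ a(g)\in\mu(K)\}<1$ and that the support of $\eta$ is not included in the diagonal subgroup $\{(g,g): g\in\mathrm{Aff}(K)\}$ of $\mathrm{Aff}(K)^2$. Let $L_n=(L_{n,1},L_{n,2})$ be the random walk driven by $\eta$ and let $r$ be the free rank of the finitely generated abelian group $A$. Then: (1) If $r\ge 3$, then almost surely there exists $n_0\in\mathbb{N}$ such that for every $n\ge n_0$, $\langle L_{n,1},L_{n,2}\rangle_+$ is free. (2) If $r\in\{1,2\}$, then $\langle L_{n,1},L_{n,2}\rangle_+$ is almost surely eventually free (i.e. almost surely free for all sufficiently large $n$) if and only if $a_*\eta$ is not centered.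
   Context: For a field $K$, $\mathrm{Aff}(K)$ is the group of maps $x\mapsto ax+b$ of $K$ with $a\in K^\times$, $b\in K$, under composition. For $\gamma:x\mapsto ax+b$ write $a(\gamma):=a$ (the linear part). $\mu(K)$ is the group of roots of unity of $K$. For a subset $E$ of a group, $\langle E\rangle_{\mathrm{grp}}$ and $\langle E\rangle_+$ denote the subgroup and the subsemigroup generated by $E$. The measure $\eta$ is supported on pairs $g=(g_1,g_2)$ with $a(g_1)=a(g_2)$; write $a(g):=a(g_1)=a(g_2)$. $a_*\eta$ is the pushforward of $\eta$ to $K^\times$ under $a$, and $A=\langle\mathrm{supp}(a_*\eta)\rangle_{\mathrm{grp}}\subset K^\times$. The free rank $r$ of $A$ is defined by $A/\mathrm{Tor}(A)\simeq\mathbb{Z}^r$. The measure $a_*\eta$ is called centered if $\int\chi(t)\,d(a_*\eta)(t)=0$ for every group homomorphism $\chi:A\to\mathbb{R}$. The random walk driven by $\eta$ is $L_n=X_n\cdots X_1$, where the $X_i$ are independent $\mathrm{Aff}(K)^2$-valued random variables of law $\eta$; write $L_n=(L_{n,1},L_{n,2})$. For $\alpha,\beta$ in a group, $\langle\alpha,\beta\rangle_+$ is said to be free if any two distinct non-empty words in the letters $\alpha$ and $\beta$ define distinct elements of the group. *)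

(* Defs.v *)
From HB Require Import structures.
From mathcomp Require Import all_boot all_order all_algebra.
From mathcomp Require Import finmap.
From mathcomp Require Import all_classical all_reals all_analysis.

Set Implicit Arguments.
Unset Strict Implicit.
Unset Printing Implicit Defensive.

Import Order.TTheory GRing.Theory Num.Theory.

Local Open Scope classical_set_scope.
Local Open Scope ring_scope.

Section Groups.
Context {G : groupType}.
Local Open Scope group_scope.
Implicit Types (E H A C D : set G) (x : G).

Definition gen_group E : set G :=
  smallest [set H | group_closed (mem H)] E.

Definition torsion A : set G :=
  [set x | A x /\ exists2 n : nat, (0 < n)%N & x ^+ n = 1].

Definition setmul C D : set G := [set x * y | x in C & y in D].

Definition cosets A H : set (set G) := [set setmul [set x] H | x in A].

(* [A / Tor A] is isomorphic to [Z ^ r], the quotient being the set of cosets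
   with elementwise product. *)
Definition is_free_rank A (r : nat) : Prop :=
  exists psi : set G -> 'rV[int]_r,
    set_bij (cosets A (torsion A)) setT psi /\
    forall C D, cosets A (torsion A) C -> cosets A (torsion A) D ->
      psi (setmul C D) = (psi C + psi D)%R.

(* A word is a sequence of booleans: [true] is the letter [alpha], [false] the
   letter [beta]. *)
Definition word_value (alpha beta : G) (w : seq bool) : G :=
  \prod_(b <- w) (if b then alpha else beta).

Definition free_semigroup (alpha beta : G) : Prop :=
  forall v w : seq bool, v <> [::] -> w <> [::] -> v <> w ->
    word_value alpha beta v <> word_value alpha beta w.

End Groups.

Section MultiplicativeGroup.
Variable K : fieldType.

(* The multiplicative group of [K]. *)
Record kstar := KStar { kval :> K; kval_neq0 : kval != 0 }.

HB.instance Definition _ := [isSub for kval].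
HB.instance Definition _ := [Choice of kstar by <:].

Implicit Types s t : kstar.

Definition kstar1 : kstar := KStar (oner_neq0 K).

Fact kstar_mul_subproof s t : kval s * kval t != 0.
Proof. by rewrite mulf_neq0 ?kval_neq0. Qed.
Definition kstar_mul s t : kstar := KStar (kstar_mul_subproof s t).

Fact kstar_inv_subproof t : (kval t)^-1 != 0.
Proof. by rewrite invr_neq0 ?kval_neq0. Qed.
Definition kstar_inv t : kstar := KStar (kstar_inv_subproof t).

Fact kstar_mulA : associative kstar_mul.
Proof. by move=> s t u; apply/val_inj; rewrite /= mulrA. Qed.
Fact kstar_mul1 : left_id kstar1 kstar_mul.
Proof. by move=> t; apply/val_inj; rewrite /= mul1r. Qed.
Fact kstar_mulr1 : right_id kstar1 kstar_mul.
Proof. by move=> t; apply/val_inj; rewrite /= mulr1. Qed.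
Fact kstar_mulV : left_inverse kstar1 kstar_inv kstar_mul.
Proof. by move=> t; apply/val_inj; rewrite /= mulVf ?kval_neq0. Qed.
Fact kstar_mulrV : right_inverse kstar1 kstar_inv kstar_mul.
Proof. by move=> t; apply/val_inj; rewrite /= mulfV ?kval_neq0. Qed.

HB.instance Definition _ := isGroup.Build kstar
  kstar_mulA kstar_mul1 kstar_mulr1 kstar_mulV kstar_mulrV.

HB.instance Definition _ := isPointed.Build kstar 1%g.
HB.instance Definition _ := @isMeasurable.Build default_measure_display
  kstar discrete_measurable discrete_measurable0
  discrete_measurableC discrete_measurableU.

(* Every element is a [0.-unity_root], hence the condition [0 < n]. *)
Definition roots_of_unity : set kstar :=
  [set t | exists2 n : nat, (0 < n)%N & n.-unity_root (kval t)].

End MultiplicativeGroup.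

Section AffineGroup.
Variable K : fieldType.

(* [Aff a b] is the map [x |-> a * x + b]. *)
Record aff := Aff { lin : kstar K; trans : K }.

Definition aff_fun (g : aff) (x : K) : K := kval (lin g) * x + trans g.
Coercion aff_fun : aff >-> Funclass.

Definition aff_pair (g : aff) := (lin g, trans g).
Definition pair_aff (p : kstar K * K) := Aff p.1 p.2.
Fact aff_pairK : cancel aff_pair pair_aff.
Proof. by case. Qed.

HB.instance Definition _ := Choice.copy aff (can_type aff_pairK).

Implicit Types g h : aff.

Definition aff_one : aff := Aff 1%g 0.
Definition aff_mul g h : aff := Aff (lin g * lin h)%g (g (trans h)).
Definition aff_inv g : aff :=
  Aff (lin g)^-1%g (- ((kval (lin g))^-1 * trans g)).

Fact aff_mulA : associative aff_mul.
Proof.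
move=> g h k; congr Aff; first exact: mulgA.
by rewrite /= /aff_fun /= mulrDr mulrA addrA.
Qed.
Fact aff_mul1 : left_id aff_one aff_mul.
Proof.
by case=> a b; congr Aff; rewrite ?mul1g // /aff_fun /= mul1r addr0.
Qed.
Fact aff_mulr1 : right_id aff_one aff_mul.
Proof.
by case=> a b; congr Aff; rewrite ?mulg1 // /aff_fun /= mulr0 add0r.
Qed.
Fact aff_mulV : left_inverse aff_one aff_inv aff_mul.
Proof.
by case=> a b; congr Aff; rewrite ?mulVg // /aff_fun /= subrr.
Qed.
Fact aff_mulrV : right_inverse aff_one aff_inv aff_mul.
Proof.
case=> a b; congr Aff; rewrite ?mulgV // /aff_fun /=.
by rewrite mulrN mulVKf ?kval_neq0 // addNr.
Qed.

HB.instance Definition _ := isGroup.Build aff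
  aff_mulA aff_mul1 aff_mulr1 aff_mulV aff_mulrV.

(* The group law of [aff K] is composition of maps. *)
Lemma aff_funM g h (x : K) : (g * h)%g x = g (h x).
Proof. by rewrite /aff_fun /= mulrDr mulrA addrA. Qed.

Lemma aff_fun_inj : injective aff_fun.
Proof.
move=> [a b] [c e] /funeqP eqgh.
have /= := eqgh 0; rewrite /aff_fun /= !mulr0 !add0r => eqbe.
have /= := eqgh 1; rewrite /aff_fun /= !mulr1 eqbe => /addIr eqac.
by congr Aff => //; apply/val_inj.
Qed.

(* [aff K] carries the discrete sigma-algebra, and [aff K * aff K] the library's
   product sigma-algebra, in which finite sets are measurable. *)
HB.instance Definition _ := isPointed.Build aff 1%g.
HB.instance Definition _ := @isMeasurable.Build default_measure_display
  aff discrete_measurable discrete_measurable0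
  discrete_measurableC discrete_measurableU.

(* On [supp eta] both components have the same linear part. *)
Definition lin2 (g : aff * aff) : kstar K := lin g.1.

Fact measurable_lin2 : measurable_fun [set: aff * aff] lin2.
Proof.
have -> : lin2 = lin \o fst by [].
by apply: measurableT_comp => //; exact: measurable_fst.
Qed.

HB.instance Definition _ :=
  isMeasurableFun.Build _ _ (aff * aff)%type (kstar K) lin2 measurable_lin2.

End AffineGroup.

Section Measures.
Context {R : realType}.

Definition finitely_supported d (T : measurableType d)
    (mu : probability T R) : Prop :=
  exists2 F : set T, finite_set F & mu (~` F) = 0%E.

(* The support of a finitely supported measure is its set of atoms. *)
Definition supp d (T : measurableType d) (mu : probability T R) : set T :=
  [set x | (0 < mu [set x])%E].

Definition independent_seq d d' (Omega : measurableType d)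
    (T : measurableType d') (P : probability Omega R)
    (X : nat -> {RV P >-> T}) : Prop :=
  forall (J : {fset nat}) (B : nat -> set T),
    (forall j, measurable (B j)) ->
    P (\bigcap_(j in [set` J]) (X j @^-1` B j)) =
    (\prod_(j <- J) P (X j @^-1` B j))%E.

Section AffineMeasures.
Variables (K : fieldType) (eta : probability (aff K * aff K)%type R).

(* The pushforward of [eta] under the linear part. *)
Definition lin_law : probability (kstar K) R := distribution eta (@lin2 K).

Definition lin_group : set (kstar K) := gen_group (supp lin_law).

(* Homomorphisms from [lin_group] to [R] are represented by functions on the
   whole of [kstar K] that are additive on [lin_group]; their values elsewhere
   play no role. *)
Definition centered : Prop :=
  forall chi : kstar K -> R,
    {in lin_group &, forall s t, chi (s * t)%g = chi s + chi t} ->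
    (\int[lin_law]_(t in lin_group) (chi t)%:E = 0)%E.

End AffineMeasures.

Section RandomWalk.
Context d (Omega : measurableType d) (P : probability Omega R).
Variables (K : fieldType) (X : nat -> {RV P >-> (aff K * aff K)%type}).

(* The increments are numbered from 0: [walk n] is the product
   [X (n - 1) * ... * X 0], newest factor on the left. *)
Fixpoint walk (n : nat) (w : Omega) : aff K * aff K :=
  if n is m.+1 then (X m w * walk m w)%g else 1%g.

End RandomWalk.

End Measures.

(* Main.v *)
From HB Require Import structures.
Require Import Defs.
From mathcomp Require Import all_boot all_order all_algebra.
From mathcomp Require Import finmap separable lra zify.
From mathcomp Require Import all_classical all_reals all_analysis measurable_realfun.

Set Implicit Arguments.
Unset Strict Implicit.
Unset Printing Implicit Defensive.

Import Order.TTheory GRing.Theory Num.Theory.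
Import numFieldNormedType.Exports.

Local Open Scope classical_set_scope.
Local Open Scope ring_scope.

(** Two affine maps with the same linear part [t] and different translation parts
   generate a free semigroup unless [t] is a flat root, that is, a root of a nonzero
   polynomial with coefficients in [{-1, 0, 1}]: two words of the same length differ
   by the value at [t] of such a polynomial times the difference of the translation
   parts. Two translations commute. So the question is whether the linear part [t_n]
   of the walk visits flat roots of the finitely generated group [A] infinitely
   often, and whether the offset [D_n], the difference of the translation parts,
   vanishes infinitely often.

   The group [A] contains finitely many flat roots ([flat_roots_finite]). In positive
   characteristic they are roots of unity. In characteristic zero they are algebraic
   integers of one number field, all of whose conjugates have modulus less than 2, and
   there are finitely many of these.

   If the walk [t_n] is transient, it leaves the flat roots for good. When it is not
   centered, transience holds because some character has a drift ([drift_transient]);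
   when it is centered of rank at least 3, because [1 / ln q] is strictly superharmonic
   far away, for the quadratic form [q] given by the inverse covariance matrix
   ([centered_transient]). If the walk is centered of rank at most 2, then [ln (ln q)]
   is strictly superharmonic outside a finite set and tends to infinity, and the walk
   returns to 1 infinitely often ([centered_walk_recurrent]): the semigroup is then not
   free infinitely often ([recurrent_not_eventually_free]).

   It remains to see that [D_n] is eventually nonzero in the transient case. It evolves
   by random affine maps. If these have a common fixed point [c], then
   [D_n = (1 - t_n) * c]. Otherwise two of them do not commute, and the two orders of
   applying them are exchangeable steps with the same linear part whose effects differ
   by a fixed nonzero [v]. There is a character [chi] of [A] such that elements on
   which its values are at distance at least 1 admit no nontrivial relation with
   coefficients in [{-1, 0, 1}] ([level_character]): it comes from a valuation if some
   element of [A] is not integral, and otherwise from an archimedean absolute value,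
   by Kronecker's theorem. Each time the walk meets a new level of [chi], the choice
   between the exchangeable steps adds [v * t] or not, with a new [t], and different
   choices never lead to the same sum; so the event [D_n = 0] is exponentially small
   in the number of levels met, which grows at least like a power of [n]
   ([affine_return_summable]). The Borel-Cantelli lemma concludes
   ([transient_eventually_free]).

   Probabilities are computed with the transfer operator of the walk, acting on
   functions by finite sums over the atoms of the law of the increments; independence
   enters in [path_event_law] only. *)

(** * Finite-support Markov operators *)

Section Averages.
Context {R : realType} {T : eqType} (ls : seq T) (p : T -> R).

Definition avg (h : T -> R) : R := \sum_(l <- ls) p l * h l.

Definition weights : Prop := (forall l, 0 <= p l) /\ \sum_(l <- ls) p l = 1.

(** The Markov operator of the chain that reads letters of [ls] with law [p]: its
   [n]-th iterate gives expectations at time [n]. *)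
Definition transfer S (step : S -> T -> S) (f : S -> R) : S -> R :=
  fun x => avg (fun l => f (step x l)).

Hypothesis pP : weights.
Let p_ge0 l : 0 <= p l. Proof. by case: pP. Qed.

Lemma ler_avg h h' : {in ls, forall l, h l <= h' l} -> avg h <= avg h'.
Proof. by move=> hh; rewrite /avg !big_seq ler_sum// => l ll; rewrite ler_wpM2l ?hh. Qed.

Lemma eq_avg h h' : {in ls, forall l, h l = h' l} -> avg h = avg h'.
Proof. by move=> hh; apply/le_anti/andP; split; apply: ler_avg => l /hh->. Qed.

Lemma avg_cst c : avg (fun=> c) = c.
Proof. by rewrite /avg -mulr_suml; case: pP => _ ->; rewrite mul1r. Qed.

Lemma avgD h h' : avg (fun l => h l + h' l) = avg h + avg h'.
Proof. by rewrite /avg -big_split; apply: eq_bigr => l _; rewrite mulrDr. Qed.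

Lemma avgZ c h : avg (fun l => c * h l) = c * avg h.
Proof. by rewrite /avg mulr_sumr; apply: eq_bigr => l _; rewrite mulrCA. Qed.

Lemma avgN h : avg (fun l => - h l) = - avg h.
Proof. by rewrite /avg -sumrN; apply: eq_bigr => l _; rewrite mulrN. Qed.

Lemma avgB h h' : avg (fun l => h l - h' l) = avg h - avg h'.
Proof. by rewrite avgD avgN. Qed.

Lemma avg_ge0 h : {in ls, forall l, 0 <= h l} -> 0 <= avg h.
Proof. by move=> h0; rewrite -(avg_cst 0); exact: ler_avg. Qed.

Lemma avg_gt0 h l : {in ls, forall l, 0 <= h l} -> l \in ls -> 0 < p l ->
  0 < h l -> 0 < avg h.
Proof.
move=> h0 lls pl hl; rewrite /avg (big_rem l)//= ltr_pwDl ?mulr_gt0//.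
rewrite big_seq sumr_ge0// => k /mem_rem kls.
by rewrite mulr_ge0// h0.
Qed.

Lemma avg_max h c : avg h = c -> {in ls, forall l, h l <= c} ->
  {in ls, forall l, 0 < p l -> h l = c}.
Proof.
move=> hc hle l lls pl; apply/eqP; rewrite eq_le hle//= leNgt; apply/negP => hlt.
suff: 0 < avg (fun l => c - h l) by rewrite avgB avg_cst hc subrr ltxx.
by apply: (avg_gt0 (l := l)) => // [k kls|]; rewrite ?subr_ge0 ?subr_gt0// hle.
Qed.

Section Steps.
Context {S : Type} (step : S -> T -> S).
Local Notation Tr := (transfer step).
Implicit Types f g : S -> R.

Lemma iter_transferS n f x :
  iter n.+1 Tr f x = avg (fun l => iter n Tr f (step x l)).
Proof. by []. Qed.

Lemma iter_transfer_le n f g : (forall x, f x <= g x) ->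
  forall x, iter n Tr f x <= iter n Tr g x.
Proof.
move=> fg; elim: n => [|n IH] x; first exact: fg.
by rewrite !iter_transferS; apply: ler_avg => l _; exact: IH.
Qed.

Lemma iter_transfer_cst n c x : iter n Tr (fun=> c) x = c.
Proof.
elim: n x => // n IH x; rewrite iter_transferS.
by rewrite (eq_avg (h' := fun=> c)) ?avg_cst.
Qed.

Lemma iter_transferD n f g x :
  iter n Tr (fun x => f x + g x) x = iter n Tr f x + iter n Tr g x.
Proof.
elim: n x => // n IH x; rewrite !iter_transferS -avgD.
by apply: eq_avg => l _; rewrite IH.
Qed.

Lemma iter_transferZ n c f x :
  iter n Tr (fun x => c * f x) x = c * iter n Tr f x.
Proof.
elim: n x => // n IH x; rewrite !iter_transferS -avgZ.
by apply: eq_avg => l _; rewrite IH.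
Qed.

Lemma eq_iter_transfer n f g : (forall x, f x = g x) ->
  forall x, iter n Tr f x = iter n Tr g x.
Proof. by move=> /funext ->. Qed.

Lemma iter_transfer_ge0 n f : (forall x, 0 <= f x) ->
  forall x, 0 <= iter n Tr f x.
Proof. by move=> f0 x; rewrite -(iter_transfer_cst n 0 x); exact: iter_transfer_le. Qed.

(** A process that is the image under [phi] of another one has the same law. *)
Lemma iter_transfer_morph S' (step' : S' -> T -> S') (phi : S -> S')
    (inv : S -> Prop) n (f : S' -> R) x :
  (forall x l, l \in ls -> inv x -> inv (step x l)) ->
  (forall x l, l \in ls -> inv x -> phi (step x l) = step' (phi x) l) ->
  inv x ->
  iter n Tr (fun x => f (phi x)) x = iter n (transfer step') f (phi x).
Proof.
move=> invS phiS; elim: n x => // n IH x ix; rewrite !iter_transferS.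
by apply: eq_avg => l ll; rewrite -phiS// IH//; exact: invS.
Qed.

End Steps.

(** If a bounded function [F] is superharmonic and strictly so at [x1], then
   each visit to [x1] lowers the expectation of [F] by a fixed amount, so that
   the expected number of visits to [x1], from any starting point, is finite.
   Translating, the same bound holds for the visits to any point. *)
Lemma green_bound (V : zmodType) (Y : T -> V) (F : V -> R) c x1 :
  let Tr := transfer (fun x l => x + Y l) in
  (forall x, 0 <= F x <= c) -> (forall x, Tr F x <= F x) -> Tr F x1 < F x1 ->
  forall y N, \sum_(n < N) iter n Tr (fun x => (x == y)%:R) 0 <=
    c / (F x1 - Tr F x1).
Proof.
move=> Tr Fc Fsup Fx1 y N; set e := F x1 - Tr F x1.
have e0 : 0 < e by rewrite subr_gt0.
have shift n f a x : iter n Tr (fun z => f (z + a)) x = iter n Tr f (x + a).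
  elim: n x => // n IH x; rewrite !iter_transferS.
  by apply: eq_avg => l _; rewrite IH addrAC.
rewrite ler_pdivlMr// mulrC mulr_sumr.
pose x := x1 - y.
have visit n : e * iter n Tr (fun x => (x == y)%:R) 0 <=
    iter n Tr F x - iter n.+1 Tr F x.
  have -> : iter n Tr (fun x => (x == y)%:R) 0 =
      iter n Tr (fun x => (x == x1)%:R) x.
    rewrite -[x]add0r -shift; apply: eq_iter_transfer => z.
    by rewrite /x addrA subr_eq (addrC x1) (inj_eq (addIr _)).
  rewrite iterSr -mulN1r -[X in _ + X]iter_transferZ -iter_transferD.
  rewrite -iter_transferZ; apply: iter_transfer_le => z; rewrite mulN1r.
  have [->|] := eqVneq z x1; first by rewrite mulr1.
  by rewrite mulr0 subr_ge0.
apply: (le_trans (ler_sum _ (fun (n : 'I_N) _ => visit n))).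
rewrite -(big_mkord xpredT (fun n => iter n Tr F x - iter n.+1 Tr F x)).
rewrite -[leLHS]opprK -sumrN (eq_bigr (fun n => iter n.+1 Tr F x - iter n Tr F x)); last first.
  by move=> n _; rewrite opprB.
rewrite telescope_sumr// opprB/= (le_trans _ (_ : F x <= c)) ?gerBl//; last first.
  by case/andP: (Fc x).
by apply: iter_transfer_ge0 => z; case/andP: (Fc z).
Qed.

(** Transience from a function [Z], large somewhere, whose inverse is strictly
   superharmonic where [Z] is large: [1 / max Z z0] is then superharmonic. *)
Lemma transient_of_inv (V : zmodType) (Y : T -> V) (Z : V -> R) z0 x1 :
  0 < z0 -> z0 < Z x1 ->
  (forall x, z0 < Z x -> {in ls, forall l, 0 < Z (x + Y l)} /\
     avg (fun l => (Z (x + Y l))^-1) < (Z x)^-1) ->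
  exists C, forall y N,
    \sum_(n < N) iter n (transfer (fun x l => x + Y l)) (fun x => (x == y)%:R) 0
      <= C.
Proof.
move=> z00 Zx1 Zsup.
pose F x := (Num.max z0 (Z x))^-1.
have max0 x : 0 < Num.max z0 (Z x) by rewrite lt_max z00.
have Flt x : z0 < Z x -> transfer (fun x l => x + Y l) F x < F x.
  move=> zx; have [Zp Zlt] := Zsup _ zx.
  rewrite {2}/F (max_idPr (ltW zx)) (le_lt_trans _ Zlt)//; apply: ler_avg => l /Zp Zl.
  by rewrite /F lef_pV2 ?posrE// le_max lexx orbT.
exists (z0^-1 / (F x1 - transfer (fun x l => x + Y l) F x1)) => y N.
have FB x : 0 <= F x <= z0^-1.
  by rewrite /F invr_ge0 ltW//= lef_pV2 ?posrE// le_max lexx.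
apply: green_bound => // [x|]; last exact: Flt.
have [/Flt/ltW//|Zx] := ltP z0 (Z x).
rewrite {2}/F (max_idPl Zx) -(avg_cst z0^-1); apply: ler_avg => l _.
by case/andP: (FB (x + Y l)).
Qed.

End Averages.

(** * Logarithmic Lyapunov functions *)

Section Logarithm.
Context {R : realType}.
Implicit Types u x : R.

Let is_derive_ln1D x : -1 < x ->
  is_derive x (1 : R) (fun y : R => ln (1 + y)) (1 + x)^-1.
Proof.
move=> x1; have x0 : 0 < (cst 1 + id : R -> R) x by rewrite /cst !fctE; lra.
have Hln := is_derive1_ln x0.
have H1 : is_derive x (1 : R) (cst 1 + id : R -> R) (0 + 1) by exact: is_deriveD.
have := @is_derive1_comp _ (@ln R) (cst 1 + id) x _ _ Hln H1.
by rewrite add0r mulr1.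
Qed.

Let min_at0 (f df : R -> R) a : a < 0 ->
  (forall x, a < x -> is_derive x (1 : R) f (df x)) ->
  (forall x, a < x -> 0 <= df x * x) -> forall u, a < u -> f 0 <= f u.
Proof.
move=> a0 dfP df0 u au.
have cont x : a < x -> {for x, continuous f}.
  move=> /dfP dx; apply: differentiable_continuous; apply/derivable1_diffP.
  exact: ex_derive.
have [u0|u0|->//] := ltrgtP 0 u.
- have [x xI eqf] : exists2 c, c \in `]0, u[%R & f u - f 0 = df c * (u - 0).
    apply: MVT => // [x|].
      by rewrite in_itv/= => /andP[x0 _]; apply: dfP; lra.
    apply/continuous_in_subspaceT => x; rewrite inE/= in_itv/= => /andP[x0 _].
    by apply: cont; lra.
  move: xI; rewrite in_itv/= => /andP[x0 xu].
  have := df0 x; rewrite pmulr_lge0// => dx.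
  rewrite -subr_ge0 eqf mulr_ge0 ?subr_ge0 ?(ltW u0)// dx//; lra.
- have [x xI eqf] : exists2 c, c \in `]u, 0[%R & f 0 - f u = df c * (0 - u).
    apply: MVT => // [x|].
      by rewrite in_itv/= => /andP[x0 _]; apply: dfP; lra.
    apply/continuous_in_subspaceT => x; rewrite inE/= in_itv/= => /andP[x0 _].
    by apply: cont; lra.
  move: xI; rewrite in_itv/= => /andP[ux x0].
  have := df0 x; rewrite nmulr_lge0// => dx.
  rewrite -subr_le0 eqf mulr_le0_ge0 ?subr_ge0 ?(ltW u0)// dx//; lra.
Qed.

Let is_derive_poly (c1 c2 c3 c4 x : R) :
  is_derive x (1 : R) (fun y : R => c1 * y + c2 * y ^+ 2 + c3 * y ^+ 3 + c4 * y ^+ 4)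
    (c1 + c2 * (2 * x) + c3 * (3 * x ^+ 2) + c4 * (4 * x ^+ 3)).
Proof.
have mono (c : R) n : is_derive x (1 : R) (c *: (id ^+ n : R -> R))
    (c *: ((n%:R * x ^+ n.-1) *: 1)).
  by apply: is_deriveZ; apply: is_deriveX.
have H := is_deriveD (is_deriveD (is_deriveD (mono c1 1) (mono c2 2)) (mono c3 3)) (mono c4 4).
have E : (fun y : R => c1 * y + c2 * y ^+ 2 + c3 * y ^+ 3 + c4 * y ^+ 4) =
  c1 *: (id ^+ 1 : R -> R) + c2 *: (id ^+ 2 : R -> R) +  c3 *: (id ^+ 3 : R -> R) +
    c4 *: (id ^+ 4 : R -> R).
  by apply/funext => y.
rewrite E; apply: is_derive_eq H _.
by rewrite /GRing.scale/=; lra.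
Qed.

Lemma ln1D_le u : -1 < u -> ln (1 + u) <= u - u ^+ 2 / 2 + u ^+ 3 / 3.
Proof.
move=> u1.
pose g := fun y : R => 1 * y + (- 2^-1) * y ^+ 2 + 3^-1 * y ^+ 3 + 0 * y ^+ 4.
pose dg x : R := 1 + (- 2^-1) * (2 * x) + 3^-1 * (3 * x ^+ 2) + 0 * (4 * x ^+ 3).
have : g 0 - ln (1 + 0) <= g u - ln (1 + u); last first.
  by rewrite addr0 ln1 /g !expr0n/=; lra.
apply: (@min_at0 (fun x => g x - ln (1 + x)) (fun x => dg x - (1 + x)^-1) (-1)).
- lra.
- move=> x x1.
  by have := is_deriveB (is_derive_poly 1 (- 2^-1) 3^-1 0 x) (is_derive_ln1D x1).
- move=> x x1; have x0 : 0 < 1 + x by lra.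
  have -> : (dg x - (1 + x)^-1) * x = x ^+ 4 / (1 + x).
    apply: (mulIf (lt0r_neq0 x0)); rewrite divfK ?lt0r_neq0//.
    rewrite mulrAC mulrBl mulVf ?lt0r_neq0// /dg; lra.
  by rewrite divr_ge0 ?(ltW x0)// exprn_even_ge0.
- exact: u1.
Qed.

Lemma ln1D_ge u : `|u| <= 2^-1 -> u - u ^+ 2 / 2 - `|u| ^+ 3 <= ln (1 + u).
Proof.
move=> u1; have u34 : - (3 / 4) < u by move: u1; rewrite ler_norml; lra.
pose g := fun y : R => (-1) * y + 2^-1 * y ^+ 2 + (- 3^-1) * y ^+ 3 + 1 * y ^+ 4.
pose dg x : R := (-1) + 2^-1 * (2 * x) + (- 3^-1) * (3 * x ^+ 2) + 1 * (4 * x ^+ 3).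
have H : ln (1 + 0) + g 0 <= ln (1 + u) + g u.
  apply: (@min_at0 (fun x => ln (1 + x) + g x) (fun x => (1 + x)^-1 + dg x) (- (3 / 4))).
  - lra.
  - move=> x x1; have x1' : -1 < x by lra.
    by have := is_deriveD (is_derive_ln1D x1') (is_derive_poly (-1) 2^-1 (- 3^-1) 1 x).
  - move=> x x1; have x0 : 0 < 1 + x by lra.
    have -> : ((1 + x)^-1 + dg x) * x = x ^+ 4 * (3 + 4 * x) / (1 + x).
      apply: (mulIf (lt0r_neq0 x0)); rewrite divfK ?lt0r_neq0//.
      rewrite mulrAC mulrDl mulVf ?lt0r_neq0// /dg; lra.
    by rewrite divr_ge0 ?(ltW x0)// mulr_ge0 ?exprn_even_ge0//; lra.
  - exact: u34.
move: H; rewrite addr0 ln1 /g !expr0n/= => H.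
have : u ^+ 3 <= `|u| ^+ 3 by rewrite -normrX ler_norm.
have : - u ^+ 3 <= `|u| ^+ 3 by rewrite -normrX -normrN ler_norm.
have : u ^+ 4 <= 2^-1 * `|u| ^+ 3.
  have -> : u ^+ 4 = `|u| * `|u| ^+ 3 by rewrite -exprS -normrX ger0_norm// exprn_even_ge0.
  by rewrite ler_wpM2r ?exprn_ge0.
lra.
Qed.

End Logarithm.

Section LogMoments.
Context {R : realType}.
Implicit Types (b k c s L : R).

(** Increments of [ln q] for a quadratic form [q] at a point where [q = s^-2]:
   an increment of [q] relative to [q] has the form [2 b s + k s ^ 2]. *)
Definition log_step s b k := ln (1 + (2 * b * s + k * s ^+ 2)).

Let u_bounds c s b k : 1 <= c -> 0 < s -> 6 * c * s <= 1 -> `|b| <= c -> 0 <= k <= c ^+ 2 ->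
  let u := 2 * b * s + k * s ^+ 2 in
  [/\ `|u| <= 3 * (c * s), `|u| <= 2^-1 & `|u| ^+ 3 <= 27 * (c ^+ 3 * s ^+ 3)] /\
  (4 * b ^+ 2 * s ^+ 2 - 4 * (c ^+ 3 * s ^+ 3) <= u ^+ 2
     <= 4 * b ^+ 2 * s ^+ 2 + 5 * (c ^+ 3 * s ^+ 3)).
Proof.
move=> c1 s0 cs1 bc /andP[k0 kc] u.
have c0 : 0 < c by have := c1; lra.
have cs0 : 0 < c * s by rewrite mulr_gt0.
have bs : `|b * s| <= c * s by rewrite normrM (gtr0_norm s0) ler_wpM2r// ltW.
have ks : 0 <= k * s ^+ 2 <= (c * s) ^+ 2.
  by rewrite mulr_ge0 ?sqr_ge0//= exprMn; apply: ler_wpM2r => //; exact: sqr_ge0.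
have cs2 : (c * s) ^+ 2 <= (c * s) * 6^-1 by rewrite expr2 ler_wpM2l; lra.
have u3 : `|u| <= 3 * (c * s).
  by move: bs ks; rewrite /u !ler_norml; lra.
split; first split=> //; first by lra.
  rewrite (_ : 27 * _ = (3 * (c * s)) ^+ 3); last by lra.
  by rewrite lerXn2r ?nnegrE//; lra.
have -> : u ^+ 2 = 4 * b ^+ 2 * s ^+ 2 + 4 * ((b * s) * (k * s ^+ 2)) + (k * s ^+ 2) ^+ 2.
  by rewrite /u; lra.
have bks : `|(b * s) * (k * s ^+ 2)| <= (c * s) * (c * s) ^+ 2.
  rewrite normrM ler_pM//; case/andP: ks => ks0 ks1.
  by rewrite ger0_norm.
have kk0 := sqr_ge0 (k * s ^+ 2).
have kk : (k * s ^+ 2) ^+ 2 <= (c * s) * (c * s) ^+ 2.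
  case/andP: ks => ks0 ks1.
  rewrite expr2 ler_pM// (le_trans ks1)//; lra.
move: bks; rewrite ler_norml; lra.
Qed.

Lemma log_step_bounds c s b k :
  1 <= c -> 0 < s -> 6 * c * s <= 1 -> `|b| <= c -> 0 <= k <= c ^+ 2 ->
  [/\ 0 < 1 + (2 * b * s + k * s ^+ 2),
      log_step s b k <= 2 * b * s + k * s ^+ 2 - 2 * b ^+ 2 * s ^+ 2 + 29 * (c ^+ 3 * s ^+ 3),
      2 * b * s + k * s ^+ 2 - 2 * b ^+ 2 * s ^+ 2 - 30 * (c ^+ 3 * s ^+ 3) <= log_step s b k,
      `|log_step s b k| <= 6 * (c * s) &
      b ^+ 2 * s ^+ 2 - c ^+ 3 * s ^+ 3 <= log_step s b k ^+ 2].
Proof.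
move=> c1 s0 cs1 bc kc.
have [] := u_bounds c1 s0 cs1 bc kc.
rewrite /log_step; set u := 2 * b * s + _ => -[u3 u2 uu3] /andP[lo up].
have cs0 : 0 < c * s by rewrite mulr_gt0//; lra.
have u1 : -1 < u by move: u2; rewrite ler_norml; lra.
have hi := ln1D_le u1; have low := ln1D_ge u2.
set L := ln (1 + u) in hi low *.
have n0 := normr_ge0 u.
have a3 : u ^+ 3 <= `|u| ^+ 3 by rewrite -normrX ler_norm.
have a2 : u ^+ 2 = `|u| ^+ 2 by rewrite real_normK ?num_real.
have b2 : `|u| ^+ 2 <= 2^-1 * `|u| by rewrite expr2 ler_wpM2r.
have b3 : `|u| ^+ 3 <= 4^-1 * `|u|.
  rewrite exprS mulrC ler_wpM2r// (le_trans b2)//; lra.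
have n3 : 0 <= `|u| ^+ 3 by rewrite exprn_ge0.
have n2 : 0 <= `|u| ^+ 2 by rewrite exprn_ge0.
have Lu : L ^+ 2 >= (u / 2) ^+ 2.
  have [u0|u0] := leP 0 u.
    have e : `|u| = u by rewrite ger0_norm.
    by rewrite lerXn2r ?nnegrE//; rewrite e in a2 b2 b3 n0 low; lra.
  have e : `|u| = - u by rewrite ltr0_norm.
  have c3 : u ^+ 3 <= 0.
    by rewrite exprSr; apply: mulr_ge0_le0; [exact: sqr_ge0|exact: ltW].
  by rewrite -[leRHS]sqrrN -[leLHS]sqrrN lerXn2r ?nnegrE//; lra.
have Labs : `|L| <= 6 * (c * s).
  rewrite ler_norml; rewrite a2 in low hi.
  have : u <= `|u| by rewrite ler_norm.
  have : - `|u| <= u by rewrite lerNnormlW.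
  lra.
split=> //; lra.
Qed.

Section Moments.
Context {T : eqType} (ls : seq T) (p : T -> R) (b k : T -> R) (c d : R).
Hypothesis pP : weights ls p.
Local Notation avg := (avg ls p).
Hypotheses (c1 : 1 <= c) (b_avg : avg b = 0) (b2_avg : avg (fun l => b l ^+ 2) = 1)
  (k_avg : avg k = d) (b_le : {in ls, forall l, `|b l| <= c})
  (k_le : {in ls, forall l, 0 <= k l <= c ^+ 2}).

Let lam s l := log_step s (b l) (k l).

(** To second order in [s], the increment of [ln q] has mean [(d - 2) s ^ 2] and
   second moment [4 s ^ 2], so that the sign of [d - 2] separates transience from
   recurrence. *)
Lemma log_moments s : 0 < s -> 6 * c * s <= 1 ->
  [/\ avg (lam s) <= (d - 2) * s ^+ 2 + 29 * (c ^+ 3 * s ^+ 3),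
      (d - 2) * s ^+ 2 - 30 * (c ^+ 3 * s ^+ 3) <= avg (lam s) &
      s ^+ 2 - c ^+ 3 * s ^+ 3 <= avg (fun l => lam s l ^+ 2)].
Proof.
move=> s0 cs1.
have main (e : R) : avg (fun l => 2 * b l * s + k l * s ^+ 2 - 2 * b l ^+ 2 * s ^+ 2 + e) =
    (d - 2) * s ^+ 2 + e.
  rewrite (@eq_avg _ _ _ _ pP _ (fun l => (2 * s) * b l + (s ^+ 2 * k l +
    ((- 2 * s ^+ 2) * b l ^+ 2 + e)))); last by move=> l _; lra.
  by rewrite !avgD !avgZ !(avg_cst pP) b_avg b2_avg k_avg; lra.
split.
- rewrite -main; apply: (ler_avg pP) => l ll.
  by case: (log_step_bounds c1 s0 cs1 (b_le ll) (k_le ll)).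
- rewrite -main; apply: (ler_avg pP) => l ll.
  by case: (log_step_bounds c1 s0 cs1 (b_le ll) (k_le ll)).
- have -> : s ^+ 2 - c ^+ 3 * s ^+ 3 = avg (fun l => s ^+ 2 * b l ^+ 2 - c ^+ 3 * s ^+ 3).
    by rewrite avgB avgZ b2_avg (avg_cst pP) mulr1.
  apply: (ler_avg pP) => l ll; rewrite mulrC.
  by case: (log_step_bounds c1 s0 cs1 (b_le ll) (k_le ll)).
Qed.

(** In rank at least 3 the drift of [ln q] wins over its variance. *)
Lemma inv_log_strict s L : 3 <= d -> 0 < s -> 120 * c ^+ 3 * s <= 1 ->
  144 * c ^+ 2 + 1 <= L ->
  {in ls, forall l, 0 < L + lam s l} /\
  avg (fun l => (L + lam s l)^-1) < L^-1.
Proof.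
move=> d3 s0 cs1 Lbig.
have c0 : 0 < c by have := c1; lra.
have c3 : c <= c ^+ 3 by rewrite -[leLHS]expr1 ler_weXn2l.
have cs : 6 * c * s <= 1.
  apply: le_trans cs1; rewrite ler_wpM2r ?(ltW s0)//.
  by have := c3; have := c0; lra.
have c2 : 1 <= c ^+ 2 by rewrite exprn_ege1.
have small l : l \in ls -> `|lam s l| <= 6 * (c * s).
  by move=> ll; case: (log_step_bounds c1 s0 cs (b_le ll) (k_le ll)).
have L0 : 0 < L by lra.
have Llam l : l \in ls -> L - 1 <= L + lam s l.
  by move=> /small; rewrite ler_norml; lra.
split=> [l /Llam|]; first lra.
have [_ low _] := log_moments s0 cs.
pose e := 36 * (c * s) ^+ 2 / (L - 1).
have step l : l \in ls -> (L + lam s l)^-1 <= L^-1 - L^-2 * (lam s l - e).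
  move=> ll; have := Llam _ ll; have := small _ ll; move: (lam s l) => x xs Lx.
  have Lx0 : 0 < L + x by lra.
  have -> : (L + x)^-1 = L^-1 - L^-2 * (x - x ^+ 2 / (L + x)).
    have nL := lt0r_neq0 L0; have nLx := lt0r_neq0 Lx0.
    apply: (mulfI nL); apply: (mulfI nL); apply: (mulIf nLx).
    rewrite -[LHS]mulrA -mulrA mulVf // mulr1.
    rewrite (_ : L * (L * (L^-1 - L^-2 * (x - x ^+ 2 / (L + x)))) = L * (L / L) - (L / L) * (L / L) * (x - x ^+ 2 / (L + x))); last first.
      by rewrite expr2 invfM; lra.
    rewrite divff// !mulr1 !mul1r mulrBl mulrBl divfK//; lra.
  rewrite lerD2l lerN2 ler_wpM2l ?invr_ge0 ?sqr_ge0// lerD2l lerN2 /e.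
  apply: ler_pM; rewrite ?sqr_ge0 ?invr_ge0 ?(ltW Lx0)//.
    rewrite -[leLHS]real_normK ?num_real// (_ : 36 * _ = (6 * (c * s)) ^+ 2); last by lra.
    by rewrite lerXn2r ?nnegrE// mulr_ge0// mulr_ge0 ?ltW.
  by rewrite lef_pV2 ?posrE//; lra.
rewrite (le_lt_trans (ler_avg pP step))// avgB (avg_cst pP) avgZ avgB (avg_cst pP).
rewrite ltrBlDr ltrDl mulr_gt0 ?invr_gt0 ?exprn_gt0// subr_gt0.
apply: lt_le_trans low.
have s2 : 0 < s ^+ 2 by rewrite exprn_gt0.
have e4 : e <= 4^-1 * s ^+ 2.
  rewrite /e ler_pdivrMr; last by lra.
  rewrite exprMn (_ : 36 * _ = s ^+ 2 * (36 * c ^+ 2)); last by lra.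
  rewrite (_ : 4^-1 * _ * _ = s ^+ 2 * (4^-1 * (L - 1))); last by lra.
  by rewrite ler_wpM2l ?(ltW s2)//; lra.
have cs3 : 30 * (c ^+ 3 * s ^+ 3) <= 4^-1 * s ^+ 2.
  rewrite (_ : 30 * _ = s ^+ 2 * (30 * c ^+ 3 * s)); last by lra.
  rewrite (_ : 4^-1 * _ = s ^+ 2 * 4^-1); last by lra.
  by rewrite ler_wpM2l ?(ltW s2)//; lra.
have : 1 * s ^+ 2 <= (d - 2) * s ^+ 2 by rewrite ler_wpM2r ?(ltW s2)//; lra.
lra.
Qed.

(** In rank at most 2 the concavity of [ln] wins over the drift of [ln q],
   which is nonpositive up to third order terms. *)
Lemma loglog_strict s L : d <= 2 -> 0 < s -> 1 <= L -> 240 * c ^+ 3 * (s * L) <= 1 ->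
  {in ls, forall l, 0 < L + lam s l} /\
  avg (fun l => ln (L + lam s l)) < ln L.
Proof.
move=> d2 s0 L1 csL.
have c0 : 0 < c by have := c1; lra.
have L0 : 0 < L by lra.
have cc3 : 0 < c ^+ 3 by rewrite exprn_gt0.
have c3 : c <= c ^+ 3 by rewrite -[leLHS]expr1 ler_weXn2l.
have sL : s <= s * L by rewrite ler_peMr ?(ltW s0).
have cs1 : 240 * c ^+ 3 * s <= 1.
  by apply: le_trans csL; rewrite ler_wpM2l//; lra.
have cs : 6 * c * s <= 1.
  apply: le_trans cs1; rewrite ler_wpM2r ?(ltW s0)//.
  by have := c3; have := c0; lra.
have small l : l \in ls -> `|lam s l| <= 6 * (c * s).
  by move=> ll; case: (log_step_bounds c1 s0 cs (b_le ll) (k_le ll)).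
have cs40 : 40 * (c * s) <= 1.
  apply: le_trans cs1; rewrite mulrA ler_wpM2r ?(ltW s0)//.
  by have := c3; have := c0; lra.
have Llam l : l \in ls -> 0 < L + lam s l.
  by move=> /small; rewrite ler_norml; lra.
split=> //.
have [up _ var] := log_moments s0 cs.
have step l : l \in ls ->
    ln (L + lam s l) <= ln L + (L^-1 * lam s l - 2^-1 * L^-2 * lam s l ^+ 2 + L^-2 * (72 * (c ^+ 3 * s ^+ 3))).
  move=> ll; have := Llam _ ll; have := small _ ll; move: (lam s l) => x xs Lx.
  have nL := lt0r_neq0 L0.
  have -> : L + x = L * (1 + x / L) by rewrite mulrDr mulr1 mulrCA divff// mulr1.
  have xL : -1 < x / L by rewrite ltr_pdivlMr//; lra.
  rewrite lnM ?posrE//; last by lra.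
  rewrite lerD2l (le_trans (ln1D_le xL))//.
  have -> : (x / L) ^+ 2 / 2 = 2^-1 * L^-2 * x ^+ 2 by rewrite exprMn exprVn; lra.
  rewrite (mulrC x) lerD2l.
  have -> : (L^-1 * x) ^+ 3 / 3 = L^-2 * (L^-1 * (x ^+ 3 / 3)).
    by rewrite exprMn exprVn exprSr invfM; lra.
  rewrite ler_wpM2l ?invr_ge0 ?sqr_ge0//.
  have x3 : x ^+ 3 / 3 <= 72 * (c ^+ 3 * s ^+ 3).
    have : x ^+ 3 <= `|x| ^+ 3 by rewrite -normrX ler_norm.
    have : `|x| ^+ 3 <= (6 * (c * s)) ^+ 3.
      by rewrite lerXn2r ?nnegrE// mulr_ge0// mulr_ge0 ?ltW.
    by rewrite !exprMn; lra.
  have y0 : 0 <= 72 * (c ^+ 3 * s ^+ 3) by rewrite mulr_ge0// mulr_ge0// exprn_ge0 ?ltW.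
  rewrite (le_trans (ler_wpM2l _ x3)) ?invr_ge0 ?(ltW L0)//.
  by rewrite ler_piMl// invf_le1.
rewrite (le_lt_trans (ler_avg pP step))// !(avgD, avgN, avgZ) !(avg_cst pP).
rewrite gtrDl.
have s2 : 0 < s ^+ 2 by rewrite exprn_gt0.
have up' : avg (lam s) <= 29 * (c ^+ 3 * s ^+ 3).
  apply: le_trans up _; rewrite gerDr mulr_le0_ge0 ?(ltW s2)//; lra.
set V := avg _ in var *.
have i0 : 0 < L^-1 by rewrite invr_gt0.
have -> : L^-2 = L^-1 * L^-1 by rewrite expr2 invfM.
rewrite (_ : _ + _ = L^-1 * L^-1 * (L * L^-1 * (L * avg (lam s)) - 2^-1 * V + 72 * (c ^+ 3 * s ^+ 3))); last first.
  rewrite divff ?lt0r_neq0// mul1r mulrDr mulrBr; congr (_ + _).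
  by rewrite mulrACA [L^-1 * L]mulVf ?lt0r_neq0// mul1r; lra.
rewrite divff ?lt0r_neq0// mul1r pmulr_rlt0 ?mulr_gt0//.
have : L * avg (lam s) <= L * (29 * (c ^+ 3 * s ^+ 3)) by rewrite ler_wpM2l// ltW.
have : s ^+ 2 * (240 * c ^+ 3 * (s * L)) <= s ^+ 2 * 1 by rewrite ler_wpM2l// ltW.
have : s ^+ 2 * (240 * c ^+ 3 * s) <= s ^+ 2 * 1 by rewrite ler_wpM2l// ltW.
lra.
Qed.

End Moments.
End LogMoments.

(** * Centered walks on vector spaces *)

Lemma avg_CS (R : realType) (T : eqType) (ls : seq T) (p : T -> R) (f g : T -> R) :
  weights ls p ->
  avg ls p (fun l => f l * g l) ^+ 2 <=
    avg ls p (fun l => f l ^+ 2) * avg ls p (fun l => g l ^+ 2).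
Proof.
move=> pP; set B := avg _ _ _; set A := avg _ _ _; set C := avg _ _ _.
have quad t : 0 <= A - 2 * t * B + t ^+ 2 * C.
  have -> : A - 2 * t * B + t ^+ 2 * C = avg ls p (fun l => (f l - t * g l) ^+ 2).
    rewrite (@eq_avg _ _ _ _ pP _ (fun l => f l ^+ 2 - 2 * t * (f l * g l) + t ^+ 2 * g l ^+ 2)).
      by rewrite avgD avgB !avgZ.
    by move=> l _; lra.
  by apply: (avg_ge0 pP) => l _; exact: sqr_ge0.
have C0 : 0 <= C by apply: (avg_ge0 pP) => l _; exact: sqr_ge0.
have A0 : 0 <= A by apply: (avg_ge0 pP) => l _; exact: sqr_ge0.
have [Cz|Cn] := eqVneq C 0.
  have [->|Bn] := eqVneq B 0; first by rewrite expr0n/= mulr_ge0.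
  have := quad ((A + 1) / (2 * B)); rewrite Cz mulr0 addr0.
  have -> : 2 * ((A + 1) / (2 * B)) * B = A + 1.
    by rewrite mulrAC mulrCA divff ?mulr1// mulf_neq0// pnatr_eq0.
  lra.
have Cp : 0 < C by rewrite lt_def Cn.
have := quad (B / C).
have -> : A - 2 * (B / C) * B + (B / C) ^+ 2 * C = A - B ^+ 2 / C.
  have -> : (B / C) ^+ 2 * C = B ^+ 2 / C * (C / C) by rewrite exprMn exprVn; lra.
  by rewrite divff//; lra.
by rewrite subr_ge0 ler_pdivrMr.
Qed.

Section Covariance.
Context {R : realType} {T : eqType} (ls : seq T) (p : T -> R) (r : nat).
Variable (y : T -> 'rV[R]_r).
Hypothesis pP : weights ls p.
Local Notation avg := (avg ls p).
Hypothesis y_avg : \sum_(l <- ls) p l *: y l = 0.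
Hypothesis y_span : forall v : 'cV[R]_r, {in ls, forall l, 0 < p l -> y l *m v = 0} -> v = 0.

Let Sigma : 'M[R]_r := \sum_(l <- ls) p l *: ((y l)^T *m y l).

Let entry (u v : 'rV[R]_r) : (u *m v^T) 0 0 = (v *m u^T) 0 0.
Proof. by rewrite !mxE; apply: eq_bigr => i _; rewrite !mxE mulrC. Qed.

Let Sigma_sym : Sigma^T = Sigma.
Proof.
rewrite /Sigma raddf_sum; apply: eq_bigr => l _ /=.
by rewrite linearZ/= trmx_mul trmxK.
Qed.

Let Sigma_form (u v : 'rV[R]_r) :
  (u *m Sigma *m v^T) 0 0 = avg (fun l => (u *m (y l)^T) 0 0 * (v *m (y l)^T) 0 0).
Proof.
rewrite /Sigma mulmx_sumr mulmx_suml summxE; apply: eq_bigr => l _.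
rewrite -scalemxAr -scalemxAl mxE; congr (_ * _).
by rewrite (mulmxA u) -(mulmxA (u *m _)) mxE big_ord1 (entry v).
Qed.

Let Sigma_unit : Sigma \in unitmx.
Proof.
rewrite -row_free_unit -kermx_eq0; apply/eqP/row_matrixP => i; rewrite row0.
set u := row i _; have uS : u *m Sigma = 0.
  by rewrite /u -row_mul mulmx_ker row0.
have q0 : avg (fun l => (u *m (y l)^T) 0 0 ^+ 2) = 0.
  rewrite (_ : avg _ = (u *m Sigma *m u^T) 0 0); last first.
    by rewrite Sigma_form; apply: (eq_avg pP) => l _; rewrite expr2.
  by rewrite uS mul0mx mxE.
apply: trmx_inj; rewrite trmx0; apply: y_span => l ll pl.
rewrite -[LHS]trmxK trmx_mul trmxK; apply/matrixP => a b; rewrite !ord1 !mxE.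
have := avg_max pP (h := fun l => - (u *m (y l)^T) 0 0 ^+ 2) (c := 0).
rewrite avgN q0 oppr0 => /(_ erefl) /(_ _ l ll pl)/eqP.
rewrite oppr_eq0 sqrf_eq0 => H; rewrite mxE in H; apply/eqP/H => k _.
by rewrite oppr_le0 sqr_ge0.
Qed.

Let S := invmx Sigma.

Let SSigma : S *m Sigma = 1%:M. Proof. exact: mulVmx. Qed.

Let S_sym : S^T = S. Proof. by rewrite /S trmx_inv Sigma_sym. Qed.

(** [cov_pair l x] is the scalar product of [x] with the step [y l] for the inverse
   of the covariance matrix of the steps. *)
Definition cov_pair l (x : 'rV[R]_r) : R := (x *m S *m (y l)^T) 0 0.

Definition cov_form (x : 'rV[R]_r) : R := avg (fun l => cov_pair l x ^+ 2).

Lemma cov_pairD l x z : cov_pair l (x + z) = cov_pair l x + cov_pair l z.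
Proof. by rewrite /cov_pair !mulmxDl mxE. Qed.

Lemma cov_pairZ l a x : cov_pair l (a *: x) = a * cov_pair l x.
Proof. by rewrite /cov_pair -!scalemxAl mxE. Qed.

Lemma cov_pair_avg x : avg (fun l => cov_pair l x) = 0.
Proof.
rewrite /cov_pair (_ : avg _ = (x *m S *m (\sum_(l <- ls) p l *: y l)^T) 0 0).
  by rewrite y_avg trmx0 mulmx0 mxE.
rewrite raddf_sum mulmx_sumr summxE.
by apply: eq_bigr => l _ /=; rewrite linearZ/= -scalemxAr [in RHS]mxE.
Qed.

Lemma cov_pairE l x : cov_pair l x = avg (fun k => cov_pair k x * cov_pair k (y l)).
Proof.
by rewrite /cov_pair -Sigma_form trmx_mul mulmxA -(mulmxA x S Sigma) SSigma mulmx1 S_sym.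
Qed.

Lemma cov_form_step l : cov_form (y l) = cov_pair l (y l).
Proof. by rewrite cov_pairE; apply: (eq_avg pP) => k _; rewrite expr2. Qed.

Lemma cov_form_avg : avg (fun l => cov_form (y l)) = r%:R.
Proof.
rewrite (_ : avg _ = \tr (S *m Sigma)); last first.
  rewrite /Sigma mulmx_sumr raddf_sum; apply: eq_bigr => l _.
  rewrite cov_form_step /= -scalemxAr linearZ/= mulmxA mxtrace_mulC mulmxA.
  by rewrite /mxtrace big_ord1.
by rewrite SSigma mxtrace1.
Qed.

Lemma cov_form_ge0 x : 0 <= cov_form x.
Proof. by apply: (avg_ge0 pP) => l _; exact: sqr_ge0. Qed.

Lemma cov_formZ a x : cov_form (a *: x) = a ^+ 2 * cov_form x.
Proof. by rewrite -avgZ; apply: (eq_avg pP) => l _; rewrite cov_pairZ exprMn. Qed.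

Lemma cov_formD x l : cov_form (x + y l) = cov_form x + 2 * cov_pair l x + cov_form (y l).
Proof.
rewrite (cov_pairE l x) -avgZ -!avgD; apply: (eq_avg pP) => k _.
by rewrite cov_pairD; lra.
Qed.

Lemma cov_pair_CS l x : cov_pair l x ^+ 2 <= cov_form x * cov_form (y l).
Proof. by rewrite cov_pairE avg_CS. Qed.

(** Recovers the coordinates: [x] is the average of [cov_pair l x *: y l]. *)
Lemma coord_le_cov_form (x : 'rV[R]_r) i :
  x 0 i ^+ 2 <= avg (fun l => y l 0 i ^+ 2) * cov_form x.
Proof.
suff -> : x 0 i = avg (fun l => y l 0 i * cov_pair l x) by exact: avg_CS.
rewrite -{1}(mulmx1 x) -SSigma mulmxA mulmx_sumr summxE.
apply: eq_bigr => l _; rewrite -scalemxAr mxE mulmxA; congr (_ * _).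
by rewrite mxE big_ord1 mulrC.
Qed.

Lemma cov_form_gt0 x : x != 0 -> 0 < cov_form x.
Proof.
move=> x0; rewrite lt_def cov_form_ge0 andbT; apply: contra x0 => /eqP q0.
apply/eqP/rowP => i; rewrite mxE; apply/eqP; rewrite -sqrf_eq0 eq_le sqr_ge0.
by rewrite andbT (le_trans (coord_le_cov_form x i))// q0 mulr0.
Qed.

End Covariance.

Lemma log_threshold (R : realType) (c : R) : 1 <= c -> exists2 M : R, 1 < M &
  forall Q, M <= Q -> let s := (Num.sqrt Q)^-1 in let L := ln Q in
    [/\ 0 < s, 144 * c ^+ 2 + 1 <= L & 240 * c ^+ 3 * (s * L) <= 1].
Proof.
move=> c1.
(* With [w = Q ^ (1/4)], [s = w ^ -2] and [L <= 4 w], so that [w >= a] suffices. *)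
pose a : R := 960 * c ^+ 3.
have c3 : 1 <= c ^+ 3 by rewrite exprn_ege1.
have a1 : 1 <= a by rewrite /a; lra.
have e0 := expR_gt0 (144 * c ^+ 2 + 1).
have a4 : 1 <= a ^+ 4 by rewrite exprn_ege1.
exists (expR (144 * c ^+ 2 + 1) + a ^+ 4) => [|Q QM s L]; first by lra.
have Q0 : 0 < Q by lra.
have s0 : 0 < s by rewrite invr_gt0 sqrtr_gt0.
have w0 : 0 < Num.sqrt (Num.sqrt Q) by rewrite !sqrtr_gt0.
split; first exact: s0.
  by rewrite -ler_expR lnK ?posrE; lra.
pose w := Num.sqrt (Num.sqrt Q).
rewrite -/w in w0.
have w2 : w ^+ 2 = Num.sqrt Q by rewrite sqr_sqrtr// sqrtr_ge0.
have w4 : w ^+ 4 = Q by rewrite -(sqr_sqrtr (ltW Q0)) -w2 -exprM.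
have aw : a <= w.
  rewrite -(@ler_pXn2r _ 4%N)// ?nnegrE ?(ltW w0)//; last by lra.
  by rewrite w4; lra.
have Lw : L <= 4 * w.
  have -> : L = 4 * ln w by rewrite mulr_natl -lnXn// w4.
  by rewrite ler_wpM2l// ltW// ln_sublinear.
have sw : s = w^-1 * w^-1 by rewrite /s -w2 expr2 invfM.
have : s * L <= s * (4 * w) by rewrite ler_wpM2l// ltW.
have -> : s * (4 * w) = 4 * (w^-1 * (w^-1 * w)) by rewrite sw; lra.
rewrite (mulVf (lt0r_neq0 w0)) mulr1 => sL.
have cc : 0 <= 240 * c ^+ 3 by lra.
apply: le_trans (ler_wpM2l cc sL) _.
rewrite (_ : 240 * _ * _ = a * w^-1); last by rewrite /a; lra.
by rewrite ler_pdivrMr// mul1r.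
Qed.

Section Lyapunov.
Context {R : realType} {T : eqType} (ls : seq T) (p : T -> R) (r : nat).
Variable (y : T -> 'rV[R]_r).
Hypothesis pP : weights ls p.
Hypothesis y_avg : \sum_(l <- ls) p l *: y l = 0.
Hypothesis y_span : forall v : 'cV[R]_r, {in ls, forall l, 0 < p l -> y l *m v = 0} -> v = 0.
Local Notation q := (cov_form ls p y).
Local Notation B := (cov_pair ls p y).

Let c : R := 1 + \sum_(l <- ls) q (y l).

Let c1 : 1 <= c.
Proof. by rewrite lerDl sumr_ge0// => l _; exact: (cov_form_ge0 _ pP). Qed.

Let q_le l : l \in ls -> 0 <= q (y l) <= c ^+ 2.
Proof.
move=> ll; rewrite (cov_form_ge0 _ pP)/=.
have qc : q (y l) <= c.
  rewrite /c (big_rem l)//= addrCA lerDl addr_ge0// sumr_ge0// => k _.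
  exact: (cov_form_ge0 _ pP).
by rewrite (le_trans qc)// -[leLHS]expr1 ler_weXn2l.
Qed.

Let scaled x : 0 < q x -> let s := (Num.sqrt (q x))^-1 in
  [/\ avg ls p (fun l => B l x * s) = 0, avg ls p (fun l => (B l x * s) ^+ 2) = 1,
      {in ls, forall l, `|B l x * s| <= c} &
      forall l, q (x + y l) = q x * (1 + (2 * (B l x * s) * s + q (y l) * s ^+ 2))].
Proof.
move=> qx s.
have s0 : 0 < s by rewrite invr_gt0 sqrtr_gt0.
have qs : q x * s ^+ 2 = 1.
  by rewrite /s exprVn sqr_sqrtr ?divff ?lt0r_neq0// ltW.
split.
- rewrite (@eq_avg _ _ _ _ pP _ (fun l => s * B l x)) => [|l _]; last by rewrite mulrC.
  by rewrite avgZ (cov_pair_avg y_avg)// mulr0.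
- rewrite (@eq_avg _ _ _ _ pP _ (fun l => s ^+ 2 * B l x ^+ 2)) => [|l _].
    by rewrite avgZ mulrC.
  by rewrite exprMn mulrC.
- move=> l ll; rewrite -(@ler_pXn2r _ 2%N)// ?nnegrE//; last by have := c1; lra.
  rewrite real_normK ?num_real// exprMn.
  have /andP[_ qc] := q_le ll; apply: le_trans qc.
  have := ler_wpM2r (ltW (exprn_gt0 2 s0)) (cov_pair_CS pP y_span l x).
  by move/le_trans; apply; rewrite mulrAC qs mul1r.
- move=> l; rewrite (cov_formD pP y_span).
  rewrite (_ : q x * _ = q x + 2 * B l x * (q x * s ^+ 2) + q (y l) * (q x * s ^+ 2)); last by lra.
  by rewrite qs !mulr1.
Qed.

Let log_cov_form x l : l \in ls -> 1 < q x ->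
  6 * c * (Num.sqrt (q x))^-1 <= 1 ->
  ln (q (x + y l)) = ln (q x) + log_step (Num.sqrt (q x))^-1 (B l x * (Num.sqrt (q x))^-1) (q (y l)).
Proof.
move=> ll qx cs; have q0 : 0 < q x by lra.
have [_ _ Bc ->] := scaled q0.
have s0 : 0 < (Num.sqrt (q x))^-1 by rewrite invr_gt0 sqrtr_gt0.
have [pos _ _ _ _] := log_step_bounds c1 s0 cs (Bc _ ll) (q_le ll).
by rewrite lnM.
Qed.

Let far : exists2 M : R, 1 < M & forall x, M <= q x ->
  let s := (Num.sqrt (q x))^-1 in let L := ln (q x) in
  [/\ 0 < s, 6 * c * s <= 1, 120 * c ^+ 3 * s <= 1, 144 * c ^+ 2 + 1 <= L &
     240 * c ^+ 3 * (s * L) <= 1].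
Proof.
have [M M1 MP] := log_threshold c1; exists M; first exact: M1.
move=> x /MP/= [s0 L1 csL].
have := c1; set s := _^-1 in s0 csL *; set L := ln _ in L1 csL * => c1'.
have c3 : c <= c ^+ 3 by rewrite -[leLHS]expr1 ler_weXn2l.
have c2 : 1 <= c ^+ 2 by rewrite exprn_ege1.
have sL : s <= s * L by rewrite ler_peMr ?(ltW s0)//; lra.
have H : c ^+ 3 * s <= c ^+ 3 * (s * L) by rewrite ler_wpM2l//; lra.
have H' : c * s <= c ^+ 3 * s by rewrite ler_wpM2r// ltW.
have H0 : 0 <= c * s by rewrite mulr_ge0 ?(ltW s0)//; lra.
by split=> //; lra.
Qed.

(** Centered walks spanning at least three dimensions: [1 / ln q] is strictly
   superharmonic far away. *)
Lemma centered_transient : (3 <= r)%N -> exists C, forall z N,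
  \sum_(n < N) iter n (transfer ls p (fun x l => x + y l)) (fun x => (x == z)%:R) 0 <= C.
Proof.
move=> r3; have [M M1 MP] := far.
have M0 : 0 < M by lra.
have lnM0 : 0 < ln M by rewrite ln_gt0.
have [x1 qx1] : exists x1, M < q x1.
  pose v : 'rV[R]_r := const_mx 1.
  have v0 : v != 0.
    apply/eqP => /rowP/(_ (Ordinal (ltnW (ltnW r3)))); rewrite !mxE => /eqP.
    by rewrite oner_eq0.
  have qv := cov_form_gt0 pP y_span v0.
  exists ((1 + M / q v) *: v); rewrite (cov_formZ _ pP).
  have Mq : 0 < M / q v by rewrite divr_gt0.
  have : (1 + 2 * (M / q v)) * q v <= (1 + M / q v) ^+ 2 * q v.
    by rewrite ler_wpM2r ?(ltW qv)//; have := sqr_ge0 (M / q v); lra.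
  apply: lt_le_trans; rewrite mulrDl -mulrA divfK ?lt0r_neq0//; lra.
apply: (@transient_of_inv _ _ _ _ pP _ y (fun x => ln (q x)) (ln M) x1) => //.
  by rewrite ltr_ln ?posrE//; lra.
move=> x Mx; have qM : M < q x.
  have [q0|q0] := ltP 0 (q x); first by rewrite -ltr_ln.
  by move: Mx; rewrite (ln0 q0); lra.
have q0 : 0 < q x by lra.
have q1 : 1 < q x by lra.
have [s0 cs1 cs3 L1 _] := MP _ (ltW qM).
have [b1 b2 b3 _] := scaled q0.
have := inv_log_strict pP c1 b1 b2 (cov_form_avg pP y_span) b3 q_le _ s0 cs3 L1.
rewrite ler_nat => /(_ r3)[pos lt]; split=> [l ll|].
  by rewrite log_cov_form// pos.
rewrite (@eq_avg _ _ _ _ pP _ (fun l => (ln (q x) + log_step (Num.sqrt (q x))^-1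
    (B l x * (Num.sqrt (q x))^-1) (q (y l)))^-1))// => l ll.
by rewrite log_cov_form.
Qed.

(** Centered walks in dimension at most two: [ln (ln q)] is strictly
   superharmonic far away, and tends to infinity. *)
Lemma centered_lyapunov : (r <= 2)%N -> exists2 M : R, 1 < M & forall x, M <= q x ->
  avg ls p (fun l => ln (ln (q (x + y l)))) < ln (ln (q x)).
Proof.
move=> r2; have [M M1 MP] := far; exists M; first exact: M1.
move=> x qM.
have q1 : 1 < q x by lra.
have q0 : 0 < q x by lra.
have [s0 cs1 cs3 L1 csL] := MP _ qM.
have L1' : 1 <= ln (q x) by have := sqr_ge0 c; lra.
have [b1 b2 b3 _] := scaled q0.
have := loglog_strict pP c1 b1 b2 (cov_form_avg pP y_span) b3 q_le _ s0 L1' csL.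
rewrite ler_nat => /(_ r2)[pos lt].
rewrite (@eq_avg _ _ _ _ pP _ (fun l => ln (ln (q x) + log_step (Num.sqrt (q x))^-1
    (B l x * (Num.sqrt (q x))^-1) (q (y l)))))// => l ll.
by rewrite log_cov_form.
Qed.

End Lyapunov.

(** * Walks on the line *)

(** Far away in the direction of the drift, the inverse of the position is strictly
   superharmonic: its first order decrease exceeds the second order error. *)
Lemma drift_transient (R : realType) (T : eqType) (ls : seq T) (p : T -> R) (Y : T -> R) :
  weights ls p -> avg ls p Y != 0 -> exists C, forall z N,
  \sum_(n < N) iter n (transfer ls p (fun x l => x + Y l)) (fun x => (x == z)%:R) 0 <= C.
Proof.
move=> pP mu0; pose sg : R := Num.sg (avg ls p Y).
have sg2 : sg * sg = 1 by rewrite -expr2 sqr_sg mu0.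
pose mu := avg ls p (fun l => sg * Y l).
have mu_gt0 : 0 < mu by rewrite /mu avgZ -normrEsg normr_gt0.
pose c := \sum_(l <- ls) `|Y l|.
have c0 : 0 <= c by rewrite sumr_ge0.
have Yc l : l \in ls -> `|sg * Y l| <= c.
  move=> ll; rewrite normrM normr_sg mu0 mul1r /c (big_rem l)//= lerDl.
  by rewrite sumr_ge0.
pose z0 := c + c ^+ 2 / mu + 1.
have cm : 0 <= c ^+ 2 / mu by rewrite divr_ge0 ?sqr_ge0 ?ltW.
have z00 : 0 < z0 by rewrite /z0; lra.
apply: (@transient_of_inv _ _ _ _ pP _ Y (fun x => sg * x) z0 (sg * (z0 + 1))) => //.
  by rewrite mulrA sg2; lra.
move=> x; set z := sg * x => zx.
have zY l : sg * (x + Y l) = z + sg * Y l by rewrite mulrDr.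
have pos l : l \in ls -> z - c <= z + sg * Y l.
  by move=> /Yc; rewrite ler_norml; lra.
have zc : c ^+ 2 / mu + 1 < z - c by rewrite /z0 in zx; lra.
split=> [l ll|]; first by rewrite zY; have := pos _ ll; lra.
have z_gt0 : 0 < z by lra.
have step l : l \in ls ->
    (sg * (x + Y l))^-1 <= z^-1 - z^-1 * z^-1 * (sg * Y l - c ^+ 2 / (z - c)).
  move=> ll; rewrite zY; have := pos _ ll; have := Yc _ ll.
  move: (sg * Y l) => a ac za; have za0 : 0 < z + a by lra.
  have zn := lt0r_neq0 z_gt0; have zan := lt0r_neq0 za0.
  have -> : (z + a)^-1 = z^-1 - z^-1 * z^-1 * (a - a ^+ 2 / (z + a)).
    apply: (mulfI zn); apply: (mulfI zn); apply: (mulIf zan).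
    rewrite -[LHS]mulrA -mulrA mulVf// mulr1.
    rewrite (_ : z * (z * (z^-1 - z^-1 * z^-1 * (a - a ^+ 2 / (z + a)))) =
      z * (z / z) - (z / z) * (z / z) * (a - a ^+ 2 / (z + a))); last by lra.
    by rewrite divff// !mulr1 !mul1r mulrBl mulrBl divfK//; lra.
  rewrite lerD2l lerN2 ler_wpM2l ?mulr_ge0 ?invr_ge0 ?(ltW z_gt0)//.
  rewrite lerD2l lerN2; apply: ler_pM; rewrite ?sqr_ge0 ?invr_ge0 ?(ltW za0)//.
    by rewrite -[leLHS]real_normK ?num_real// lerXn2r ?nnegrE.
  by rewrite lef_pV2 ?posrE//; lra.
rewrite (le_lt_trans (ler_avg pP step))// avgB (avg_cst pP) avgZ avgB (avg_cst pP).
rewrite ltrBlDr ltrDl mulr_gt0 ?mulr_gt0 ?invr_gt0// subr_gt0 -/mu.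
rewrite ltr_pdivrMr; last by lra.
have : mu * (c ^+ 2 / mu) = c ^+ 2 by rewrite mulrCA divff ?mulr1 ?lt0r_neq0.
have : mu * (c ^+ 2 / mu + 1) < mu * (z - c) by rewrite ltr_pM2l.
by rewrite mulrDr; lra.
Qed.

Section Exit.
Context {R : realType} {T : eqType} (ls : seq T) (p : T -> R) (Y : T -> R).
Hypothesis pP : weights ls p.

(** Probability that the walk started at [x] stays in [[-w, w]] up to time [n]. *)
Fixpoint stay (w : R) n (x : R) : R :=
  if n is m.+1 then (`|x| <= w)%R%:R * avg ls p (fun l => stay w m (x + Y l))
  else (`|x| <= w)%R%:R.

(** With [mu] the drift, [x ^ 2 + 2 w sg(mu) x] grows on average by at least
   the second moment of a step as long as the walk is inside, whatever [mu] is. *)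
Lemma stay_le w B v : 0 <= w -> {in ls, forall l, `|Y l| <= B} ->
  0 < v -> v <= avg ls p (fun l => Y l ^+ 2) ->
  forall n, stay w n 0 <= (6 * (w + B) ^+ 2 + v) / v *
    (1 - ((6 * (w + B) ^+ 2 + v) / v)^-1) ^+ n.
Proof.
move=> w0 YB v0 v_le; set mu := avg ls p Y.
have B0 : 0 <= B.
  apply: contraT => Bn; have B_lt : B < 0 by rewrite ltNge.
  have : avg ls p (fun l => Y l ^+ 2) <= 0.
    rewrite -(avg_cst pP 0); apply: (ler_avg pP) => l /YB /le_lt_trans/(_ B_lt).
    by rewrite normr_lt0.
  lra.
pose sg : R := Num.sg mu; set W := w + B; set M := 6 * W ^+ 2 + v.
have W0 : 0 <= W by rewrite addr_ge0.
have W2 : 0 <= W ^+ 2 by exact: sqr_ge0.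
have M0 : 0 < M by rewrite /M; lra.
(* The constant keeps [F] between [v] and [M] on [[-W, W]]. *)
pose F (x : R) : R := 3 * W ^+ 2 + v - (x ^+ 2 + 2 * w * (sg * x)).
have sg1 : `|sg| <= 1 by rewrite normr_sg lern1 leq_b1.
have FB x : `|x| <= W -> v <= F x <= M.
  move=> xW.
  have x2 : 0 <= x ^+ 2 <= W ^+ 2.
    by rewrite sqr_ge0 -[leLHS]real_normK ?num_real// lerXn2r ?nnegrE.
  have sx : `|w * (sg * x)| <= W * W.
    rewrite normrM (ger0_norm w0) ler_pM ?normr_ge0//; first by rewrite /W lerDl.
    by rewrite normrM -[W]mul1r ler_pM.
  by move: sx; rewrite /F /M ler_norml; lra.
have avgE e k : avg ls p (fun l => e - Y l ^+ 2 - k * Y l) =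
    e - avg ls p (fun l => Y l ^+ 2) - k * mu.
  by rewrite !avgB (avg_cst pP) avgZ.
have Fdrift x : `|x| <= w -> avg ls p (fun l => F (x + Y l)) <= F x * (1 - (M / v)^-1).
  move=> xw; rewrite (@eq_avg _ _ _ _ pP _ (fun l => F x - Y l ^+ 2 - (2 * x + 2 * w * sg) * Y l)).
    rewrite avgE.
    have drift : 0 <= (2 * x + 2 * w * sg) * mu.
      rewrite mulrDl -!mulrA -normrEsg.
      have : `|x * mu| <= w * `|mu| by rewrite normrM ler_wpM2r.
      by rewrite ler_norml; lra.
    have FM : F x * (M / v)^-1 <= v.
      rewrite invf_div mulrCA ler_piMr ?(ltW v0)// ler_pdivrMr// mul1r.
      have xW : `|x| <= W by rewrite (le_trans xw)// lerDl.
      by case/andP: (FB x xW).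
    lra.
  by move=> l _; rewrite /F; lra.
have lam0 : 0 <= 1 - (M / v)^-1.
  by rewrite subr_ge0 invf_div ler_pdivrMr// /M; lra.
have main n x : `|x| <= W -> stay w n x <= (1 - (M / v)^-1) ^+ n * (F x / v).
  elim: n x => [|n IH] x xW /=.
    rewrite expr0 mul1r ler_pdivlMr//; case/andP: (FB _ xW) => vF _.
    by apply: le_trans vF; rewrite ler_piMl ?(ltW v0)// lern1 leq_b1.
  have F0 : 0 <= F x by case/andP: (FB _ xW) => vF _; lra.
  have [xw|_] := boolP (`|x| <= w); last first.
    by rewrite mul0r mulr_ge0 ?exprn_ge0// divr_ge0 ?(ltW v0).
  rewrite mul1r.
  apply: le_trans (_ : (1 - (M / v)^-1) ^+ n / v * avg ls p (fun l => F (x + Y l)) <= _).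
    rewrite -avgZ; apply: (ler_avg pP) => l ll; rewrite mulrAC -mulrA; apply: IH.
    by rewrite (le_trans (ler_normD _ _))// lerD// YB.
  rewrite exprSr.
  rewrite (_ : _ * (F x / v) = (1 - (M / v)^-1) ^+ n / v * (F x * (1 - (M / v)^-1))).
    by rewrite ler_wpM2l ?Fdrift// divr_ge0 ?exprn_ge0 ?(ltW v0).
  by rewrite -!mulrA; congr (_ * _); rewrite mulrC -mulrA mulrCA.
move=> n; rewrite (le_trans (main n 0 _)) ?normr0//.
rewrite mulrC ler_wpM2r ?exprn_ge0// ler_wpM2r ?invr_ge0 ?(ltW v0)//.
by have /FB/andP[] : `|0 : R| <= W by rewrite normr0.
Qed.

End Exit.

(** Balancing the two error terms: with [m ~ n ^ (1/4)] both are [O(n ^ -2)]. *)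
Lemma balance_summable (R : realType) (theta K : R) : 0 < theta < 1 -> 2 <= K ->
  exists C : R, forall n, exists2 m, (0 < m)%N &
    theta ^+ m + K * m%:R ^+ 2 * (1 - (K * m%:R ^+ 2)^-1) ^+ n
      <= C / (n.+1%:R * n.+2%:R).
Proof.
move=> /andP[t0 t1] K2.
have exp_ge (x : R) k : 0 <= x -> x ^+ k.+1 / k.+1`!%:R <= expR x.
  by move=> x0; have := expR_ge1Dxn k x0; lra.
(* With [n ~ m ^ 4]: the first term is exponential in [m], hence at most of order
   [m ^ -8]; the second is at most of order [m ^ 2 * (m ^ 2 / n) ^ 5 = m ^ 12 / n ^ 5]. *)
pose a := - ln theta.
have a0 : 0 < a by rewrite oppr_gt0 ln_lt0// t0.
pose C1 : R := expR a * (8`!%:R / a ^+ 8).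
pose C2 : R := 2 * (K * (5`!%:R * K ^+ 5)).
exists (2 * (C1 + C2)) => n.
pose N := n.+1.
have [m /andP[m4 m5]] : exists m, (m ^ 4 <= N)%N && (N < m.+1 ^ 4)%N.
  have ex : exists m, (m ^ 4 <= N)%N by exists 0%N.
  have ub m : (m ^ 4 <= N)%N -> (m <= N)%N.
    by apply: leq_trans; case: m => // m; rewrite -{1}(expn1 m.+1) leq_pexp2l.
  case: (ex_maxnP ex ub) => m mN mmax; exists m; rewrite mN ltnNge/=.
  by apply/negP => /mmax; rewrite ltnn.
have m0 : (0 < m)%N by case: m m5 {m4}.
exists m => //.
have N0 : 0 < N%:R :> R by rewrite ltr0n.
have m0R : 0 < m%:R :> R by rewrite ltr0n.
have NN : 2^-1 * (n.+1%:R * n.+2%:R) <= N%:R ^+ 2 :> R.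
  rewrite expr2 /N -!natrM (mulrC 2^-1) ler_pdivrMr// -natrM ler_nat; nia.
have T1 : theta ^+ m <= C1 / N%:R ^+ 2.
  have -> : theta ^+ m = expR a * expR (- (a * m.+1%:R)).
    rewrite -expRD -{1}(@lnK _ theta) ?posrE// -expRM_natl; congr expR.
    by rewrite /a -addn1 natrD; lra.
  rewrite /C1 -mulrA ler_wpM2l ?expR_ge0// expRN.
  have am : 0 < a * m.+1%:R by rewrite mulr_gt0.
  have am8 : 0 < (a * m.+1%:R) ^+ 8 / 8`!%:R by rewrite divr_gt0 ?exprn_gt0// ltr0n fact_gt0.
  have := exp_ge _ 7%N (ltW am); rewrite -(lef_pV2 (expR_gt0 _) am8) => /le_trans; apply.
  rewrite invf_div -mulrA ler_wpM2l ?ler0n// -invfM lef_pV2 ?posrE; last 2 first.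
  - exact: exprn_gt0.
  - by rewrite mulr_gt0// exprn_gt0.
  rewrite exprMn ler_wpM2l ?exprn_ge0 ?(ltW a0)// -!natrX ler_nat (_ : 8%N = (4 * 2)%N)//.
  by rewrite expnM leq_exp2r// ltnW.
have T2 : K * m%:R ^+ 2 * (1 - (K * m%:R ^+ 2)^-1) ^+ n <= C2 / N%:R ^+ 2.
  set x := _^-1.
  have D2 : 2 <= K * m%:R ^+ 2 by rewrite -[2]mulr1 ler_pM// -natrX ler1n expn_gt0 m0.
  have x2 : x <= 2^-1 by rewrite /x lef_pV2 ?posrE//; lra.
  have x0 : 0 < x by rewrite invr_gt0; lra.
  have e1 : (1 - x) ^+ n <= 2 * (1 - x) ^+ N.
    rewrite exprS mulrA ler_peMl ?exprn_ge0//; lra.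
  have e2 : (1 - x) ^+ N <= expR (N%:R * - x).
    rewrite expRM_natl lerXn2r ?nnegrE ?expR_ge0//; first lra.
    exact: expR_ge1Dx.
  have e3 : expR (N%:R * - x) <= 5`!%:R * (x * N%:R) ^- 5.
    have xN : 0 < x * N%:R by rewrite mulr_gt0.
    have xN5 : 0 < (x * N%:R) ^+ 5 / 5`!%:R by rewrite divr_gt0 ?exprn_gt0// ltr0n fact_gt0.
    have := exp_ge _ 4%N (ltW xN); rewrite -(lef_pV2 (expR_gt0 _) xN5) invf_div.
    by rewrite mulrN mulrC expRN.
  have e4 : (1 - x) ^+ n <= 2 * (5`!%:R * (x * N%:R) ^- 5).
    by rewrite (le_trans e1)// ler_wpM2l// (le_trans e2).
  have D0 : 0 <= K * m%:R ^+ 2 by lra.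
  apply: le_trans (ler_wpM2l D0 e4) _.
  have -> : (x * N%:R) ^- 5 = (K * m%:R ^+ 2) ^+ 5 / N%:R ^+ 5.
    by rewrite exprMn invfM /x exprVn invrK.
  have -> : K * m%:R ^+ 2 * (2 * (5`!%:R * ((K * m%:R ^+ 2) ^+ 5 / N%:R ^+ 5))) =
      C2 * (m%:R ^+ 12 / N%:R ^+ 5).
    rewrite /C2; set F := 5`!%:R; set i := _^-1.
    rewrite exprMn -exprM; lra.
  have C20 : 0 <= C2.
    by rewrite /C2 !mulr_ge0 ?ler0n ?exprn_ge0//; lra.
  rewrite ler_wpM2l// ler_pdivrMr ?exprn_gt0//.
  rewrite mulrC -exprVn (_ : N%:R ^+ 5 * N%:R^-1 ^+ 2 = N%:R ^+ 3); last first.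
    by rewrite (_ : 5%N = (3 + 2)%N)// exprD -mulrA -exprMn divff ?lt0r_neq0// expr1n mulr1.
  by rewrite -!natrX ler_nat (_ : 12%N = (4 * 3)%N)// expnM leq_exp2r.
have C0 : 0 <= C1 + C2.
  rewrite /C1 /C2 addr_ge0// !mulr_ge0 ?ler0n ?exprn_ge0 ?expR_ge0 ?invr_ge0 ?exprn_ge0 ?(ltW a0)//; lra.
have X0 : 0 < n.+1%:R * n.+2%:R :> R by rewrite mulr_gt0 ?ltr0n.
apply: le_trans (lerD T1 T2) _; rewrite -mulrDl [2 * _]mulrC -[leRHS]mulrA.
by rewrite ler_wpM2l// -[2 in leRHS]invrK -invfM lef_pV2 ?posrE ?exprn_gt0//.
Qed.

(** * Anticoncentration of random affine sums *)

Section SubsetSums.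
Context {R : realType} {K : fieldType}.

(** Sum of [f] over the points [c - v * (sum of a subset of V)]. *)
Fixpoint cosum (v : K) (V : seq (kstar K)) (f : K -> R) (c : K) : R :=
  if V is t :: V' then cosum v V' f c + cosum v V' f (c - v * kval t) else f c.

Lemma cosum_ge0 v V f c : (forall c, 0 <= f c) -> 0 <= cosum v V f c.
Proof. by move=> f0; elim: V c => //= t V IH c; rewrite addr_ge0. Qed.

Lemma cosum_shift v V f c e : cosum v V (fun c => f (c - e)) c = cosum v V f (c - e).
Proof. by elim: V c => //= t V IH c; rewrite !IH addrAC. Qed.

Lemma cosum_avg v V (T : eqType) (ls : seq T) (p : T -> R) (f : T -> K -> R) c :
  cosum v V (fun c => avg ls p (fun l => f l c)) c = avg ls p (fun l => cosum v V (f l) c).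
Proof. by elim: V c => //= t V IH c; rewrite !IH avgD. Qed.

Definition dissociated (V : seq (kstar K)) : Prop :=
  forall e : kstar K -> K, (forall t, e t \in [:: -1; 0; 1]) ->
    \sum_(t <- V) e t * kval t = 0 -> forall t, t \in V -> e t = 0.

Lemma dissociated_behead t V : uniq (t :: V) -> dissociated (t :: V) -> dissociated V.
Proof.
move=> /= /andP[tV _] dis e e1 e0 s sV.
have st : s == t = false by apply: contraNF tV => /eqP<-.
have := dis (fun s => if s == t then 0 else e s) _ _ s _; rewrite st; apply.
- by move=> u; case: ifP => // _; rewrite !inE eqxx orbT.
- rewrite big_cons eqxx mul0r add0r -[RHS]e0 !big_seq; apply: eq_bigr => u uV.
  by case: eqP uV => // ->; rewrite (negPf tV).
- by rewrite inE sV orbT.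
Qed.

(** Two subsets of [V] with the same sum would give a signed relation. *)
Lemma cosum_le1 v V c : v != 0 -> uniq V -> dissociated V ->
  cosum v V (fun c => (c == 0)%:R) c <= 1.
Proof.
move=> v0.
have repr V' c' : uniq V' -> cosum v V' (fun c => (c == 0)%:R) c' != 0 ->
    exists2 e : kstar K -> bool, (forall t, t \notin V' -> e t = false)
      & c' = v * \sum_(t <- V') (e t)%:R * kval t.
  elim: V' c' => [|t V' IH] c' /=.
    have [-> _ _|_] := eqVneq c' 0; last by rewrite eqxx.
    by exists xpred0 => //; rewrite big_nil mulr0.
  move=> /andP[tV' uV']; have [z|/(IH _ uV')[e eV' ->]] := eqVneq (cosum v V' (fun c => (c == 0)%:R) c') (0 : R); last first.
    move=> _; exists e => [s|]; last by rewrite big_cons eV'// mul0r add0r.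
    by rewrite inE negb_or => /andP[_ sV']; exact: eV'.
  rewrite z add0r => /(IH _ uV')[e eV' Ec].
  exists (fun s => (s == t) || e s) => [s|].
    by rewrite inE negb_or => /andP[/negPf-> sV'] /=; exact: eV'.
  rewrite big_cons eqxx mul1r mulrDr -[LHS](subrK (v * kval t)) Ec addrC; congr (_ + v * _).
  rewrite !big_seq; apply: eq_bigr => s sV'.
  by case: eqP sV' => // ->; rewrite (negPf tV').
elim: V c => [|t V IH] c /= uV dis; first by rewrite lern1 leq_b1.
have {}IH c' : cosum v V (fun c => (c == 0)%:R) c' <= 1.
  by apply: IH; [case/andP: uV|exact: dissociated_behead dis].
have [->|] := eqVneq (cosum v V (fun c => (c == 0)%:R) c) 0; first by rewrite add0r.
have [->|] := eqVneq (cosum v V (fun c => (c == 0)%:R) (c - v * kval t)) 0.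
  by rewrite addr0.
case/andP: (uV) => tV uV'; move=> /(repr _ _ uV')[e' _ Ec'] /(repr _ _ uV')[e _ Ec].
suff : - 1 = 0 :> K by move/eqP; rewrite oppr_eq0 oner_eq0.
have := dis (fun s => if s == t then -1 else (e s)%:R - (e' s)%:R) _ _ t _.
rewrite eqxx; apply; last by rewrite inE eqxx.
- move=> s; case: ifP => _; first by rewrite !inE eqxx.
  by case: (e s) (e' s) => -[]; rewrite ?subrr ?subr0 ?sub0r !inE eqxx ?orbT.
- rewrite big_cons eqxx mulN1r big_seq.
  under eq_bigr => s sV.
    have -> : (s == t) = false by apply: contraNF tV => /eqP<-.
    rewrite mulrBl; over.
  rewrite -big_seq sumrB; apply: (mulfI v0).
  by rewrite mulr0 mulrDr mulrBr -Ec -Ec' mulrN opprB addrC [c + _]addrC subrK subrr.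
Qed.

End SubsetSums.

Section AffineSums.
Context {R : realType} {K : fieldType} {T : eqType} (ls : seq T) (p : T -> R).
Variables (a : T -> kstar K) (b : T -> K).
Hypothesis pP : weights ls p.

(** The state [(t, c)] records the linear part read so far and the value that the
   translation parts still to come have to produce. *)
Definition affine_step (x : kstar K * K) l := ((x.1 * a l)%g, x.2 - kval x.1 * b l).

Definition affine_hit n x : R :=
  iter n (transfer ls p affine_step) (fun x => (x.2 == 0)%:R) x.

Variables (A : set (kstar K)) (chi : kstar K -> R).
Hypotheses (A1 : A 1%g) (AM : forall s t, A s -> A t -> A (s * t)%g)
  (chiM : forall s t, A s -> A t -> chi (s * t)%g = chi s + chi t)
  (aA : {in ls, forall l, A (a l)}).

Let sep s t := 1 <= `|chi s - chi t|.

Hypothesis chi_dissociated : forall V, (forall t, t \in V -> A t) ->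
  pairwise sep V -> dissociated V.

Let fresh t V := all (sep t) V.
Let extend t V := if fresh t V then t :: V else V.

Let step (x : kstar K * seq (kstar K) * K) l :=
  ((x.1.1 * a l)%g, extend x.1.1 x.1.2, x.2 - kval x.1.1 * b l).

Let good V := (forall t, t \in V -> A t) /\ pairwise sep V.

Let good_uniq V : good V -> uniq V.
Proof.
move=> [_ sV]; apply: pairwise_uniq sV => t.
by rewrite /sep subrr normr0 ler10.
Qed.

Let good_extend t V : A t -> good V -> good (extend t V).
Proof.
move=> At [AV sV]; rewrite /extend; case: ifP => // fV; split; last first.
  by rewrite /= sV andbT.
by move=> s; rewrite inE => /predU1P[->|/AV].
Qed.

Variables (al be : T).
Hypotheses (al_ls : al \in ls) (be_ls : be \in ls) (albe : al != be)
  (a_albe : a al = a be) (b_albe : b al != b be).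

Let q := Num.min (p al) (p be).
Let v := b be - b al.

Let p_ge0 l : 0 <= p l. Proof. by case: pP. Qed.
Let q_ge0 : 0 <= q. Proof. by rewrite le_min !p_ge0. Qed.

Let p_split (h : T -> R) (X : R) : {in ls, forall l, h l <= X} -> h al + h be <= X ->
  avg ls p h <= (1 - q) * X.
Proof.
move=> hX hX2.
have be_ls' : be \in rem al ls.
  by have := be_ls; rewrite (perm_mem (perm_to_rem al_ls)) inE eq_sym (negPf albe).
have := pP.2; rewrite (big_rem al)//= (big_rem be)//=.
set S := \sum_(_ <- _) _ => p1.
rewrite /avg (big_rem al)//= (big_rem be)//=.
set H := \sum_(_ <- _) _.
have HS : H <= S * X.
  rewrite /H /S mulr_suml !big_seq ler_sum// => l ll; rewrite ler_wpM2l// hX//.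
  by rewrite (mem_rem (mem_rem ll)).
have qa : q <= p al by rewrite ge_min lexx.
have qb : q <= p be by rewrite ge_min lexx orbT.
have h1 : (p al - q) * h al <= (p al - q) * X by rewrite ler_wpM2l ?subr_ge0 ?hX.
have h2 : (p be - q) * h be <= (p be - q) * X by rewrite ler_wpM2l ?subr_ge0 ?hX.
have h3 : q * (h al + h be) <= q * X by rewrite ler_wpM2l.
have := congr1 (fun z => z * X) p1 => /=; lra.
Qed.

Let q_le : 0 <= 1 - q <= 1.
Proof.
rewrite gerBl q_ge0 andbT.
by have := @p_split (fun=> 0) 0; rewrite mulr0; have := pP.2;
  rewrite (big_rem al)//= => p1 _; rewrite -p1 subr_ge0 (le_trans (_ : q <= p al))
  ?ge_min ?lexx// lerDl sumr_ge0.
Qed.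

Let hit m (x : kstar K * seq (kstar K) * K) : R :=
  ((x.2 == 0) && (m <= size x.1.2)%N)%:R.

(** Main estimate. Each time the walk of linear parts reaches a fresh level, the
   two exchangeable letters [al] and [be] offer a fair choice whose outcomes
   differ by [v * t]; by dissociation no two sequences of choices lead to the
   same sum. The sum over the subsets of [V] keeps the past choices undecided,
   so that each fresh level costs a factor [1 - q]. *)
Let many_levels m n t V c : A t -> good V ->
  cosum v V (fun c => iter n (transfer ls p step) (hit m) (t, V, c)) c <= (1 - q) ^+ (m - size V).
Proof.
set G := hit m.
have v0 : v != 0 by rewrite subr_eq0 eq_sym.
have G0 n' x : 0 <= iter n' (transfer ls p step) G x.
  by apply: (iter_transfer_ge0 pP) => y; exact: ler0n.
elim: n t V c => [|n IH] t V c At gV.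
  rewrite /= /G /hit /=; have [mV|Vm] := leqP m (size V).
    rewrite (eqP mV) expr0.
    under [X in cosum _ _ X]eq_fun do rewrite andbT.
    by apply: cosum_le1 => //; [exact: good_uniq|exact: chi_dissociated gV.1 gV.2].
  apply: le_trans (_ : 0 <= _); last by rewrite exprn_ge0//; case/andP: q_le.
  elim: V c {gV Vm} => [|s V IH] c /=; first by rewrite andbF.
  by rewrite -[leRHS]addr0 lerD.
under [X in cosum _ _ X]eq_fun do rewrite (iter_transferS ls p).
rewrite cosum_avg.
rewrite /step /=.
have gV' := good_extend At gV.
have shift l : cosum v V (fun c => iter n (transfer ls p step) G
      ((t * a l)%g, extend t V, c - kval t * b l)) c =
    cosum v V (fun c => iter n (transfer ls p step) G ((t * a l)%g, extend t V, c))
      (c - kval t * b l).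
  exact: (cosum_shift _ _ (fun c => iter n (transfer ls p step) G ((t * a l)%g, extend t V, c))).
rewrite (eq_avg pP (fun l _ => shift l)).
move: shift gV'; rewrite /extend; case: ifP => fV _ gV'; last first.
  rewrite -(avg_cst pP ((1 - q) ^+ (m - size V))); apply: (ler_avg pP) => l ll.
  by apply: IH => //; apply: AM => //; exact: aA.
have IH' l c' : l \in ls -> cosum v (t :: V) (fun c => iter n (transfer ls p step) G
    ((t * a l)%g, t :: V, c)) c' <= (1 - q) ^+ (m - (size V).+1).
  by move=> ll; apply: IH => //; apply: AM => //; exact: aA.
apply: (@le_trans _ _ ((1 - q) * (1 - q) ^+ (m - (size V).+1))); last first.
  rewrite -exprS; have [Vm|mV] := ltnP (size V) m; first by rewrite subnSK.
  rewrite (eqP mV) (eqP (leqW mV : m <= (size V).+1)%N) expr1 expr0.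
  by case/andP: q_le.
apply: p_split => [l ll|].
  apply: le_trans (IH' l (c - kval t * b l) ll) => /=; rewrite lerDl; exact: cosum_ge0.
apply: le_trans (IH' al (c - kval t * b al) al_ls) => /=.
rewrite lerD2l -a_albe -addrA -opprD.
by rewrite [v * _]mulrC -mulrDr /v [b al + _]addrC subrK.
Qed.


Let B := \sum_(l <- ls) `|chi (a l)|.

Let chi_le l : l \in ls -> `|chi (a l)| <= B.
Proof. by move=> ll; rewrite /B (big_rem l)//= lerDl sumr_ge0. Qed.

Let B0 : 0 <= B. Proof. exact: sumr_ge0. Qed.

(** Consecutive levels differ by at most [B], so that a walk which has met only
   few levels has stayed in a short interval. *)
Let few_levels m n t V c : A t ->
  `|chi t| <= (B + 1) * (size V)%:R ->
  (forall s, s \in V -> `|chi s| <= (B + 1) * (size V)%:R - (B + 1)) ->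
  iter n (transfer ls p step) (fun x => (size x.1.2 < m)%N%:R) (t, V, c) <=
    stay ls p (fun l => chi (a l)) ((B + 1) * m%:R) n (chi t).
Proof.
have inside t' (V' : seq (kstar K)) : `|chi t'| <= (B + 1) * (size V')%:R -> (size V' < m)%N ->
    `|chi t'| <= (B + 1) * m%:R.
  move=> tV Vm; rewrite (le_trans tV)// ler_wpM2l ?ler_nat ?(ltnW Vm)//.
  by rewrite addr_ge0.
elim: n t V c => [|n IH] t V c At tV VV.
  rewrite /=; case: ltnP => [Vm|_]; last exact: ler0n.
  by rewrite (inside _ _ tV Vm).
have [mV|Vm] := leqP m (size V).
  have -> : iter n.+1 (transfer ls p step) (fun x => (size x.1.2 < m)%N%:R) (t, V, c) = 0.
    elim: n.+1 t V c mV {IH At tV VV} => [|k IH] t V c mV.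
      by rewrite /= ltnNge mV.
    rewrite iter_transferS (eq_avg pP (h' := fun=> 0)) ?(avg_cst pP)// => l _.
    by apply: IH; rewrite /extend; case: ifP => // _; rewrite (leq_trans mV)/=.
  by elim: n.+1 (chi t) => [|k IHk] z /=; rewrite ?ler0n// mulr_ge0 ?ler0n// (avg_ge0 pP).
rewrite iter_transferS /= (inside _ _ tV Vm) mul1r; apply: (ler_avg pP) => l ll.
rewrite /step/= -(chiM At (aA ll)); have Atl := AM At (aA ll).
have chitl : `|chi (t * a l)%g| <= `|chi t| + B.
  by rewrite (chiM At (aA ll)) (le_trans (ler_normD _ _))// lerD2l chi_le.
rewrite /extend; case: ifP => [_|/negbT]; last first.
  rewrite -has_predC => /hasP[s sV]; rewrite /= /sep -ltNge => ts.
  have := VV _ sV; have := ler_distD (chi s) (chi t) 0; rewrite !subr0 => tri sb.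
  by apply: IH => //; lra.
have E : (B + 1) * (size (t :: V))%:R = (B + 1) * (size V)%:R + (B + 1).
  by rewrite /= -addn1 natrD mulrDr mulr1.
apply: IH => [//||s]; rewrite E; first lra.
rewrite inE addrK => /predU1P[->//|/VV]; have := B0; lra.
Qed.

(** Up to time [n] the walk of linear parts either reaches [m] separated levels or
   stays in an interval of length of order [m]; [m] is chosen to balance the two
   bounds. *)
Lemma affine_hit_summable :
  (exists2 l, l \in ls & (0 < p l) && (chi (a l) != 0)) -> 0 < p al -> 0 < p be ->
  exists C : R, forall n c, affine_hit n (1%g, c) <= C / (n.+1%:R * n.+2%:R).
Proof.
move=> [l ll /andP[pl chil]] pal pbe.
pose w2 := avg ls p (fun l => chi (a l) ^+ 2).
have w20 : 0 < w2.
  apply: (avg_gt0 pP _ ll pl); first by move=> k _; exact: sqr_ge0.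
  by rewrite lt_def sqr_ge0 sqrf_eq0 chil.
have q0 : 0 < q by rewrite lt_min pal.
have q1 : q < 1.
  have be_ls' : be \in rem al ls.
    by have := be_ls; rewrite (perm_mem (perm_to_rem al_ls)) inE eq_sym (negPf albe).
  have := pP.2; rewrite (big_rem al)//= (big_rem be)//= => <-.
  have qa : q <= p al by rewrite ge_min lexx.
  rewrite (le_lt_trans qa)// ltrDl ltr_pwDl// sumr_ge0//.
have th : 0 < 1 - q < 1 by rewrite subr_gt0 q1/= gtrBl.
pose K0 : R := 6 * (2 * B + 1) ^+ 2 / w2 + 2.
have K02 : 2 <= K0 by rewrite lerDr divr_ge0 ?(ltW w20)// mulr_ge0// sqr_ge0.
have [C CP] := balance_summable th K02; exists C => n c.
have [m m0 mC] := CP n; apply: le_trans mC.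
have -> : affine_hit n (1%g, c) =
    iter n (transfer ls p step) (fun x => (x.2 == 0)%:R) (1%g, [::], c).
  rewrite /affine_hit (iter_transfer_morph pP (step' := affine_step) (step := step)
    (phi := fun x => (x.1.1, x.2)) (inv := fun=> True) n (fun x => (x.2 == 0)%:R))//.
apply: (@le_trans _ _ (iter n (transfer ls p step) (fun x => hit m x +
    (size x.1.2 < m)%N%:R) (1%g, [::], c))).
  apply: (iter_transfer_le pP) => x; rewrite /hit ltnNge.
  by case: (_ == 0); case: (m <= _)%N; rewrite /= ?addr0 ?add0r ?ler01.
rewrite (iter_transferD pP) lerD//.
  have := @many_levels m n 1%g [::] c A1 (conj _ _) => /=; rewrite subn0; apply => //.
have := @few_levels m n 1%g [::] c A1; rewrite /= mulr0 normr_le0.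
have -> : chi 1%g = 0 by apply: (addrI (chi 1%g)); rewrite -chiM// mulg1 addr0.
move=> /(_ (eqxx _))/(_ _)/le_trans; apply => //.
set w := (B + 1) * m%:R.
have w0 : 0 <= w by rewrite mulr_ge0// addr_ge0.
apply: le_trans (stay_le pP w0 chi_le w20 (lexx _) n) _.
set D := _ / w2.
have D1 : 1 <= D by rewrite ler_pdivlMr// mul1r lerDr mulr_ge0// sqr_ge0.
have DK : D <= K0 * m%:R ^+ 2.
  have m1 : 1 <= m%:R :> R by rewrite ler1n.
  have wm : w + B <= (2 * B + 1) * m%:R.
    have : B * 1 <= B * m%:R by rewrite ler_wpM2l.
    by rewrite /w; lra.
  have wm2 : (w + B) ^+ 2 <= (2 * B + 1) ^+ 2 * m%:R ^+ 2.
    rewrite -exprMn lerXn2r ?nnegrE ?addr_ge0// mulr_ge0// addr_ge0//.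
    by rewrite mulr_ge0.
  have -> : D = 6 * (w + B) ^+ 2 / w2 + 1.
    by rewrite /D [LHS]mulrDl divff ?lt0r_neq0.
  have i0 : 0 <= w2^-1 by rewrite invr_ge0 ltW.
  have := ler_wpM2r i0 wm2; set X := (w + B) ^+ 2; set Z := (2 * B + 1) ^+ 2.
  have : 1 <= m%:R ^+ 2 :> R by rewrite exprn_ege1.
  rewrite /K0 -/Z; lra.
have D0 : 0 < D by lra.
have KD : (K0 * m%:R ^+ 2)^-1 <= D^-1 by rewrite lef_pV2 ?posrE//; lra.
have D1' : D^-1 <= 1 by rewrite invf_le1.
apply: ler_pM => //; [lra|by rewrite exprn_ge0//; lra|].
rewrite lerXn2r ?nnegrE//; lra.
Qed.

End AffineSums.

Section Blocks.
Context {R : realType} {K : fieldType} {T : eqType} (ls : seq T) (p : T -> R).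
Variables (a : T -> kstar K) (b : T -> K).
Hypothesis pP : weights ls p.

Let ls2 := [seq (l, l') | l <- ls, l' <- ls].
Let p2 (l : T * T) := p l.1 * p l.2.
Let a2 (l : T * T) := (a l.1 * a l.2)%g.
Let b2 (l : T * T) := b l.1 + kval (a l.1) * b l.2.

Let avg2 h : avg ls2 p2 h = avg ls p (fun l => avg ls p (fun l' => h (l, l'))).
Proof.
rewrite /avg big_allpairs_dep; apply: eq_bigr => l _.
by rewrite mulr_sumr; apply: eq_bigr => l' _; rewrite mulrA.
Qed.

Let p2P : weights ls2 p2.
Proof.
split=> [l|]; first by rewrite mulr_ge0// pP.1.
have <- : avg ls2 p2 (fun=> 1) = \sum_(l <- ls2) p2 l.
  by apply: eq_bigr => l _; rewrite mulr1.
by rewrite avg2 !(avg_cst pP).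
Qed.

Let hit2 n x : affine_hit ls2 p2 a2 b2 n x = affine_hit ls p a b (2 * n) x.
Proof.
rewrite /affine_hit; elim: n x => // n IH x.
rewrite mulnS iter_transferS (eq_avg p2P (fun l _ => IH _)).
rewrite avg2 iter_transferS; apply: (eq_avg pP) => l _; rewrite iter_transferS.
apply: (eq_avg pP) => l' _; congr (iter _ _ _ _); rewrite /affine_step/=.
by rewrite mulgA mulrDr mulrA opprD addrA.
Qed.

Let hit_scale n (t : kstar K) c :
  affine_hit ls p a b n (t, c) = affine_hit ls p a b n (1%g, (kval t)^-1 * c).
Proof.
have t0 := kval_neq0 t.
rewrite [RHS](_ : _ = iter n (transfer ls p (affine_step a b))
  (fun x => ((kval t * x.2 == 0)%:R : R)) (1%g, (kval t)^-1 * c)); last first.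
  apply: eq_iter_transfer => x; congr (_%:R); congr nat_of_bool.
  by rewrite mulf_eq0 (negPf t0).
have := @iter_transfer_morph _ _ ls p pP _ (affine_step a b) _ (affine_step a b)
  (fun x => ((t * x.1)%g, kval t * x.2)) (fun=> True) n (fun x => (x.2 == 0)%:R)
  (1%g, (kval t)^-1 * c).
rewrite /= mulg1 mulVKf// {1}/affine_hit => <- // x l _ _.
by rewrite /affine_step/= mulgA mulrBr mulrA.
Qed.

Variables (A : set (kstar K)) (chi : kstar K -> R).
Hypotheses (A1 : A 1%g) (AM : forall s t, A s -> A t -> A (s * t)%g)
  (chiM : forall s t, A s -> A t -> chi (s * t)%g = chi s + chi t)
  (aA : {in ls, forall l, A (a l)}).
Hypothesis chi_dissociated : forall V, (forall t, t \in V -> A t) ->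
  pairwise (fun s t => 1 <= `|chi s - chi t|) V -> dissociated V.

(** Two words of length two with the same letters have the same linear part, so
   that two letters that do not commute provide the exchangeable steps. *)
Lemma affine_return_summable s0 s1 :
  (exists2 l, l \in ls & (0 < p l) && (chi (a l) != 0)) ->
  s0 \in ls -> s1 \in ls -> 0 < p s0 -> 0 < p s1 ->
  b s0 + kval (a s0) * b s1 != b s1 + kval (a s1) * b s0 ->
  exists C : R, forall n c,
    affine_hit ls p a b n (1%g, c) <= C / ((n./2).+1%:R * (n./2).+2%:R).
Proof.
move=> [l ll /andP[pl chil]] s0ls s1ls ps0 ps1 b01.
have [C CP] : exists C, forall n c,
    affine_hit ls2 p2 a2 b2 n (1%g, c) <= C / (n.+1%:R * n.+2%:R).
  apply: (@affine_hit_summable _ _ _ ls2 p2 a2 b2 p2P A chi A1 AM chiM _ _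
    (s0, s1) (s1, s0)).
  - by move=> _ /allpairsP[[l1 l2] [/= l1s l2s ->]]; apply: AM; exact: aA.
  - exact: chi_dissociated.
  - exact: allpairs_f.
  - exact: allpairs_f.
  - apply: contra b01 => /eqP[-> _]; exact: eqxx.
  - by apply/val_inj; rewrite /= mulrC.
  - exact: b01.
  - exists (l, l); first exact: allpairs_f.
    rewrite mulr_gt0//= chiM; [|exact: aA|exact: aA].
    by rewrite -mulr2n mulrn_eq0.
  - exact: mulr_gt0.
  - exact: mulr_gt0.
exists C => n c; rewrite -{1}(odd_double_half n) -mul2n.
case: (odd n); last by rewrite add0n -hit2; exact: CP.
rewrite add1n /affine_hit iter_transferS.
rewrite -(avg_cst pP (C / _)); apply: (ler_avg pP) => k kl.
rewrite /affine_step/= -/(affine_hit ls p a b _ _) hit_scale -hit2; exact: CP.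
Qed.

End Blocks.

(** * Recurrence criterion *)

Lemma finite_repeat (T : eqType) (D : set T) (u : nat -> T) :
  finite_set D -> (forall n, D (u n)) -> exists i j, (i < j)%N /\ u i = u j.
Proof.
move=> /finite_seqP[s ->] us; have us' n : u n \in s := us n.
have : ~~ uniq (map u (iota 0 (size s).+1)).
  apply/negP => /uniq_leq_size H; suff : (size s < size s)%N by rewrite ltnn.
  have := H s; rewrite size_map size_iota; apply.
  by move=> _ /mapP[n _ ->].
move=> /(uniqPn (u 0%N))[i [j [ij]]]; rewrite size_map size_iota => js.
rewrite !(nth_map 0%N) ?size_iota// ?(ltn_trans ij)// !nth_iota ?(ltn_trans ij)// !add0n.
by exists i, j.
Qed.

Lemma finite_argmax (R : realType) (T : eqType) (D : set T) (f : T -> R) x0 :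
  finite_set D -> D x0 -> exists2 x, D x & forall y, D y -> f y <= f x.
Proof.
move=> /finite_seqP[s ->] /=; elim: s x0 => // t s IH x0 _.
have [->|[y ys]] : s = [::] \/ exists y, y \in s.
  by case: s {IH} => [|y s]; [left|right; exists y; rewrite inE eqxx].
  exists t => [|y]/=; first by rewrite inE eqxx.
  by rewrite inE => /eqP->.
have [x xs xmax] := IH _ ys; have [ft|ft] := leP (f t) (f x).
  exists x => [|z]/=; first by rewrite inE xs orbT.
  by rewrite inE => /predU1P[->//|/xmax].
exists t => [|z]/=; first by rewrite inE eqxx.
by rewrite inE => /predU1P[->//|/xmax/le_trans]; apply; exact: ltW.
Qed.

Section Recurrence.
Context {R : realType} {G : groupType} {T : eqType} (ls : seq T) (p : T -> R).
Variables (a : T -> G) (A : set G) (f : G -> R) (B : set G).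
Hypotheses (pP : weights ls p) (p_gt0 : {in ls, forall l, 0 < p l}).
Hypotheses (A1 : A 1%g)
  (AM : forall s t, A s -> A t -> A (s * t)%g) (aA : {in ls, forall l, A (a l)})
  (A_gen : forall H : set G, H 1%g -> (forall s t, H s -> H t -> H (s * t)%g) ->
     (forall s, H s -> H s^-1%g) -> {in ls, forall l, H (a l)} -> A `<=` H).
Hypotheses (B_fin : finite_set B)
  (f_drift : forall x, A x -> ~ B x -> avg ls p (fun l => f (x * a l)%g) < f x)
  (f_level : forall M, finite_set [set x | A x /\ f x <= M]).

(** Probability of not visiting [1] up to time [n]. *)
Fixpoint miss n (x : G) : R :=
  if n is m.+1 then (x != 1%g)%:R * avg ls p (fun l => miss m (x * a l)%g)
  else (x != 1%g)%:R.

Let miss_ge0 n x : 0 <= miss n x.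
Proof.
elim: n x => [|n IH] x /=; first exact: ler0n.
by rewrite mulr_ge0 ?ler0n// (avg_ge0 pP) => // l _; exact: IH.
Qed.

Lemma missS n x : miss n.+1 x <= miss n x.
Proof.
elim: n x => [|n IH] x.
  rewrite /= ler_piMr ?ler0n// -[leRHS](avg_cst pP 1); apply: (ler_avg pP) => l _.
  by rewrite /= lern1 leq_b1.
rewrite [leLHS]/= [leRHS]/= ler_wpM2l ?ler0n//; apply: (ler_avg pP) => l _.
exact: IH.
Qed.

Let miss_cvg x : cvgn (miss ^~ x).
Proof.
apply: nonincreasing_is_cvgn; first by apply/nonincreasing_seqP => n; exact: missS.
by exists 0 => _ [n _ <-]; exact: miss_ge0.
Qed.

Let h x : R := limn (miss ^~ x).

Let h_ge0 x : 0 <= h x.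
Proof. by apply: limr_ge => //; apply: nearW => n; exact: miss_ge0. Qed.

Let hE x : h x = (x != 1%g)%:R * avg ls p (fun l => h (x * a l)%g).
Proof.
apply: cvg_lim => //; rewrite -(cvg_shiftS (miss ^~ x)) /=.
apply: cvgMr; rewrite /avg.
apply: (cvg_big (op := +%R)) => [|l _]; first by move=> y; exact: add_continuous.
by apply: cvgMr; exact: miss_cvg.
Qed.

Let h_sub x : h x <= avg ls p (fun l => h (x * a l)%g).
Proof.
rewrite {1}hE ler_piMl ?lern1 ?leq_b1//.
by apply: (avg_ge0 pP) => l _; exact: h_ge0.
Qed.

Let h1 : h 1%g = 0. Proof. by rewrite hE eqxx mul0r. Qed.

(** The maximum of [h - eps * f] cannot lie outside [B] because [f] has a strict
   drift there. *)
Let h_max_eps (eps : R) : 0 < eps ->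
  exists2 x, A x /\ B x & forall y, A y -> h y - eps * f y <= h x - eps * f x.
Proof.
move=> e0; pose k x := h x - eps * f x.
have h_le1 x : h x <= 1.
  have dec : nonincreasing_seq (miss ^~ x).
    by apply/nonincreasing_seqP => n; exact: missS.
  apply: le_trans (nonincreasing_cvgn_ge dec (@miss_cvg x) 0%N) _.
  by rewrite /= lern1 leq_b1.
have [x [Ax kx] xmax] : exists2 x, A x /\ k 1%g <= k x &
    forall y, A y /\ k 1%g <= k y -> k y <= k x.
  apply: (@finite_argmax _ _ [set x | A x /\ k 1%g <= k x] k 1%g); last by split.
  apply: sub_finite_set (f_level ((1 - k 1%g) / eps)) => y [Ay ky]; split=> //.
  by rewrite ler_pdivlMr// mulrC; move: ky; rewrite {2}/k; have := h_le1 y; lra.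
have {}xmax y : A y -> k y <= k x.
  move=> Ay; have [ky|ky] := leP (k 1%g) (k y); first exact: xmax.
  exact: le_trans (ltW ky) kx.
exists x => //; split=> //; apply: contrapT => nBx.
have : k x < k x; last by rewrite ltxx.
have k_avg : avg ls p (fun l => k (x * a l)%g) <= k x.
  rewrite -(avg_cst pP (k x)); apply: (ler_avg pP) => l ll.
  by apply: xmax; apply: AM => //; exact: aA.
apply: lt_le_trans k_avg; rewrite avgB avgZ /k.
apply: ler_ltD (h_sub x) _; rewrite ltrN2 ltr_pM2l//; exact: f_drift.
Qed.

Let h_max : exists2 x, A x /\ B x & forall y, A y -> h y <= h x.
Proof.
have [b0 ABb0 _] := h_max_eps ltr01.
have ABfin : finite_set [set x | A x /\ B x] by apply: sub_finite_set B_fin => x [].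
have [b ABb bmax] := finite_argmax h ABfin ABb0.
have [c _ cmax] := finite_argmax (fun x => - f x) ABfin ABb0.
exists b => // y Ay; rewrite leNgt; apply/negP => hlt.
pose d := h y - h b; have d0 : 0 < d by rewrite subr_gt0.
pose S : R := `|f y| + `|f c| + 1.
have S0 : 0 < S by rewrite /S; have := normr_ge0 (f y); have := normr_ge0 (f c); lra.
have e0 : 0 < d / (2 * S) by rewrite divr_gt0// mulr_gt0.
have [x ABx xmax] := h_max_eps e0.
have := xmax _ Ay; have := bmax _ ABx; have fx := cmax _ ABx.
set e := d / _ in e0 *.
have eS : e * S = d / 2 by rewrite /e invfM mulrA divfK ?lt0r_neq0.
have : e * f y <= e * `|f y| by rewrite ler_wpM2l ?(ltW e0)// ler_norm.
have : e * - f x <= e * `|f c|.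
  by rewrite ler_wpM2l ?(ltW e0)// (le_trans fx)// -normrN ler_norm.
have := e0; move: eS; rewrite /S /d; move: (e) => e'; lra.
Qed.

Let reached (s : G) := exists2 w : seq T, {subset w <= ls} & s = (\prod_(l <- w) a l)%g.

Let reached1 : reached 1%g. Proof. by exists [::] => //; rewrite big_nil. Qed.

Let reachedM s t : reached s -> reached t -> reached (s * t)%g.
Proof.
move=> [w wls ->] [w' wls' ->]; exists (w ++ w'); last by rewrite big_cat.
by move=> l; rewrite mem_cat => /orP[/wls|/wls'].
Qed.

Let reached_step l : l \in ls -> reached (a l).
Proof. by move=> ll; exists [:: l]; [move=> k; rewrite inE => /eqP->|rewrite big_seq1]. Qed.

Let reachedA s : reached s -> A s.
Proof.
move=> [w + ->]; elim: w => [|l w IH] wls; first by rewrite big_nil.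
rewrite big_cons; apply: AM; first by apply/aA/wls; rewrite inE eqxx.
by apply: IH => k kw; apply: wls; rewrite inE kw orbT.
Qed.

Let reach_B x : A x -> exists2 s, reached s & B (x * s)%g.
Proof.
move=> Ax.
have fin : finite_set [set y | (exists2 s, reached s & y = (x * s)%g) /\ f y <= f x].
  apply: sub_finite_set (f_level (f x)) => y [[s rs ->] fy]; split=> //.
  by apply: AM => //; exact: reachedA.
have x_in : [set y | (exists2 s, reached s & y = (x * s)%g) /\ f y <= f x] x.
  by split=> //; exists 1%g => //; rewrite mulg1.
have [y [[s rs yE] fy] ymin] := finite_argmax (fun y => - f y) fin x_in.
exists s => //; rewrite -yE; apply: contrapT => nBy.
have Ay : A y by rewrite yE; apply: AM => //; exact: reachedA.
have := f_drift Ay nBy; rewrite ltNge => /negP; apply.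
rewrite -(avg_cst pP (f y)); apply: (ler_avg pP) => l ll.
rewrite leNgt; apply/negP => fl.
have := ymin (y * a l)%g; rewrite lerN2 leNgt fl => /(_ _)/notF; apply.
split; last by rewrite (le_trans (ltW fl)).
by exists (s * a l)%g; [apply: reachedM => //; exact: reached_step|rewrite yE mulgA].
Qed.

(** Returning to the finite set [B] again and again, each time after a step [a l],
   the walk meets some point twice: the inverse of [a l] is a product of steps. *)
Let reached_inv_step l : l \in ls -> reached (a l)^-1%g.
Proof.
move=> ll.
have nxt (y : {x | A x}) : exists y' : {x | A x}, B (sval y') /\
    exists2 s, reached s & sval y' = (sval y * a l * s)%g.
  case: y => y Ay /=; have Ayl : A (y * a l)%g by apply: AM => //; exact: aA.
  have [s rs Bs] := reach_B Ayl.
  by exists (exist _ _ (AM Ayl (reachedA rs))); split=> //; exists s.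
have [g gP] := choice nxt.
pose u n := sval (iter n.+1 g (exist _ 1%g A1)).
have uB n : B (u n) by have [] := gP (iter n g (exist _ 1%g A1)).
have ustep n : exists2 s, reached s & u n.+1 = (u n * a l * s)%g.
  by have [] := gP (iter n.+1 g (exist _ 1%g A1)).
have uij i k : exists2 s, reached s & u (i + k.+1)%N = (u i * a l * s)%g.
  elim: k => [|k [s rs us]]; first by rewrite addn1.
  have [s' rs' us'] := ustep (i + k.+1)%N.
  exists (s * a l * s')%g; last by rewrite addnS us' us !mulgA.
  by apply: reachedM => //; apply: reachedM => //; exact: reached_step.
have [i [j [ij uE]]] := finite_repeat B_fin uB.
have [s rs] := uij i (j - i.+1)%N; rewrite addnS -addSn subnKC// -uE => E.
suff -> : (a l)^-1%g = s by [].
apply/eqP; rewrite eq_sym -(inj_eq (mulgI (a l))) mulgV -(inj_eq (mulgI (u i))).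
by rewrite mulg1 mulgA -E.
Qed.

Let reachedV s : reached s -> reached s^-1%g.
Proof.
move=> [w + ->]; elim: w => [|l w IH] wls; first by rewrite big_nil invg1.
rewrite big_cons invgM; apply: reachedM.
  by apply: IH => k kw; apply: wls; rewrite inE kw orbT.
by apply: reached_inv_step; apply: wls; rewrite inE eqxx.
Qed.

(** The probability [h] of never visiting [1] is at most its average over the steps.
   Where it attains its maximum, it keeps the same value along all products of
   steps, one of which leads to [1], where [h] vanishes. *)
Lemma recurrent x (eps : R) : A x -> 0 < eps -> exists n, miss n x < eps.
Proof.
move=> Ax e0; suff hx : h x = 0.
  have : miss n x @[n --> \oo] --> (0 : R) by rewrite -hx; exact: miss_cvg.
  move=> /cvgrPdist_lt/(_ _ e0)[n _ nP]; exists n; have := nP n (leqnn n).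
  by rewrite /= sub0r normrN ger0_norm.
apply/eqP; rewrite eq_le h_ge0 andbT.
have [b [Ab Bb] bmax] := h_max; apply: le_trans (bmax _ Ax) _.
have hb s : reached s -> h (b * s)%g = h b.
  move=> [w + ->]; elim/last_ind: w => [|w l IH] wls; first by rewrite big_nil mulg1.
  have wls' : {subset w <= ls} by move=> k kw; apply: wls; rewrite mem_rcons inE kw orbT.
  have ll : l \in ls by apply: wls; rewrite mem_rcons inE eqxx.
  have Aw : A (b * \prod_(k <- w) a k)%g by apply: AM => //; apply: reachedA; exists w.
  rewrite -cats1 big_cat big_seq1 mulgA.
  have hw := IH wls'.
  apply: (avg_max pP (h := fun l => h (b * \prod_(k <- w) a k * a l)%g)) (p_gt0 ll) => //.
    apply/eqP; rewrite eq_le -{2}hw h_sub andbT -(avg_cst pP (h b)).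
    by apply: (ler_avg pP) => k kl; apply: bmax; apply: AM => //; exact: aA.
  by move=> k kl; apply: bmax; apply: AM => //; exact: aA.
have [] : reached b^-1%g.
  apply: reachedV; exact: (A_gen reached1 reachedM reachedV reached_step Ab).
by move=> w wls bE; rewrite -(hb b^-1%g) ?mulgV ?h1//; exists w.
Qed.

End Recurrence.

(** * Walks on a finitely generated subgroup of [K^*] *)

Section WalkOnGroup.
Context {R : realType} {K : fieldType} {T : eqType} (ls : seq T) (p : T -> R).
Variables (a : T -> kstar K) (A : set (kstar K)) (r : nat) (v : kstar K -> 'rV[int]_r).
Hypotheses (pP : weights ls p) (p_gt0 : {in ls, forall l, 0 < p l}).
Hypotheses (A1 : A 1%g) (AM : forall s t, A s -> A t -> A (s * t)%g)
  (AV : forall s, A s -> A s^-1%g) (aA : {in ls, forall l, A (a l)})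
  (A_gen : forall H : set (kstar K), H 1%g -> (forall s t, H s -> H t -> H (s * t)%g) ->
     (forall s, H s -> H s^-1%g) -> {in ls, forall l, H (a l)} -> A `<=` H).
Hypotheses (vM : forall s t, A s -> A t -> v (s * t)%g = v s + v t)
  (v_torsion : finite_set [set s | A s /\ v s = 0])
  (v_surj : forall z, exists2 s, A s & v s = z).

Definition group_step (x : kstar K) (l : T) : kstar K := (x * a l)%g.

Let morphism1 (V : zmodType) (f : kstar K -> V) :
  (forall s t, A s -> A t -> f (s * t)%g = f s + f t) -> f 1%g = 0.
Proof. by move=> fM; apply: (addrI (f 1%g)); rewrite addr0 -fM// mulg1. Qed.

(** Visits to [s] project to visits to [f s]. *)
Let hit_le (V : zmodType) (f : kstar K -> V) n s :
  (forall s t, A s -> A t -> f (s * t)%g = f s + f t) ->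
  iter n (transfer ls p group_step) (fun x => (x == s)%:R) 1%g <=
  iter n (transfer ls p (fun x l => x + f (a l))) (fun x => (x == f s)%:R) 0.
Proof.
move=> fM; rewrite -(morphism1 fM).
have := @iter_transfer_morph _ _ ls p pP _ group_step _ (fun x l => x + f (a l)) f A n
  (fun x => (x == f s)%:R) 1%g.
move=> <- //; last first.
- by move=> x l ll Ax; apply: fM => //; exact: aA.
- by move=> x l ll Ax; apply: AM => //; exact: aA.
apply: (iter_transfer_le pP) => x; rewrite ler_nat.
by case: (x =P s) => [->|//]; rewrite eqxx.
Qed.

Lemma noncentered_walk_transient (chi : kstar K -> R) :
  (forall s t, A s -> A t -> chi (s * t)%g = chi s + chi t) ->
  avg ls p (chi \o a) != 0 ->
  exists C, forall s N, \sum_(n < N)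
    iter n (transfer ls p group_step) (fun x => (x == s)%:R) 1%g <= C.
Proof.
move=> chiM /(drift_transient pP)[C CP]; exists C => s N.
by apply: le_trans (CP (chi s) N); apply: ler_sum => n _; exact: hit_le.
Qed.

Let w (s : kstar K) : 'rV[R]_r := map_mx intr (v s).
Let y l := w (a l).

Let wM s t : A s -> A t -> w (s * t)%g = w s + w t.
Proof. by move=> As At; rewrite /w vM// map_mxD. Qed.

Hypothesis walk_centered : forall chi : kstar K -> R,
  (forall s t, A s -> A t -> chi (s * t)%g = chi s + chi t) -> avg ls p (chi \o a) = 0.

Let y_avg : \sum_(l <- ls) p l *: y l = 0.
Proof.
apply/rowP => i; rewrite summxE mxE -[RHS](walk_centered (chi := fun s => w s 0 i)).
  by apply: eq_bigr => l _; rewrite mxE.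
by move=> s t As At; rewrite wM// mxE.
Qed.

Let y_span (u : 'cV[R]_r) : {in ls, forall l, 0 < p l -> y l *m u = 0} -> u = 0.
Proof.
move=> yu; have wu : A `<=` [set s | A s /\ w s *m u = 0].
  apply: A_gen => [|s t [As su] [At tu]|s [As su]|l ll]; split => //.
  - by rewrite (morphism1 wM) mul0mx.
  - exact: AM.
  - by rewrite wM// mulmxDl su tu addr0.
  - exact: AV.
  - have : w (s * s^-1)%g *m u = 0 by rewrite mulgV (morphism1 wM) mul0mx.
    by rewrite wM//; [rewrite mulmxDl su add0r|exact: AV].
  - exact: aA.
  - by apply: yu => //; exact: p_gt0.
apply/colP => i; have [s /wu[_ +] vs] := v_surj (delta_mx 0 i).
rewrite /w vs map_delta_mx -rowE => /rowP/(_ 0).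
by rewrite !mxE.
Qed.

Lemma centered_walk_transient : (3 <= r)%N ->
  exists C, forall s N, \sum_(n < N)
    iter n (transfer ls p group_step) (fun x => (x == s)%:R) 1%g <= C.
Proof.
move=> r3; have [C CP] := centered_transient pP y_avg y_span r3; exists C => s N.
by apply: le_trans (CP (w s) N); apply: ler_sum => n _; exact: hit_le.
Qed.

Let q s := cov_form ls p y (w s).

Let q_level M : finite_set [set s | A s /\ q s <= M].
Proof.
pose c i := avg ls p (fun l => y l 0 i ^+ 2).
have [N NP] : exists N : nat, forall i, c i * M <= N%:R.
  exists (Num.truncn (\sum_i `|c i * M|)).+1 => i.
  apply: le_trans (ltW (truncnS_gt _)); rewrite (bigD1 i)//=.
  by rewrite (le_trans (ler_norm _))// lerDl sumr_ge0.
pose D : set 'rV[int]_r := [set z : 'rV[int]_r | forall i, (absz (z 0%R i) <= N)%N].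
have Dfin : finite_set D.
  pose g (f : {ffun 'I_r -> 'I_(N + N).+1}) : 'rV[int]_r := \row_i ((f i)%:Z - N%:Z).
  apply: sub_finite_set (finite_image g (@finite_finset _ setT)) => z zN.
  exists [ffun i => inord (absz (z 0%R i + N%:Z))] => //; apply/rowP => i.
  by have zi := zN i; rewrite !mxE ffunE inordK; lia.
have sub : [set s | A s /\ q s <= M] `<=` \bigcup_(z in D) [set s | A s /\ v s = z].
  move=> s [As qs]; exists (v s) => // i.
  have ci : 0 <= c i by apply: (avg_ge0 pP) => l _; exact: sqr_ge0.
  have := le_trans (coord_le_cov_form pP y_span (w s) i) (ler_wpM2l ci qs).
  move=> /le_trans/(_ (NP i)); rewrite mxE -[N%:R]/(N%:~R) -rmorphXn ler_int.
  by move: (v s 0 i) => z; nia.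
apply: sub_finite_set sub _; apply: bigcup_finite => // z _.
have [t At <-] := v_surj z.
apply: sub_finite_set (finite_image (fun x => t * x)%g v_torsion) => s [As st].
exists (t^-1 * s)%g; last by rewrite mulVKg.
split; first by apply: AM => //; exact: AV.
apply: (addrI (v t)); rewrite -vM//; last by apply: AM => //; exact: AV.
by rewrite mulVKg st addr0.
Qed.

(** [ln (ln q)] is a Lyapunov function outside a finite set, the fibres of the
   coordinates being cosets of the torsion subgroup. *)
Lemma centered_walk_recurrent x (eps : R) : (r <= 2)%N -> A x -> 0 < eps ->
  exists n, miss ls p a n x < eps.
Proof.
move=> r2; have [M M1 MP] := centered_lyapunov pP y_avg y_span r2.
pose B := [set s | A s /\ q s <= M].
apply: (@recurrent _ _ _ ls p a A (fun s => ln (ln (q s))) B) => //.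
- exact: q_level.
- move=> s As nB; rewrite (@eq_avg _ _ ls p pP _ (fun l => ln (ln (cov_form ls p y (w s + y l))))).
    apply: MP; rewrite leNgt; apply/negP => qs; apply: nB; split=> //; exact: ltW.
  by move=> l ll; rewrite /q wM//; exact: aA.
- move=> M'; apply: sub_finite_set (q_level (Num.max M (expR (expR M')))) => s [As qs].
  split=> //; rewrite le_max; have [//|qM /=] := leP (q s) M.
  have q1 : 1 < q s by exact: lt_trans qM.
  have q0 : 0 < q s by rewrite (lt_trans _ q1).
  by rewrite -ler_ln ?posrE ?expR_gt0// expRK -ler_ln ?posrE ?expR_gt0 ?ln_gt0// expRK.
Qed.

End WalkOnGroup.

Section DelayedVisits.
Context {R : realType} {G : groupType} {T : eqType} (ls : seq T) (p : T -> R).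
Variables (a : T -> G) (A : set G).
Hypotheses (pP : weights ls p) (AM : forall s t, A s -> A t -> A (s * t)%g)
  (aA : {in ls, forall l, A (a l)}).

(** The walk with a countdown, after which visits to [1] are recorded. *)
Definition delayed_step (x : nat * G * bool) (l : T) : nat * G * bool :=
  (x.1.1.-1, (x.1.2 * a l)%g, if x.1.1 is 0 then x.2 && (x.1.2 != 1%g) else x.2).

Definition no_visit (x : nat * G * bool) : bool := x.2 && (x.1.2 != 1%g).

Lemma delayed_no_visit_law N m x :
  iter (N + m) (transfer ls p delayed_step) (fun y => (no_visit y)%:R) (N, x, true) =
  iter N (transfer ls p (fun x l => x * a l)%g) (miss ls p a m) x.
Proof.
have zero k y ok : iter k (transfer ls p delayed_step) (fun y => (no_visit y)%:R) (0%N, y, ok) =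
    ok%:R * miss ls p a k y.
  elim: k y ok => [|k IH] y ok; first by rewrite /= /no_visit/= -mulnb natrM.
  rewrite iter_transferS (@eq_avg _ _ ls p pP _
    (fun l => (ok && (y != 1%g))%:R * miss ls p a k (y * a l)%g)); last by move=> l _; exact: IH.
  by rewrite avgZ -mulnb natrM -mulrA.
elim: N x => [|N IH] x; first by rewrite zero mul1r.
by rewrite addSn !iter_transferS; apply: (eq_avg pP) => l _; exact: IH.
Qed.

Lemma delayed_no_visit_small : (forall x (e : R), A x -> 0 < e -> exists m, miss ls p a m x < e) ->
  forall N x (e : R), A x -> 0 < e ->
  exists m, iter N (transfer ls p (fun x l => x * a l)%g) (miss ls p a m) x < e.
Proof.
move=> miss0; elim=> [|N IH] x e Ax e0; first exact: miss0.
have e20 : 0 < e / 2 by rewrite divr_gt0.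
have miss_le m m' y : (m <= m')%N -> miss ls p a m' y <= miss ls p a m y.
  by move=> /subnK <-; elim: (m' - m)%N => // k /(le_trans _); apply; exact: missS.
have [m mP] : exists m, {in ls, forall l,
    iter N (transfer ls p (fun x l => x * a l)%g) (miss ls p a m) (x * a l)%g < e / 2}.
  have : {subset ls <= ls} by [].
  elim: {1 3}ls => [_|l s IHs sls]; first by exists 0%N.
  have [|m1 m1P] := IHs; first by move=> k ks; apply: sls; rewrite inE ks orbT.
  have [|m2 m2P] := IH (x * a l)%g (e / 2) _ e20.
    by apply: AM => //; apply: aA; apply: sls; rewrite inE eqxx.
  have le_iter k k' y : (k <= k')%N ->
      iter N (transfer ls p (fun x l => x * a l)%g) (miss ls p a k') y <=
      iter N (transfer ls p (fun x l => x * a l)%g) (miss ls p a k) y.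
    by move=> kk'; apply: (iter_transfer_le pP) => z; exact: miss_le.
  exists (maxn m1 m2) => k; rewrite inE => /predU1P[->|ks].
    by apply: le_lt_trans m2P; apply: le_iter; exact: leq_maxr.
  by apply: le_lt_trans (m1P _ ks); apply: le_iter; exact: leq_maxl.
exists m; rewrite iter_transferS; apply: (@le_lt_trans _ _ (e / 2)).
  by rewrite -[leRHS](avg_cst pP); apply: (ler_avg pP) => l /mP/ltW.
by lra.
Qed.

End DelayedVisits.

(** * Complex numbers *)

Section Complex.
Variable R : realType.

Record cplx := Cplx { cre : R; cim : R }.

Definition cplx_pair (z : cplx) := (cre z, cim z).
Definition pair_cplx (p : R * R) := Cplx p.1 p.2.
Lemma cplx_pairK : cancel cplx_pair pair_cplx. Proof. by case. Qed.

HB.instance Definition _ := Choice.copy cplx (can_type cplx_pairK).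

Implicit Types x y z : cplx.

Definition cplx_zero := Cplx 0 0.
Definition cplx_one := Cplx 1 0.
Definition cplx_add x y := Cplx (cre x + cre y) (cim x + cim y).
Definition cplx_opp x := Cplx (- cre x) (- cim x).
Definition cplx_mul x y :=
  Cplx (cre x * cre y - cim x * cim y) (cre x * cim y + cim x * cre y).
Definition sqmod x : R := cre x ^+ 2 + cim x ^+ 2.
Definition cplx_inv x := Cplx (cre x / sqmod x) (- cim x / sqmod x).

Lemma cplx_eqP x y : cre x = cre y -> cim x = cim y -> x = y.
Proof. by case: x y => a b [c d] /= -> ->. Qed.

Lemma cplx_addA : associative cplx_add.
Proof. by move=> x y z; apply: cplx_eqP; rewrite /= addrA. Qed.
Lemma cplx_addC : commutative cplx_add.
Proof. by move=> x y; apply: cplx_eqP; rewrite /= addrC. Qed.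
Lemma cplx_add0 : left_id cplx_zero cplx_add.
Proof. by move=> x; apply: cplx_eqP; rewrite /= add0r. Qed.
Lemma cplx_addN : left_inverse cplx_zero cplx_opp cplx_add.
Proof. by move=> x; apply: cplx_eqP; rewrite /= addNr. Qed.

HB.instance Definition _ := GRing.isZmodule.Build cplx
  cplx_addA cplx_addC cplx_add0 cplx_addN.

Lemma cplx_mulA : associative cplx_mul.
Proof. by move=> x y z; apply: cplx_eqP => /=; lra. Qed.
Lemma cplx_mulC : commutative cplx_mul.
Proof. by move=> x y; apply: cplx_eqP => /=; lra. Qed.
Lemma cplx_mul1 : left_id cplx_one cplx_mul.
Proof. by move=> x; apply: cplx_eqP => /=; lra. Qed.
Lemma cplx_mulD : left_distributive cplx_mul +%R.
Proof. by move=> x y z; apply: cplx_eqP => /=; lra. Qed.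
Lemma cplx_one_neq0 : cplx_one != 0.
Proof. by apply/eqP => -[/eqP]; rewrite oner_eq0. Qed.

HB.instance Definition _ := GRing.Zmodule_isComNzRing.Build cplx
  cplx_mulA cplx_mulC cplx_mul1 cplx_mulD cplx_one_neq0.

Lemma sqmod_eq0 x : (sqmod x == 0) = (x == 0).
Proof.
apply/eqP/eqP => [|->]; last by rewrite /sqmod /= expr0n /= addr0.
move=> /eqP; rewrite paddr_eq0 ?sqr_ge0// !sqrf_eq0 => /andP[/eqP a /eqP b].
exact: cplx_eqP.
Qed.

Lemma cplx_mulV x : x != 0 -> cplx_mul (cplx_inv x) x = 1.
Proof.
rewrite -sqmod_eq0 => x0; apply: cplx_eqP => /=.
  have := divff x0; rewrite {1}/sqmod; move: (_^-1) => i; lra.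
by move: (_^-1) => i; lra.
Qed.
Lemma cplx_inv0 : cplx_inv 0 = 0.
Proof. by apply: cplx_eqP; rewrite /= ?oppr0 mul0r. Qed.

HB.instance Definition _ := GRing.ComNzRing_isField.Build cplx cplx_mulV cplx_inv0.

Definition cmod z : R := Num.sqrt (sqmod z).

Lemma sqmod_ge0 z : 0 <= sqmod z.
Proof. by rewrite addr_ge0 ?sqr_ge0. Qed.

Lemma sqmodM x y : sqmod (x * y) = sqmod x * sqmod y.
Proof. by rewrite /sqmod /=; lra. Qed.

Lemma cmod_ge0 z : 0 <= cmod z. Proof. exact: sqrtr_ge0. Qed.

Lemma cmod_sq z : cmod z ^+ 2 = sqmod z.
Proof. by rewrite sqr_sqrtr ?sqmod_ge0. Qed.

Lemma cmodM x y : cmod (x * y) = cmod x * cmod y.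
Proof. by rewrite /cmod sqmodM sqrtrM ?sqmod_ge0. Qed.

Lemma cmod_eq0 z : (cmod z == 0) = (z == 0).
Proof. by rewrite -sqmod_eq0 -cmod_sq sqrf_eq0. Qed.

Lemma cmod0 : cmod 0 = 0. Proof. by apply/eqP; rewrite cmod_eq0. Qed.

Lemma cmod_gt0 z : z != 0 -> 0 < cmod z.
Proof. by move=> z0; rewrite lt_def cmod_eq0 z0 cmod_ge0. Qed.

Lemma cmod1 : cmod 1 = 1.
Proof. by rewrite /cmod /sqmod /= expr1n expr0n /= addr0 sqrtr1. Qed.

Lemma cmodN z : cmod (- z) = cmod z.
Proof. by rewrite /cmod /sqmod /= !sqrrN. Qed.

Lemma cmodX z n : cmod (z ^+ n) = cmod z ^+ n.
Proof. by elim: n => [|n IH]; rewrite ?expr0 ?cmod1// !exprS cmodM IH. Qed.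

Lemma cre_le z : `|cre z| <= cmod z.
Proof.
rewrite -(@ler_pXn2r _ 2%N)// ?nnegrE ?cmod_ge0// cmod_sq real_normK ?num_real//.
by rewrite lerDl sqr_ge0.
Qed.

Lemma cmodD x y : cmod (x + y) <= cmod x + cmod y.
Proof.
rewrite -(@ler_pXn2r _ 2%N)// ?nnegrE ?addr_ge0 ?cmod_ge0//.
rewrite sqrrD !cmod_sq.
have /ler_normlP[_] := cre_le (x * Cplx (cre y) (- cim y)).
rewrite cmodM [cmod (Cplx _ _)](_ : _ = cmod y); last by rewrite /cmod /sqmod /= sqrrN.
by rewrite /sqmod /=; lra.
Qed.

Lemma cmodB x y : cmod x - cmod y <= cmod (x + y).
Proof. by rewrite lerBlDr -{1}(addrK y x) (le_trans (cmodD _ _))// cmodN. Qed.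

Lemma cmod_sum I (r : seq I) (F : I -> cplx) :
  cmod (\sum_(i <- r) F i) <= \sum_(i <- r) cmod (F i).
Proof.
elim: r => [|i r IH]; first by rewrite !big_nil cmod0.
by rewrite !big_cons (le_trans (cmodD _ _))// lerD.
Qed.

Definition real_cplx (a : R) : cplx := Cplx a 0.

Lemma cmod_real a : cmod (real_cplx a) = `|a|.
Proof. by rewrite /cmod /sqmod /= expr0n addr0 sqrtr_sqr. Qed.

Lemma real_cplxX a n : real_cplx a ^+ n = real_cplx (a ^+ n).
Proof.
elim: n => [|n IH]; first by rewrite !expr0.
by rewrite !exprS IH; apply: cplx_eqP => /=; lra.
Qed.

Lemma cmod_nat n : cmod n%:R = n%:R.
Proof.
have -> : (n%:R : cplx) = real_cplx n%:R; last by rewrite cmod_real normr_nat.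
elim: n => [|n IH]; first exact: cplx_eqP.
by rewrite -addn1 !natrD IH; apply: cplx_eqP; rewrite /= ?addr0.
Qed.

Definition cplx_sqrt z : cplx :=
  let m := cmod z in
  let a := Num.sqrt ((m + cre z) / 2) in
  let b := Num.sqrt ((m - cre z) / 2) in
  if 0 <= cim z then Cplx a b else Cplx a (- b).

Lemma sqr_cplx_sqrt z : cplx_sqrt z ^+ 2 = z.
Proof.
have /ler_normlP[h1 h2] := cre_le z.
have m2 := cmod_sq z; rewrite /cplx_sqrt.
set a := Num.sqrt _; set b := Num.sqrt _.
have a2 : a ^+ 2 = (cmod z + cre z) / 2 by rewrite sqr_sqrtr//; lra.
have b2 : b ^+ 2 = (cmod z - cre z) / 2 by rewrite sqr_sqrtr//; lra.
have ab : 2 * (a * b) = `|cim z|.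
  apply/eqP; rewrite -(@eqrXn2 _ 2%N)//; last by rewrite !mulr_ge0// sqrtr_ge0.
  rewrite !exprMn a2 b2 real_normK ?num_real//; apply/eqP.
  by move: m2; rewrite /sqmod; lra.
case: ifPn => [i0|]; [rewrite ger0_norm// in ab|rewrite -ltNge => i0; rewrite ltr0_norm// in ab];
  by rewrite expr2; apply: cplx_eqP => /=; lra.
Qed.

End Complex.

(** The fundamental theorem of algebra: the modulus of a polynomial attains its
   minimum, and near a point which is not a root it takes a smaller value. *)
Section FTA.
Variable R : realType.
Local Notation C := (cplx R).
Implicit Types (p : {poly C}) (z : C).

Let horner_continuous p :
  continuous (fun u : R * R => cre p.[Cplx u.1 u.2]) /\
  continuous (fun u : R * R => cim p.[Cplx u.1 u.2]).
Proof.
elim/poly_ind: p => [|p c [IHr IHi]].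
  by split=> u; under eq_fun do rewrite horner0; exact: cvg_cst.
have c1 : continuous (fun u : R * R => u.1) by move=> u; exact: cvg_fst.
have c2 : continuous (fun u : R * R => u.2) by move=> u; exact: cvg_snd.
split=> u; under eq_fun do rewrite hornerMXaddC /=.
- apply: cvgD; last exact: cvg_cst.
  by apply: cvgB; apply: cvgM; (exact: IHr || exact: IHi || exact: c1 || exact: c2).
- apply: cvgD; last exact: cvg_cst.
  by apply: cvgD; apply: cvgM; (exact: IHr || exact: IHi || exact: c1 || exact: c2).
Qed.

Let horner_growth p : (1 < size p)%N ->
  forall M, exists r, forall z, r <= cmod z -> M <= cmod p.[z].
Proof.
elim/poly_ind: p => [|p c IH]; first by rewrite size_poly0.
rewrite size_MXaddC; case: ifP => // _; rewrite ltnS => p_gt0 M.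
have [e [r [e0 er]]] : exists e r, 0 < e /\ forall z, r <= cmod z -> e <= cmod p.[z].
  have [p1|p1] := leqP (size p) 1; last by have [r rP] := IH p1 1; exists 1, r.
  have p0 : p`_0 != 0.
    apply: contraTneq p_gt0 => p0; rewrite [p]size1_polyC// p0.
    by rewrite size_poly0.
  exists (cmod p`_0), 0; split; first exact: cmod_gt0.
  by move=> z _; rewrite [in leRHS](size1_polyC p1) hornerC.
exists (Num.max r ((`|M| + cmod c) / e)) => z.
rewrite ge_max => /andP[/er ep]; rewrite ler_pdivrMr// => zM.
rewrite hornerMXaddC (le_trans _ (cmodB _ _))// cmodM lerBrDr.
have : cmod z * e <= cmod z * cmod p.[z] by rewrite ler_wpM2l ?cmod_ge0.
by have := ler_norm M; lra.
Qed.

Let horner_bounded p : exists2 M, 0 <= M & forall z, cmod z <= 1 -> cmod p.[z] <= M.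
Proof.
elim/poly_ind: p => [|p c [M M0 MP]].
  by exists 0 => // z _; rewrite horner0 cmod0.
exists (M + cmod c) => [|z z1]; first by rewrite addr_ge0 ?cmod_ge0.
rewrite hornerMXaddC (le_trans (cmodD _ _))// lerD2r cmodM.
by rewrite -[leRHS]mulr1 ler_pM ?cmod_ge0 ?MP.
Qed.

Let two_power_root j z : exists y, y ^+ (2 ^ j) = z.
Proof.
elim: j z => [|j IH] z; first by exists z; rewrite expn0 expr1.
have [y yE] := IH (cplx_sqrt z); exists y.
by rewrite expnSr exprM yE sqr_cplx_sqrt.
Qed.

(** If [k = 2 ^ j * m] with [m] odd, some [m]-th power among 1, -1, i, -i has the
   required direction, and its base has a [2 ^ j]-th root by square roots alone. *)
Let descent_direction k z : (0 < k)%N -> z != 0 ->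
  exists2 y, cmod y = 1 & cre (z * y ^+ k) < 0.
Proof.
move=> k0 z0; have [m codd kE] := pfactor_coprime (isT : prime 2) k0.
have modd : odd m by rewrite coprime2n in codd.
set j := logn 2 k in kE.
suff [u u1 uz] : exists2 u : C, cmod u = 1 & cre (z * u ^+ m) < 0.
  have [y yE] := two_power_root j u; exists y; last by rewrite kE mulnC exprM yE.
  apply/eqP; rewrite -(@eqrXn2 _ (2 ^ j)) ?cmod_ge0 ?expn_gt0//.
  by rewrite -cmodX yE u1 expr1n.
have [m2 mE] : exists m2, m = (m2.*2).+1 by exists m./2; rewrite -{1}(odd_double_half m) modd.
have [re|re|re] := ltrgtP (cre z) 0.
- by exists 1; rewrite ?cmod1// expr1n mulr1.
- exists (-1); first by rewrite cmodN cmod1.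
  by rewrite -signr_odd modd expr1 mulrN1 /=; lra.
have im0 : cim z != 0.
  by apply: contra z0 => /eqP im; apply/eqP/cplx_eqP.
have ii : Cplx 0 1 ^+ 2 = -1 :> C by rewrite expr2; apply: cplx_eqP => /=; lra.
have iE (s : R) : s ^+ 2 = 1 -> exists2 e : R, e ^+ 2 = 1 & Cplx 0 s ^+ m = Cplx 0 (e * s).
  move=> s1; have ss : Cplx 0 s ^+ 2 = -1 :> C.
    by rewrite expr2; rewrite expr2 in s1; apply: cplx_eqP => /=; lra.
  exists ((-1) ^+ m2); first by rewrite -exprM mulnC exprM sqrrN expr1n expr1n.
  rewrite mE exprSr -mul2n exprM ss.
  have -> : (-1) ^+ m2 = real_cplx ((-1) ^+ m2) :> C.
    rewrite -real_cplxX; congr (_ ^+ _); apply: cplx_eqP => //=; exact: oppr0.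
  by move: ((-1) ^+ m2) => e; apply: cplx_eqP => /=; lra.
have mod1 (s : R) : s ^+ 2 = 1 -> cmod (Cplx 0 s) = 1.
  by move=> s1; rewrite /cmod /sqmod /= s1 expr0n add0r sqrtr1.
have [e e1 eE] := iE 1 (expr1n _ _).
have [e' e1' eE'] : exists2 e' : R, e' ^+ 2 = 1 & Cplx 0 e' ^+ m = Cplx 0 (e * - 1).
  exists (-1); first by rewrite sqrrN expr1n.
  have -> : Cplx 0 (-1) = - Cplx 0 1 :> C by apply: cplx_eqP; rewrite /= ?oppr0.
  by rewrite exprNn -signr_odd modd expr1 eE mulN1r; apply: cplx_eqP => /=; lra.
have eim : e * cim z != 0.
  by rewrite mulf_neq0// -sqrf_eq0 e1 oner_eq0.
have [lt|gt|/eqP] := ltrgtP (e * cim z) 0; last by rewrite (negPf eim).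
- by exists (Cplx 0 e'); [exact: mod1|rewrite eE' /=; lra].
- by exists (Cplx 0 1); [exact: mod1 (expr1n _ _)|rewrite eE /=; lra].
Qed.

Let local_decrease p z0 : (1 < size p)%N -> p.[z0] != 0 ->
  exists z, cmod p.[z] < cmod p.[z0].
Proof.
move=> p1 pz0; pose q := p \Po ('X + z0%:P).
have qE h : q.[h] = p.[h + z0] by rewrite horner_comp !hornerE.
set a := p.[z0] in pz0 *.
have qa0 : q - a%:P != 0.
  apply: contraTneq p1 => /eqP; rewrite subr_eq0 => /eqP qaE.
  have : size q = size p by rewrite /q size_comp_poly2// size_XaddC.
  by rewrite qaE size_polyC pz0 => <-.
have [k [s]] := multiplicity_XsubC (q - a%:P) 0; rewrite qa0/= subr0 => s0 qs.
have qh h : q.[h] = a + s.[h] * h ^+ k.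
  have := congr1 (fun u => u.[h]) qs; rewrite !hornerE => <-.
  by rewrite addrC subrK.
have k0 : (0 < k)%N.
  case: k qs qh => // qs qh; move: s0; rewrite rootE.
  have := qh 0; rewrite qE add0r expr0 mulr1 -/a => /eqP.
  by rewrite -subr_eq0 opprD addrA subrr add0r oppr_eq0 => ->.
have [s' sE] : exists s', s = s' * 'X + (s.[0])%:P.
  have : root (s - (s.[0])%:P) 0 by rewrite rootE !hornerE subrr.
  move=> /factor_theorem[s' ss]; exists s'.
  by rewrite -[LHS](subrK (s.[0])%:P) ss polyC0 subr0.
set b := s.[0] in sE s0; have b0 : b != 0 by [].
have [M M0 MP] := horner_bounded (a^-1 *: s').
have [y y1] : exists2 y, cmod y = 1 & cre (b / a * y ^+ k) < 0.
  by apply: descent_direction => //; rewrite mulf_neq0// invr_eq0.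
set w := b / a * _ => w0; pose rho := - cre w.
have rho0 : 0 < rho by rewrite oppr_gt0.
(* At a step [t * y] the value divided by [a] is [1 + t ^ k * w] up to an error
   [t ^ k.+1 * M]; [D] makes [t] small enough for [- rho], the real part of [w], to win. *)
pose D := rho + cmod w ^+ 2 + 2 * M + 1.
have wsq0 : 0 <= cmod w ^+ 2 by exact: sqr_ge0.
have D0 : 0 < D by rewrite /D; lra.
pose t := rho / D.
have tD : t * D = rho by rewrite divfK ?lt0r_neq0.
have t0 : 0 < t by rewrite divr_gt0.
have tparts : t * rho + t * cmod w ^+ 2 + 2 * (t * M) + t = rho.
  by have := tD; rewrite {1}/D; move: (t) (rho) => t2 rho2; lra.
have trho : 0 < t * rho by rewrite mulr_gt0.
have tw : 0 <= t * cmod w ^+ 2 by rewrite mulr_ge0 ?(ltW t0).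
have tM : 0 <= t * M by rewrite mulr_ge0 ?(ltW t0).
have t1 : t <= 1 by rewrite -(ler_pM2r rho0) mul1r; lra.
pose sg := t ^+ k.
have sg0 : 0 < sg by rewrite exprn_gt0.
have sgt : sg <= t by rewrite /sg -[leRHS]expr1 ler_wiXn2l ?(ltW t0).
exists (real_cplx t * y + z0); rewrite -qE qh.
have hn : cmod (real_cplx t * y) = t by rewrite cmodM y1 mulr1 cmod_real gtr0_norm.
set h := real_cplx t * y in hn *.
have hk : h ^+ k = real_cplx sg * y ^+ k by rewrite exprMn real_cplxX.
have aw : a * w = b * y ^+ k by rewrite /w mulrA [a * _]mulrC divfK.
have -> : a + s.[h] * h ^+ k = a * ((1 + real_cplx sg * w) + h ^+ k * (h * (a^-1 *: s').[h])).
  rewrite {1}sE hornerMXaddC hornerZ !mulrDr mulr1 -addrA; congr (_ + _).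
  rewrite mulrDl addrC; congr (_ + _); last by rewrite [RHS]mulrCA aw mulrCA -hk.
  by rewrite [RHS]mulrCA (mulrCA a h) mulVKf// [LHS]mulrC [s'.[h] * h]mulrC.
rewrite cmodM -[ltRHS]mulr1 ltr_pM2l ?cmod_gt0// (le_lt_trans (cmodD _ _))//.
have w2 : cmod w ^+ 2 = rho ^+ 2 + cim w ^+ 2 by rewrite cmod_sq /sqmod /rho sqrrN.
have tr1 : t * rho <= 1.
  rewrite -(ler_pM2r rho0) mul1r (le_trans (_ : _ <= t * cmod w ^+ 2))//; last by lra.
  by rewrite -mulrA -expr2 ler_wpM2l ?(ltW t0)// w2 lerDl sqr_ge0.
have sr : sg * rho <= t * rho by rewrite ler_wpM2r ?(ltW rho0).
have sw : sg * (sg * cmod w ^+ 2) <= sg * rho.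
  rewrite ler_wpM2l ?(ltW sg0)// (le_trans (_ : _ <= t * cmod w ^+ 2))//; last by lra.
  by rewrite ler_wpM2r.
have e1 : cmod (1 + real_cplx sg * w) <= 1 - sg * rho / 2.
  rewrite -(@ler_pXn2r _ 2%N)// ?nnegrE ?cmod_ge0//; last by lra.
  have := sqr_ge0 (sg * rho); move: sw; rewrite w2 cmod_sq /sqmod /rho /=.
  move: (cre w) (cim w) => u v; lra.
have e2 : cmod (h ^+ k * (h * (a^-1 *: s').[h])) <= sg * (t * M).
  rewrite cmodM cmodX (cmodM h) hn -/sg ler_wpM2l ?(ltW sg0)// ler_wpM2l ?(ltW t0)//.
  by apply: MP; rewrite hn.
have : sg * (t * M) < sg * (rho / 2) by rewrite ltr_pM2l//; lra.
lra.
Qed.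

Theorem cplx_root p : (1 < size p)%N -> exists z, root p z.
Proof.
move=> p1; have [r rP] := horner_growth p1 (cmod p.[0] + 1).
pose b := Num.max r 0.
have b0 : 0 <= b by rewrite le_max lexx orbT.
pose box := `[- b, b]%classic `*` `[- b, b]%classic : set (R * R).
have box0 : box (0, 0) by split; rewrite /= in_itv/= oppr_le0 b0.
have cbox : compact box by apply: compact_setX; exact: segment_compact.
pose g (u : R * R) := cre p.[Cplx u.1 u.2] ^+ 2 + cim p.[Cplx u.1 u.2] ^+ 2.
have [cr ci] := horner_continuous p.
have cg : continuous g.
  by move=> u; apply: cvgD; rewrite expr2; apply: cvgM; (exact: cr || exact: ci).
have [[x y] _ gmin] := compact_EVT_min (ex_intro _ _ box0) cbox (continuous_subspaceT cg).
have zmin z : cmod p.[Cplx x y] <= cmod p.[z].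
  have min0 z' : box (cre z', cim z') -> cmod p.[Cplx x y] <= cmod p.[z'].
    move=> bz; have := gmin (cre z', cim z'); rewrite inE => /(_ bz); rewrite /g /=.
    by move=> gz; rewrite /cmod ler_sqrt ?sqmod_ge0//; case: z' {bz} gz.
  have [zb|zb] := leP (cmod z) b.
    apply: min0; split; rewrite /= in_itv/= -ler_norml (le_trans _ zb)// ?cre_le//.
    have := cre_le (Cplx 0 (-1) * z); rewrite cmodM /= mul0r sub0r mulN1r opprK.
    by rewrite {1}/cmod /sqmod /= expr0n add0r sqrrN expr1n sqrtr1 mul1r.
  have /rP : r <= cmod z by rewrite (le_trans _ (ltW zb))// le_max lexx.
  have := min0 0 box0; lra.
exists (Cplx x y); rewrite rootE; apply: contraT => /(local_decrease p1)[z].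
by rewrite ltNge zmin.
Qed.
End FTA.

(** * Valuation rings *)

Section ValuationRing.
Variable K : fieldType.
Implicit Types (O : set K) (x y : K).

Definition is_subring O : Prop :=
  [/\ O 1, forall x y, O x -> O y -> O (x - y) & forall x y, O x -> O y -> O (x * y)].

Definition is_valuation_ring O : Prop :=
  is_subring O /\ forall x, x != 0 -> O x \/ O x^-1.

Section SubringTheory.
Variable O : set K.
Hypothesis ringO : is_subring O.

Lemma subring1 : O 1. Proof. by case: ringO. Qed.
Lemma subringB x y : O x -> O y -> O (x - y). Proof. by case: ringO => _ + _; apply. Qed.
Lemma subringM x y : O x -> O y -> O (x * y). Proof. by case: ringO => _ _; apply. Qed.
Lemma subring0 : O 0. Proof. by rewrite -(subrr 1); apply: subringB; exact: subring1. Qed.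
Lemma subringN x : O x -> O (- x).
Proof. by move=> Ox; rewrite -sub0r; apply: subringB => //; exact: subring0. Qed.
Lemma subringD x y : O x -> O y -> O (x + y).
Proof. by move=> Ox Oy; rewrite -(opprK y); apply: subringB => //; exact: subringN. Qed.
Lemma subringX x n : O x -> O (x ^+ n).
Proof.
by move=> Ox; elim: n => [|n IH]; rewrite ?expr0 ?exprS; [exact: subring1|exact: subringM].
Qed.
Lemma subring_sum I (r : seq I) (F : I -> K) :
  (forall i, O (F i)) -> O (\sum_(i <- r) F i).
Proof. by move=> OF; elim/big_rec: _ => [|i x _]; [exact: subring0|exact: subringD]. Qed.

End SubringTheory.

Let poly_over O (p : {poly K}) := forall i, O p`_i.

Section Maximal.
Variables (u : K) (O : set K).
Hypotheses (u0 : u != 0) (ringO : is_subring O) (Ou : O u) (Ou' : ~ O u^-1).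
Hypothesis maxO : forall O', is_subring O' -> O `<=` O' -> ~ O' u^-1 -> O' `<=` O.

(** [u] lies in the Jacobson radical of [O]: otherwise localizing [O] at the
   powers of [1 - u * v] would enlarge it. *)
Let unit_1sub v : O v -> O (1 - u * v)^-1.
Proof.
move=> Ov.
have nz w : O w -> 1 - u * w != 0.
  move=> Ow; apply/negP; rewrite subr_eq0 => /eqP uw.
  by apply: Ou'; rewrite -[u^-1]mulr1 uw mulKf.
have clos w w' : O w -> O w' -> exists2 w'', O w'' &
    (1 - u * w) * (1 - u * w') = 1 - u * w''.
  move=> Ow Ow'; exists (w + w' - u * w * w').
    by apply: (subringB ringO); [exact: subringD|do ?[apply: (subringM ringO) => //]].
  have -> : u * (w + w' - u * w * w') = u * w + u * w' - (u * w) * (u * w').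
    rewrite mulrBr mulrDr; congr (_ - _); rewrite -!mulrA; congr (_ * _).
    by rewrite mulrCA.
  rewrite mulrBr mulr1 mulrBl mul1r !opprB -addrA; congr (_ + _).
  by rewrite addrCA opprD.
pose O' := [set x | exists2 w, O w & O (x * (1 - u * w))].
have ringO' : is_subring O'.
  split.
  - by exists 0; [exact: subring0|rewrite mulr0 subr0 mulr1; exact: subring1].
  - move=> x y [w Ow xw] [w' Ow' yw']; have [w'' Ow'' wE] := clos _ _ Ow Ow'.
    exists w'' => //; rewrite -wE mulrBl; apply: (subringB ringO).
      rewrite mulrA; apply: (subringM ringO) => //; apply: (subringB ringO); first exact: subring1.
      exact: subringM.
    rewrite [(1 - u * w) * _]mulrC mulrA; apply: (subringM ringO) => //.
    by apply: (subringB ringO); [exact: subring1|exact: subringM].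
  - move=> x y [w Ow xw] [w' Ow' yw']; have [w'' Ow'' wE] := clos _ _ Ow Ow'.
    by exists w'' => //; rewrite -wE mulrACA; exact: subringM.
apply: (maxO ringO').
- move=> x Ox; exists 0; first exact: subring0.
  by rewrite mulr0 subr0 mulr1.
- move=> [w Ow]; rewrite mulrBr mulr1 mulKf// => Ouw; apply: Ou'.
  by rewrite -(subrK w u^-1); exact: subringD.
- exists v => //; rewrite mulVf ?nz//; exact: subring1.
Qed.

Let adjoin x : ~ O x -> exists p, poly_over O p /\ u * p.[x] = 1.
Proof.
move=> nOx; apply: contrapT => H; apply: nOx.
pose O' := [set y | exists2 p, poly_over O p & y = p.[x]].
apply: (maxO (O' := O')).
- split.
  + exists 1; last by rewrite hornerC.
    by move=> i; rewrite coef1; case: i => [|i]; [exact: subring1|exact: subring0].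
  + move=> _ _ [p pO ->] [q qO ->]; exists (p - q); last by rewrite hornerD hornerN.
    by move=> i; rewrite coefB; apply: (subringB ringO).
  + move=> _ _ [p pO ->] [q qO ->]; exists (p * q); last by rewrite hornerM.
    by move=> i; rewrite coefM; apply: subring_sum => // j; apply: (subringM ringO).
- move=> y Oy; exists y%:P; last by rewrite hornerC.
  by move=> i; rewrite coefC; case: ifP => // _; exact: subring0.
- by move=> [p pO uE]; apply: H; exists p; split=> //; rewrite -uE divff.
- exists 'X; last by rewrite hornerX.
  by move=> i; rewrite coefX; case: eqP => _; [exact: subring1|exact: subring0].
Qed.

(** Chevalley: if neither [x] nor [x^-1] could be adjoined, two relations of
   minimal total degree would combine into one of smaller degree. *)
Let no_two_relations n : forall x p q, x != 0 -> poly_over O p -> poly_over O q ->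
  (size p + size q <= n)%N -> u * p.[x] = 1 -> u * q.[x^-1] = 1 -> False.
Proof.
elim: n => [|n IH] x p q x0 Op Oq spq px qx.
  have p0 : p = 0 by apply/eqP; rewrite -size_poly_eq0; lia.
  by move: px; rewrite p0 horner0 mulr0 => /eqP; rewrite eq_sym oner_eq0.
wlog qp : x p q x0 Op Oq spq px qx / (size q <= size p)%N.
  move=> W; have [qp|pq] := leqP (size q) (size p); first exact: (W x p q).
  by apply: (W x^-1 q p); rewrite ?invr_eq0 ?invrK// ?(ltnW pq)// addnC.
have pn : p != 0.
  apply/eqP => p0; move: px; rewrite p0 horner0 mulr0 => /eqP.
  by rewrite eq_sym oner_eq0.
pose e := (1 - u * q`_0)^-1.
have Oe : O e by exact: unit_1sub.
have e0 : 1 - u * q`_0 != 0.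
  apply/eqP => e0; apply: Ou'; move/eqP: e0; rewrite subr_eq0 => /eqP E.
  by rewrite -[u^-1]mulr1 E mulKf.
pose q1 := \poly_(i < (size q).-1) q`_i.+1.
have q1E i : q1`_i = q`_i.+1.
  rewrite coef_poly; case: ltnP => // qi; rewrite nth_default//.
  by move: qi; case: (size q).
have qE : q = q1 * 'X + (q`_0)%:P.
  apply/polyP => i; rewrite coefD coefMX coefC.
  by case: i => [|i] /=; rewrite ?add0r ?addr0.
have q1x : u * (e * (q1.[x^-1] * x^-1)) = 1.
  have uZ : u * (q1.[x^-1] * x^-1) = 1 - u * q`_0.
    have := congr1 (fun r => r.[x^-1]) qE; rewrite hornerMXaddC => E.
    by rewrite -qx E mulrDr addrK.
  by rewrite mulrCA uZ mulVf.
pose n' := (size p).-1.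
have sp : size p = n'.+1 by rewrite prednK// size_poly_gt0.
have sq1 : (size q1 <= n')%N by rewrite (leq_trans (size_poly _ _))// /n'; lia.
have n'0 : (0 < n')%N.
  rewrite lt0n; apply/eqP => n'0; have p1 : (size p <= 1)%N by rewrite sp n'0.
  apply: Ou'; move: px; rewrite (size1_polyC p1) hornerC => up.
  by rewrite -[u^-1]mulr1 -up mulKf.
pose a := u * e * p`_n'.
pose p2 := \poly_(i < n') (p`_i + a * q1`_(n'.-1 - i)).
apply: (IH x p2 q) => //.
- move=> i; rewrite coef_poly; case: ifP => _; last exact: subring0.
  apply: subringD => //; apply: (subringM ringO) => //.
    by do 2?[apply: (subringM ringO) => //].
  by rewrite q1E.
- have := size_poly n' (fun i => p`_i + a * q1`_(n'.-1 - i)); rewrite -/p2; lia.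
- rewrite -[RHS]px; congr (_ * _); rewrite horner_poly [RHS]horner_coef sp big_ord_recr/=.
  under eq_bigr do rewrite mulrDl.
  rewrite big_split; congr (_ + _).
  transitivity (a * (x ^+ n'.-1 * q1.[x^-1])); last first.
    have xn : x ^+ n' = x * x ^+ n'.-1 by rewrite -exprS prednK.
    rewrite xn /a [X in _ * X = _](_ : _ = x ^+ n'.-1 * (q1.[x^-1] * x^-1 * x)); last by rewrite divfK.
    rewrite -[RHS]mulr1 -q1x.
    by rewrite !mulrA [LHS](ACl (3*7*4*1*2*5*6)).
  rewrite (horner_coef_wide _ sq1) !mulr_sumr (reindex_inj rev_ord_inj)/=.
  apply: eq_bigr => i _; have ltin := ltn_ord i; pose k := (n' - i.+1)%N.
  have -> : (n'.-1 - (n' - i.+1) = i)%N by lia.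
  rewrite -/k [x ^+ n'.-1](_ : _ = x ^+ k * x ^+ i); last first.
    by rewrite -exprD; congr (_ ^+ _); rewrite /k; lia.
  rewrite -[LHS]mulrA; congr (_ * _); rewrite exprVn.
  by rewrite [RHS]mulrACA divff ?expf_neq0// mulr1 mulrC.
Qed.

Lemma maximal_valuation : is_valuation_ring O.
Proof.
split=> // x x0; apply: contrapT => /not_orP[nx nx'].
have [p [Op px]] := adjoin nx; have [q [Oq qx]] := adjoin nx'.
exact: (no_two_relations x0 Op Oq (leqnn _) px qx).
Qed.

End Maximal.

(** Chevalley: as [t] is not integral, it is not a polynomial in [t^-1] with integer
   coefficients, and a subring that is maximal among those which contain [t^-1] but
   not [t] is a valuation ring. *)
Lemma exists_valuation_ring (t : K) : t != 0 ->
  ~ integralOver (intr : int -> K) t -> exists O, is_valuation_ring O /\ ~ O t.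
Proof.
move=> t0 nint; pose u := t^-1.
pose good O := [/\ is_subring O, O u & ~ O u^-1].
have good0 : good [set x | exists p : {poly int}, x = (map_poly intr p).[u]].
  split; first split.
  - by exists 1; rewrite rmorph1 hornerC.
  - by move=> _ _ [p ->] [q ->]; exists (p - q); rewrite rmorphB hornerD hornerN.
  - by move=> _ _ [p ->] [q ->]; exists (p * q); rewrite rmorphM hornerM.
  - by exists 'X; rewrite map_polyX hornerX.
  move=> [p tp]; apply: nint; rewrite invrK in tp.
  pose n := size p; pose L := \poly_(j < n.+1) p`_(n - j).
  have sL : (size (- L)%R < size ('X^(n.+1) : {poly int}))%N.
    by rewrite size_polyN size_polyXn ltnS size_poly.
  exists ('X^(n.+1) - L); first by rewrite monicE lead_coefDl ?lead_coefXn.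
  rewrite rootE rmorphB/= map_polyXn hornerD hornerN hornerXn subr_eq0; apply/eqP.
  rewrite exprSr {2}tp [RHS](@horner_coef_wide _ n.+1); last first.
    by rewrite (leq_trans (size_poly _ _))// size_poly.
  rewrite (@horner_coef_wide _ n.+1); last by rewrite (leq_trans (size_poly _ _))// leqW.
  rewrite mulr_sumr (reindex_inj rev_ord_inj)/=; apply: eq_bigr => i _.
  rewrite subSS !coef_map/= coef_poly ltn_ord mulrCA; congr (_ * _).
  have ltin := ltn_ord i.
  by rewrite /u exprVn -{1}(subnKC (ltin : (i <= n)%N)) exprD mulfK ?expf_neq0.
have [] := @Zorn_bigcup K (fun S => S = set0 \/ good S).
  move=> F FP Ftot.
  have [|/existsNP[ S1 /not_implyP[FB1 S1n0]]] := pselect (forall S, F S -> S = set0).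
    move=> F0; left; rewrite -subset0 => x [ S FS]; by rewrite (F0 _ FS).
  right; have gd S : F S -> S !=set0 -> good S.
    by move=> FS [x Sx]; have [ S0|//] := FP _ FS; rewrite S0 in Sx.
  have two x y : (\bigcup_(S in F) S) x -> (\bigcup_(S in F) S) y -> exists S, [/\ F S, S x & S y].
    move=> [ S FS Sx] [S' FS' Sy]; have [ SS'|S'S] := Ftot _ _ FS FS'.
      by exists S'; split=> //; exact: SS'.
    by exists S; split=> //; exact: S'S.
  have B1ne : S1 !=set0 by apply/set0P/eqP.
  have [[ B11 _ _] B1u _] := gd _ FB1 B1ne.
  split; first split.
  - by exists S1.
  - move=> x y Ux Uy; have [ S [ FS Sx Sy]] := two _ _ Ux Uy; exists S => //.
    by have [ringS _ _] := gd _ FS (ex_intro _ _ Sx); exact: subringB.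
  - move=> x y Ux Uy; have [ S [ FS Sx Sy]] := two _ _ Ux Uy; exists S => //.
    by have [ringS _ _] := gd _ FS (ex_intro _ _ Sx); exact: subringM.
  - by exists S1.
  - by move=> [ S FS Su']; have [_ _] := gd _ FS (ex_intro _ _ Su'); apply.
move=> S [[ S0|gS] Smax].
  case: (Smax [set x | exists p : {poly int}, x = (map_poly intr p).[u]]); last by right.
  rewrite S0; split; first exact: sub0set.
  by move=> H; have := H u; apply; case: good0.
case: gS => ringS Su Su'; exists S; split; last by rewrite -[t]invrK.
apply: (maximal_valuation _ ringS Su Su'); first by rewrite invr_eq0.
move=> S' ringS' SS' S'u; apply: contrapT => nO'S.
by apply: (Smax S'); [split|right; split=> //; exact: SS'].
Qed.

End ValuationRing.

Section ValuationDissociated.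
Variables (K : fieldType) (B : set K).
Hypothesis valB : is_valuation_ring B.
Let ringB : is_subring B := valB.1.

Let small x := x = 0 \/ ~ B x^-1.

Let small_in x : small x -> B x.
Proof.
move=> [->|nx]; first exact: subring0.
have [->|x0] := eqVneq x 0; first exact: subring0.
by have [//|] := valB.2 _ x0.
Qed.

Let smallD x y : small x -> small y -> small (x + y).
Proof.
move=> [-> sy|nx]; first by rewrite add0r.
move=> [->|ny]; first by rewrite addr0; right.
have [->|xy0] := eqVneq (x + y) 0; [by left|right => Bxy].
have y0 : y != 0 by apply/eqP => y0; apply: ny; rewrite y0 invr0; exact: subring0.
have x0 : x != 0 by apply/eqP => x0; apply: nx; rewrite x0 invr0; exact: subring0.
have [xy|yx] := valB.2 (x / y) (mulf_neq0 x0 (invr_neq0 y0)).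
- apply: ny; rewrite -[y^-1](mulfK xy0); apply: (subringM ringB) => //.
  rewrite mulrC mulrDl divff// addrC; apply: subringD => //; exact: subring1.
- apply: nx; rewrite -[x^-1](mulfK xy0); apply: (subringM ringB) => //.
  rewrite mulrC mulrDl divff//; apply: subringD => //; first exact: subring1.
  by rewrite invf_div in yx.
Qed.

Let unit u := [/\ u != 0, B u & B u^-1].

Let unitD u x : unit u -> small x -> unit (u + x).
Proof.
move=> [u0 Bu Bu'] sx.
have uE : u = (u + x) + - x by rewrite addrK.
have sNx : small (- x).
  by case: sx => [->|nx]; [left; rewrite oppr0|right; rewrite invrN => /(subringN ringB); rewrite opprK].
have nsu : ~ small u by move=> [/eqP|]; [rewrite (negPf u0)|].
have ns : ~ small (u + x) by move=> sux; apply: nsu; rewrite uE; exact: smallD.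
split; first by apply/eqP => ux0; apply: ns; left.
- by apply: subringD => //; exact: small_in.
- by apply: contrapT => nB; apply: ns; right.
Qed.

(** Terms with distinct valuations cannot cancel: a signed sum has the valuation
   of one of its terms. *)
Lemma valuation_dissociated (V : seq (kstar K)) : uniq V ->
  {in V &, forall s t, s != t -> ~ (B (kval s / kval t) /\ B (kval t / kval s))} ->
  dissociated V.
Proof.
move=> uV sepV e e1 e0.
suff [//|[s sV [es [u [[u0 _ _]]]]]] : (forall t, t \in V -> e t = 0) \/
    exists2 s, s \in V & e s != 0 /\ exists u, unit u /\ \sum_(t <- V) e t * kval t = kval s * u.
  by rewrite e0 => /esym/eqP; rewrite mulf_eq0 (negPf u0) (negPf (kval_neq0 s)).
have unit_sg t : e t != 0 -> unit (e t).
  have := e1 t; rewrite !inE => /or3P[]/eqP->; rewrite ?eqxx// => _.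
    split; rewrite ?oppr_eq0 ?oner_eq0 ?invrN1//; apply: (subringN ringB); exact: subring1.
  by split; rewrite ?oner_eq0 ?invr1//; exact: subring1.
elim: V uV sepV {e0} => [|t V IH] /=; first by left.
move=> /andP[tV uV] sepV.
have [|V0|[s sV [es [u [uu uE]]]]] := IH uV.
- by move=> s s' sV s'V; apply: sepV; rewrite inE ?sV ?s'V orbT.
- have [et|et] := eqVneq (e t) 0.
    by left=> s; rewrite inE => /predU1P[->//|/V0].
  right; exists t; first by rewrite inE eqxx.
  split=> //; exists (e t); split; first exact: unit_sg.
  rewrite big_cons mulrC big_seq big1 ?addr0// => s /V0 ->.
  by rewrite mul0r.
have st : t != s by apply: contraNneq tV => ->.
rewrite big_cons uE; have [et|et] := eqVneq (e t) 0.
  right; exists s; first by rewrite inE sV orbT.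
  by split=> //; exists u; rewrite et mul0r add0r.
right; have t0 := kval_neq0 t; have s0 := kval_neq0 s.
have tin : t \in t :: V by rewrite inE eqxx.
have sin : s \in t :: V by rewrite inE sV orbT.
have [et0 Be Be'] := unit_sg _ et.
have /not_andP[nts|nst] := sepV _ _ tin sin st.
- exists t => //; split=> //; exists (e t + kval s / kval t * u); split.
    apply: unitD; [exact: unit_sg|right]; rewrite invfM invf_div => Bi; apply: nts.
    case: uu => u0 Bu _.
    by rewrite -(divfK u0 (kval t / kval s)); apply: (subringM ringB).
  by rewrite mulrDr [kval t * e t]mulrC mulrA [kval t * _]mulrCA divff// mulr1.
- exists s => //; split=> //; exists (u + kval t / kval s * e t); split.
    apply: unitD => //; right; rewrite invfM invf_div => Bi; apply: nst.
    by rewrite -(divfK et0 (kval s / kval t)); apply: (subringM ringB).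
  rewrite addrC mulrDr; congr (_ + _).
  by rewrite mulrA [kval s * _]mulrCA divff// mulr1 mulrC.
Qed.

End ValuationDissociated.

(** * Finitely generated multiplicative groups *)

Section MulGroups.
Variable K : fieldType.
Implicit Types (gs : seq K) (H : set K) (x y g : K).

Definition mulgroup H : Prop :=
  [/\ H 1, forall x y, H x -> H y -> H (x / y) & forall x, H x -> x != 0].

(** The subgroup generated by [gs]. *)
Fixpoint spn gs : set K :=
  if gs is g :: gs' then [set x | exists k : int, exists2 s, spn gs' s & x = g ^ k * s]
  else [set 1].

Section Theory.
Variable H : set K.
Hypothesis gH : mulgroup H.

Lemma mulgroup1 : H 1. Proof. by case: gH. Qed.
Lemma mulgroup_neq0 x : H x -> x != 0. Proof. by case: gH => _ _; apply. Qed.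
Lemma mulgroupV x : H x -> H x^-1.
Proof. by move=> Hx; rewrite -div1r; case: gH => H1 + _; apply. Qed.
Lemma mulgroupM x y : H x -> H y -> H (x * y).
Proof. by move=> Hx Hy; rewrite -[y]invrK; case: gH => _ + _; apply=> //; exact: mulgroupV. Qed.
Lemma mulgroupXn x n : H x -> H (x ^+ n).
Proof.
by move=> Hx; elim: n => [|n IH]; rewrite ?expr0 ?exprS; [exact: mulgroup1|exact: mulgroupM].
Qed.
Lemma mulgroupX x (k : int) : H x -> H (x ^ k).
Proof.
by move=> Hx; case: k => n; rewrite ?NegzE -?exprnP -?exprnN; [|apply: mulgroupV];
  exact: mulgroupXn.
Qed.

Lemma spn_sub gs : (forall g, g \in gs -> H g) -> spn gs `<=` H.
Proof.
elim: gs => [|g gs IH] gsH x /=; first by move=> ->; exact: mulgroup1.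
move=> [k [s ss ->]]; apply: mulgroupM.
  by apply/mulgroupX/gsH; rewrite inE eqxx.
by apply: (IH _ s ss) => h hgs; apply: gsH; rewrite inE hgs orbT.
Qed.

End Theory.

Lemma spn_mulgroup gs : (forall g, g \in gs -> g != 0) -> mulgroup (spn gs).
Proof.
elim: gs => [|g gs IH] gs0.
  split=> [//|x y -> ->|x ->]; rewrite /= ?divr1//; exact: oner_neq0.
have g0 : g != 0 by apply: gs0; rewrite inE eqxx.
have gG := IH (fun h hgs => gs0 h (mem_behead (s := g :: gs) hgs)).
split=> [|x y|x].
- by exists 0, 1; [exact: mulgroup1|rewrite expr0z mulr1].
- move=> [k [s ss ->]] [l [t st ->]]; exists (k - l), (s / t).
    by case: gG => _ + _; apply.
  by rewrite expfzDr// -invr_expz invfM mulrACA.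
- move=> [k [s ss ->]]; apply: mulf_neq0; last exact: (mulgroup_neq0 gG).
  exact: expfz_neq0.
Qed.

Lemma mem_spn gs g : (forall g, g \in gs -> g != 0) -> g \in gs -> spn gs g.
Proof.
elim: gs => // h gs IH gs0; rewrite inE => /predU1P[->|ggs].
  exists 1, 1; last by rewrite expr1z mulr1.
  by apply: mulgroup1; apply: spn_mulgroup => k kgs; apply: gs0; rewrite inE kgs orbT.
exists 0, g; last by rewrite expr0z mul1r.
by apply: IH => // k kgs; apply: gs0; rewrite inE kgs orbT.
Qed.

(** Subgroups of finitely generated abelian groups are finitely generated: the
   exponents of [g] that occur in [H] are the multiples of the least positive
   one, realized by [h0], and the elements of [H] not involving [g] are dealt
   with inductively. *)
Lemma subgroup_fg gs H : (forall g, g \in gs -> g != 0) -> mulgroup H ->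
  H `<=` spn gs -> exists2 hs, (forall h, h \in hs -> H h) & H `<=` spn hs.
Proof.
elim: gs H => [|g gs IH] H gs0 gH Hgs; first by exists [::].
have g0 : g != 0 by apply: gs0; rewrite inE eqxx.
have gs0' h : h \in gs -> h != 0 by move=> hgs; apply: gs0; rewrite inE hgs orbT.
have gG := spn_mulgroup gs0'.
have gH' : mulgroup (H `&` spn gs).
  split; first by split; [exact: mulgroup1|exact: mulgroup1].
    by move=> x y [Hx sx] [Hy sy]; split; [case: gH => _ + _|case: gG => _ + _]; apply.
  by move=> x [Hx _]; exact: (mulgroup_neq0 gH).
have [hs hsH Hhs] := IH _ gs0' gH' (@subIsetr _ _ _).
pose P d := `[< (0 < d)%N /\ exists2 s, spn gs s & H (g ^+ d * s) >].
have [exP|nexP] := pselect (exists d, P d); last first.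
  exists hs => [h /hsH[]//|x Hx]; apply: Hhs; split=> //.
  have [k [s ss xE]] := Hgs _ Hx.
  suff k0 : k = 0 by rewrite xE k0 expr0z mul1r.
  apply: contrapT => k0; apply: nexP; exists `|k|%N; apply/asboolP.
  split; first by rewrite absz_gt0; apply/eqP.
  have [kn|kn] := leP 0 k.
    by exists s => //; rewrite exprnP gez0_abs// -xE.
  exists s^-1; first exact: (mulgroupV gG).
  by rewrite exprnP ltz0_abs// -invr_expz -invfM -xE; exact: (mulgroupV gH).
case: (ex_minnP exP) => d /asboolP[d0 [s0 ss0 Hh0]] dmin.
pose h0 := g ^+ d * s0.
exists (h0 :: hs) => [h|x Hx].
  by rewrite inE => /predU1P[->//|/hsH[]].
have [k [s ss xE]] := Hgs _ Hx.
pose q := (k %/ d)%Z; pose m := (k %% d)%Z.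
have kE : k = q * d%:Z + m := divz_eq k d.
have d0' : d%:Z != 0 by rewrite eqz_nat -lt0n.
have m0 : 0 <= m := modz_ge0 _ d0'.
have md : m < d%:Z by rewrite ltz_pmod// ltz_nat.
pose y := x / h0 ^ q; exists q, y; last first.
  by rewrite mulrC divfK//; apply/expfz_neq0/(mulgroup_neq0 gH).
have Hy : H y by case: (gH) => _ + _; apply=> //; exact: mulgroupX.
pose s' := s / s0 ^ q.
have ss' : spn gs s' by case: (gG) => _ + _; apply=> //; exact: mulgroupX.
have yE : y = g ^ m * s'.
  rewrite /y /s' /h0 expfzMl exprnP exprz_exp xE {1}kE expfzDr// [d%:Z * q]mulrC invfM.
  have cancel (A u w z : K) : A != 0 -> A * u * w / A / z = u * w / z.
    by move=> A0; rewrite -(mulrA A) [A * _]mulrC mulfK.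
  by rewrite !mulrA cancel// expfz_neq0.
have m00 : m = 0.
  apply: contrapT => m0'; have mE : m = `|m|%N by rewrite gez0_abs.
  have /dmin : P `|m|%N.
    apply/asboolP; split; first by rewrite absz_gt0; apply/eqP.
    by exists s' => //; rewrite exprnP -mE -yE.
  by rewrite leqNgt -ltz_nat -mE md.
by apply: Hhs; split=> //; rewrite yE m00 expr0z mul1r.
Qed.

Lemma torsion_spn_finite gs :
  (forall g, g \in gs -> exists2 n, (0 < n)%N & g ^+ n = 1) -> finite_set (spn gs).
Proof.
elim: gs => [|g gs IH] gsT /=; first exact: finite_set1.
have [n n0 gn] := gsT g (mem_head _ _).
have fin := IH (fun h hgs => gsT h (mem_behead (s := g :: gs) hgs)).
apply: sub_finite_set (finite_image2 (fun i s => g ^+ i * s) (finite_II n) fin).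
move=> x [k [s ss ->]]; exists `|(k %% n)%Z|%N; last exists s => //.
  by rewrite /= -ltz_nat gez0_abs ?modz_ge0 ?ltz_pmod ?eqz_nat -?lt0n.
have nz : n%:Z != 0 by rewrite eqz_nat -lt0n.
have g0 : g != 0 by apply: contraTneq n0 => g0; move/eqP: gn; rewrite g0 expr0n; case: n {nz} => // n; rewrite eq_sym oner_eq0.
rewrite [in RHS](divz_eq k n) expfzDr// [_ * n%:Z]mulrC -exprz_exp -exprnP gn exp1rz mul1r.
by rewrite exprnP gez0_abs// modz_ge0.
Qed.

End MulGroups.

(** * Algebraic elements in characteristic zero *)

Lemma rat_embedding (K : fieldType) : [pchar K] =i pred0 -> exists f : {rmorphism rat -> K}, True.
Proof.
move=> /pcharf0P char0.
pose f (x : rat) : K := (numq x)%:~R / (denq x)%:~R.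
have int0 (n : int) : n != 0 -> n%:~R != 0 :> K.
  move=> n0; have [k [k0 [-> | ->]]] : exists k : nat, k != 0%N /\ (n = k \/ n = - k%:Z).
  - by exists `|n|%N; split; [rewrite absz_eq0|case: (leP 0 n) => n1; [left|right]; lia].
  - by rewrite -pmulrn char0.
  - by rewrite mulrNz oppr_eq0 -pmulrn char0.
have den0 x : (denq x)%:~R != 0 :> K by apply: int0; exact: denq_neq0.
have fE (a d : int) : d != 0 -> f (a%:~R / d%:~R) = a%:~R / d%:~R.
  move=> d0; set x := _ / _ : rat.
  have E : numq x * d = a * denq x.
    apply: (@intr_inj rat); rewrite !rmorphM /= [in LHS]numqE /x.
    by rewrite mulrAC divfK// intr_eq0.
  apply/eqP; rewrite /f eqr_div ?den0 ?int0// -!rmorphM /= E.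
  by rewrite mulrC.
have fD : zmod_morphism f.
  move=> x y.
  have -> : x - y = (numq x * denq y - numq y * denq x)%:~R / (denq x * denq y)%:~R.
    rewrite -{1}[x]divq_num_den -{1}[y]divq_num_den -mulNr addf_div ?intr_eq0 ?denq_neq0//.
    by rewrite mulNr intrB !intrM.
  rewrite fE ?mulf_neq0 ?denq_neq0// intrB !intrM.
  by rewrite /f -[in RHS]mulNr addf_div// mulNr.
have fM : monoid_morphism f.
  split; first by rewrite /f divr1.
  move=> x y.
  have -> : x * y = (numq x * numq y)%:~R / (denq x * denq y)%:~R.
    by rewrite -{1}[x]divq_num_den -{1}[y]divq_num_den mulf_div !intrM.
  by rewrite fE ?mulf_neq0 ?denq_neq0// !intrM /f mulf_div.
pose fZ := GRing.isZmodMorphism.Build rat K f fD.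
pose fR := GRing.isMonoidMorphism.Build rat K f fM.
by exists (HB.pack_for {rmorphism rat -> K} f fZ fR).
Qed.

Section Algebraic.
Variables (K : fieldType) (iota : {rmorphism rat -> K}).
Local Notation "p ^i" := (map_poly iota p) (at level 2).
Implicit Types (x z : K) (p q m : {poly rat}).

(** [z] generates a field containing [x]. *)
Definition in_adjoin z x := exists p, x = p^i.[z].

Lemma in_adjoinM z x y : in_adjoin z x -> in_adjoin z y -> in_adjoin z (x * y).
Proof. by move=> [p ->] [q ->]; exists (p * q); rewrite rmorphM hornerM. Qed.

Lemma in_adjoin1 z : in_adjoin z 1.
Proof. by exists 1; rewrite rmorph1 hornerC. Qed.

Lemma in_adjoin_trans z x y : in_adjoin z x -> in_adjoin x y -> in_adjoin z y.
Proof.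
move=> [p ->] [q ->]; exists (q \Po p).
by rewrite map_comp_poly horner_comp.
Qed.

(** By induction: in characteristic zero some integral combination of two algebraic
   elements generates both. *)
Lemma primitive_element (s : seq K) : (forall x, x \in s -> algebraicOver iota x) ->
  exists2 z, algebraicOver iota z & forall x, x \in s -> in_adjoin z x.
Proof.
elim: s => [|x s IH] s_alg.
  by exists 0 => //; exact: algebraic0.
have [y y_alg ys] := IH (fun x xs => s_alg x (mem_behead (s := _ :: _) xs)).
have x_alg := s_alg x (mem_head _ _).
have [p p0 px] := x_alg; have [q q0 qy] := y_alg.
have [n [[px' Ex] [py' Ey]]] := pchar0_PET p0 px q0 qy (pchar_num _).
set z := _ - _ in Ex Ey; exists z.
  by apply: algebraic_sub => //; rewrite -mulr_natr; apply: algebraic_mul => //;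
    rewrite -(rmorph_nat iota); exact: algebraic_id.
have zx : in_adjoin z x by exists px'.
have zy : in_adjoin z y by exists py'.
move=> w; rewrite inE => /predU1P[->//|/ys]; exact: in_adjoin_trans.
Qed.

Lemma minimal_poly z : algebraicOver iota z -> exists m, [/\ m \is monic, root m^i z,
  (1 < size m)%N & forall q, root q^i z -> m %| q].
Proof.
move=> [p p0 pz].
pose P n := `[< exists q, [/\ q != 0, root q^i z & size q = n] >].
have exP : exists n, P n by exists (size p); apply/asboolP; exists p.
case: (ex_minnP exP) => n /asboolP[q [q0 qz qn]] nmin.
have lc0 : lead_coef q != 0 by rewrite lead_coef_eq0.
exists ((lead_coef q)^-1 *: q); split.
- by rewrite monicE lead_coefZ mulVf.
- by rewrite rootE map_polyZ hornerZ (eqP qz) mulr0.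
- rewrite size_scale ?invr_eq0//; rewrite ltnNge; apply/negP => q1.
  move: qz q0; rewrite (size1_polyC q1) rootE map_polyC hornerC /= fmorph_eq0.
  by move=> /eqP->; rewrite eqxx.
move=> r rz; rewrite dvdpZl ?invr_eq0//; apply/modp_eq0P/eqP; apply: contraT => rq0.
have : P (size (r %% q)).
  apply/asboolP; exists (r %% q); split=> //.
  have := rz; rewrite {1}(divp_eq r q) rootE rmorphD rmorphM/= hornerD hornerM.
  by rewrite (eqP qz) mulr0 add0r.
by move=> /nmin; rewrite -qn leqNgt ltn_modp q0.
Qed.

(** The powers of [x] up to the degree of [z] are linearly dependent, being
   polynomials in [z] of smaller degree. *)
Lemma degree_in_adjoin z x m : m != 0 -> root m^i z -> in_adjoin z x ->
  exists q, [/\ q != 0, root q^i x & (size q <= size m)%N].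
Proof.
move=> m0 mz [p xE].
pose d := (size m).-1; have dE : size m = d.+1 by rewrite prednK// size_poly_gt0.
pose M : 'M[rat]_(d.+1, d) := \matrix_i poly_rV (p ^+ i %% m).
have [v v0 vM] : exists2 v : 'rV_d.+1, v != 0 & v *m M = 0.
  have : kermx M != 0.
    by rewrite -mxrank_eq0 mxrank_ker subn_eq0 -ltnNge ltnS rank_leq_col.
  by move=> /rowV0Pn[v /sub_kermxP vM v0]; exists v.
exists (rVpoly v); split.
- by apply: contra v0 => /eqP v0; rewrite -[v]rVpolyK v0 linear0.
- have sm i : (size (p ^+ i %% m)%R <= d)%N by rewrite -ltnS -dE ltn_modp.
  have S0 : \sum_(i < d.+1) v 0 i *: (p ^+ i %% m) = 0.
    transitivity (rVpoly (v *m M)); last by rewrite vM linear0.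
    rewrite mulmx_sum_row raddf_sum; apply: eq_bigr => i _ /=.
    by rewrite linearZ/= rowK poly_rV_K.
  have px i : (p ^+ i %% m)^i.[z] = x ^+ i.
    rewrite [in RHS]xE -horner_exp -rmorphXn [in RHS](divp_eq (p ^+ i) m).
    by rewrite rmorphD rmorphM/= hornerD hornerM (eqP mz) mulr0 add0r.
  rewrite rootE; have -> : (rVpoly v)^i.[x] = \sum_(i < d.+1) iota (v 0 i) * x ^+ i.
    rewrite (@horner_coef_wide _ d.+1); last by rewrite size_map_poly size_poly.
    by apply: eq_bigr => i _; rewrite coef_map coef_rVpoly_ord.
  have := congr1 (fun q => q^i.[z]) S0; rewrite rmorph0 horner0 rmorph_sum horner_sum => E.
  apply/eqP; rewrite -[RHS]E; apply: eq_bigr => i _.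
  by rewrite /= map_polyZ hornerZ px.
- by rewrite dE size_poly.
Qed.

End Algebraic.

(** * Roots of polynomials with coefficients -1, 0, 1 *)

Definition flat (e : {poly int}) : Prop := e != 0 /\ forall i, e`_i \in [:: -1; 0; 1].

Definition flat_root (F : fieldType) (x : F) : Prop :=
  exists2 e, flat e & root (map_poly intr e) x.

Lemma flat_lead e : flat e -> lead_coef e = 1 \/ lead_coef e = -1.
Proof.
move=> [e0 ec]; have := ec (size e).-1; rewrite -lead_coefE !inE (negPf (_ : _ != 0)) ?lead_coef_eq0//.
by move=> /orP[/eqP|/eqP]; [right|left].
Qed.

Lemma flat_root_integral (F : fieldType) (x : F) : flat_root x -> integralOver (intr : int -> F) x.
Proof.
move=> [e /flat_lead el ex]; exists (lead_coef e *: e).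
  by rewrite monicE lead_coefZ; case: el => ->.
by rewrite rootE map_polyZ hornerZ (eqP ex) mulr0.
Qed.

Lemma poly_roots_finite (F : fieldType) (p : {poly F}) : p != 0 -> finite_set [set x | root p x].
Proof.
move=> p0; pose P n := `[< exists s : seq F, [/\ uniq s, all (root p) s & size s = n] >].
have exP : exists n, P n by exists 0%N; apply/asboolP; exists [::].
have ubP n : P n -> (n <= size p)%N.
  by move=> /asboolP[s [us sp <-]]; exact/ltnW/max_poly_roots.
case: (ex_maxnP exP ubP) => n /asboolP[s [us sp sn]] nmax.
apply/finite_seqP; exists s; apply/seteqP; split=> x /=; last by move=> xs; exact: (allP sp).
move=> px; apply: contraT => xs; have : P n.+1.
  by apply/asboolP; exists (x :: s); rewrite /= xs us px sp sn.
by move=> /nmax; rewrite ltnn.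
Qed.

Lemma bounded_int_polys_finite n (N : nat) :
  finite_set [set q : {poly int} | (size q <= n)%N /\ forall i, (`|(q`_i)%R|%N <= N)%N].
Proof.
pose g (f : {ffun 'I_n -> 'I_(N + N).+1}) : {poly int} :=
  \sum_(i < n) ((f i)%:Z - N%:Z) *: 'X^i.
have : finite_set (range g) by exact: finite_image.
apply: sub_finite_set => q [sq qN]; exists [ffun i : 'I_n => inord `|(q`_i + N%:Z)%R|%N] => //.
rewrite /g; transitivity (\poly_(i < n) q`_i); last first.
  by apply/polyP => i; rewrite coef_poly; case: ltnP => // ni; rewrite nth_default// (leq_trans sq).
rewrite poly_def; apply: eq_bigr => i _; congr (_ *: _); rewrite ffunE inordK; have := qN i; lia.
Qed.

Section ComplexBounds.
Variable R : realType.
Local Notation C := (cplx R).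

Lemma cmod_int (n : int) : cmod (n%:~R : C) = `|n|%N%:R.
Proof.
have [k [->|->]] : exists k : nat, n = k \/ n = - k%:Z.
- by exists `|n|%N; case: (leP 0 n) => n1; [left|right]; lia.
- by rewrite -pmulrn cmod_nat.
- by rewrite mulrNz -pmulrn cmodN cmod_nat abszN.
Qed.

Lemma cplx_split (p : {poly C}) : exists s : seq C, p = lead_coef p *: \prod_(z <- s) ('X - z%:P).
Proof.
have [n sp] := ubnP (size p); elim: n p sp => // n IH p sp.
have [p1|p1] := leqP (size p) 1.
  by exists [::]; rewrite big_nil (size1_polyC p1) lead_coefC alg_polyC.
have [z /factor_theorem[q pq]] := cplx_root p1.
have q0 : q != 0 by apply: contraTneq p1 => q0; rewrite pq q0 mul0r size_poly0.
have [|s qs] := IH q.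
  by move: sp; rewrite pq size_mul ?polyXsubC_eq0// size_XsubC addn2.
exists (z :: s); rewrite big_cons {1}pq {1}qs pq lead_coefM lead_coefXsubC mulr1.
by rewrite -scalerAl mulrC.
Qed.

Lemma flat_root_lt2 (y : C) : flat_root y -> cmod y < 2.
Proof.
move=> [e fe ye]; rewrite ltNge; apply/negP => y2.
pose n := (size e).-1; have eE : size e = n.+1 by rewrite prednK// size_poly_gt0; case: fe.
have geom k : \sum_(i < k) cmod y ^+ i + 1 <= cmod y ^+ k.
  elim: k => [|k IH]; first by rewrite big_ord0 add0r expr0.
  rewrite big_ord_recr exprS /= addrAC.
  have : 2 * cmod y ^+ k <= cmod y * cmod y ^+ k by rewrite ler_wpM2r// exprn_ge0// cmod_ge0.
  by lra.
have lead1 : cmod ((lead_coef e)%:~R : C) = 1.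
  by case: (flat_lead fe) => ->; rewrite ?rmorphN1 ?cmodN ?cmod1.
have coef1 i : cmod ((e`_i)%:~R : C) <= 1.
  have := fe.2 i; rewrite !inE => /or3P[]/eqP->; rewrite ?rmorphN1 ?cmodN ?cmod1//.
  by rewrite cmod0.
move: ye; rewrite rootE (@horner_coef_wide _ n.+1) ?eE ?(leq_trans (size_poly _ _)) ?eE//.
rewrite big_ord_recr /= !coef_map /=.
have -> : e`_n = lead_coef e by rewrite lead_coefE.
rewrite addr_eq0 => /eqP/(congr1 (@cmod R)); rewrite cmodN cmodM cmodX lead1 mul1r => E.
have := geom n; rewrite -E leNgt => /negP; apply.
rewrite ltr_pwDr// (le_trans (cmod_sum _ _))//; apply: ler_sum => i _.
by rewrite coef_map cmodM cmodX; apply: ler_piMl; [rewrite exprn_ge0// cmod_ge0|exact: coef1].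
Qed.

Lemma coef_prod_le (s : seq C) : all (fun y => cmod y <= 2) s ->
  forall i, cmod (\prod_(z <- s) ('X - z%:P))`_i <= 3 ^+ size s.
Proof.
elim: s => [_ i|z s IH /= /andP[z2 s2] i].
  by rewrite big_nil coef1; case: eqP; rewrite ?cmod1 ?cmod0 ?expr0//.
rewrite big_cons mulrBl coefB coefXM mulrC coefMC exprS.
have IHi := IH s2.
have h1 : cmod (if i == 0%N then 0 else (\prod_(z <- s) ('X - z%:P))`_i.-1) <= 3 ^+ size s.
  by case: ifP => _; rewrite ?cmod0 ?exprn_ge0.
apply: le_trans (cmodD _ _) _; rewrite cmodN cmodM.
have : cmod (\prod_(j <- s) ('X - j%:P))`_i * cmod z <= 3 ^+ size s * 2.
  by rewrite ler_pM ?cmod_ge0.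
lra.
Qed.

End ComplexBounds.

(** Northcott: a number field contains finitely many flat roots, because their
   minimal polynomials are monic integer polynomials of bounded degree all of
   whose complex roots have modulus less than 2. *)
Lemma flat_roots_in_adjoin_finite (R : realType) (K : fieldType) (iota : {rmorphism rat -> K}) (z : K) :
  algebraicOver iota z -> finite_set [set x | in_adjoin iota z x /\ flat_root x].
Proof.
move=> [m m0 mz]; pose d := size m.
pose Q := [set q : {poly int} | (size q <= d)%N /\ forall i, (`|(q`_i)%R|%N <= 3 ^ d)%N].
have intrE p : map_poly iota (map_poly intr p) = map_poly intr p :> {poly K}.
  by rewrite -map_poly_comp; apply: eq_map_poly => k /=; rewrite rmorph_int.
suff : finite_set (\bigcup_(q in Q `&` [set q | map_poly intr q != 0 :> {poly K}])
    [set x | root (map_poly intr q : {poly K}) x]); last first.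
  apply: bigcup_finite => [|q [_ q0]]; last exact: poly_roots_finite.
  apply: finite_setIl; exact: bounded_int_polys_finite.
apply: sub_finite_set => x [xz [e fe ex]].
have [q [q0 qx sq]] := degree_in_adjoin m0 mz xz.
have [mx [mx_mon mxx mx1 mxdiv]] := minimal_poly (ex_intro2 _ _ q q0 qx).
have : mx %| map_poly intr e by apply: mxdiv; rewrite intrE.
move=> /dvdpP_rat_int[p1 [a a0 mxE] [r eE]].
have smx : size mx = size p1.
  by rewrite mxE size_scale// size_rat_int_poly.
have lp : lead_coef p1 = 1 \/ lead_coef p1 = -1.
  have : `|(lead_coef p1 * lead_coef r)%R|%N = 1%N.
    by rewrite -lead_coefM -eE; case: (flat_lead fe) => ->.
  rewrite abszM => /eqP; rewrite muln_eq1 => /andP[/eqP p1E _].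
  by case: (lead_coef p1) p1E => -[|[|k]]//= _; [left|right].
pose q1 := lead_coef p1 *: p1.
have q1mon : q1 \is monic by rewrite monicE lead_coefZ; case: lp => ->.
have lp0 : lead_coef p1 != 0 by case: lp => ->.
have q1x : root (map_poly intr q1 : {poly K}) x.
  move: mxx; rewrite mxE map_polyZ intrE rootE hornerZ mulf_eq0 fmorph_eq0 (negPf a0)/= => p1x.
  by rewrite rootE map_polyZ hornerZ (eqP p1x) mulr0.
have sq1 : size q1 = size p1 by rewrite size_scale.
have sq1d : (size q1 <= d)%N.
  rewrite sq1 -smx (leq_trans _ sq)// dvdp_leq//; exact: mxdiv.
exists q1; last exact: q1x; split; last first.
  by rewrite /= map_poly_eq0_id0 ?monic_neq0// (monicP q1mon) oner_neq0.
split=> // i.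
have [s qs] := cplx_split (map_poly intr q1 : {poly cplx R}).
have monC : (map_poly intr q1 : {poly cplx R}) \is monic.
  by rewrite monicE lead_coef_map_id0 ?(monicP q1mon) ?oner_neq0.
rewrite (monicP monC) scale1r in qs.
have small : all (fun y => cmod y <= 2) s.
  apply/allP => y ys; apply: ltW; apply: flat_root_lt2; exists e => //.
  have : root (map_poly intr q1) y by rewrite qs root_prod_XsubC.
  rewrite rootE map_polyZ hornerZ mulf_eq0 => /orP[|p1y].
    by case: lp => ->; rewrite ?rmorphN1 ?oppr_eq0 oner_eq0.
  by rewrite eE rmorphM rootE hornerM (eqP p1y) mul0r.
have := coef_prod_le small i; rewrite -qs coef_map /= cmod_int -natrX ler_nat => /leq_trans; apply.
rewrite leq_exp2l// ltnW// -ltnS.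
have : size (map_poly intr q1 : {poly cplx R}) = (size s).+1 by rewrite qs size_prod_XsubC.
rewrite size_map_poly_id0 ?(monicP q1mon) ?oner_neq0// => <-.
by rewrite ltnS.
Qed.

(** * Archimedean absolute values *)

Lemma monic_power_mod (F : fieldType) (t : F) (g : {poly int}) k :
  g \is monic -> root (map_poly intr g) t ->
  t ^+ k = (map_poly intr (Pdiv.Ring.rmodp 'X^k g)).[t].
Proof.
move=> gm gt; have := Pdiv.RingMonic.rdivp_eq gm ('X^k).
move=> /(congr1 (fun q => (map_poly (intr : int -> F) q).[t])).
rewrite map_polyXn hornerXn rmorphD rmorphM/= hornerD hornerM (eqP gt).
by rewrite mulr0 add0r.
Qed.

Section Kronecker.
Context {R : realType} {K : fieldType} (iota : {rmorphism rat -> K}).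
Local Notation C := (cplx R).
Variables (j : {rmorphism rat -> C}) (z : K) (m : {poly rat}).
Hypotheses (m_monic : m \is monic) (mz : root (map_poly iota m) z) (m1 : (1 < size m)%N)
  (m_min : forall q, root (map_poly iota q) z -> m %| q).

Let m0 : m != 0. Proof. exact: monic_neq0. Qed.

Let m_separable : separable_poly m.
Proof.
rewrite separable_poly.unlock /coprimep; set g := gcdp m m^`().
have gm : g %| m := dvdp_gcdl _ _.
have d0 : m^`() != 0.
  apply/eqP => d0; have := congr1 (fun q : {poly rat} => q`_(size m).-2) d0.
  have sE : (size m).-2.+1 = (size m).-1 by move: m1; case: (size m) => [|[]].
  rewrite coef_deriv coef0 sE -lead_coefE (monicP m_monic) => /eqP.
  by rewrite pnatr_eq0; move: m1; case: (size m) => [|[]].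
have g0 : g != 0 by rewrite gcdp_eq0 (negPf m0).
have sgd : (size g <= size m^`())%N by rewrite dvdp_leq// dvdp_gcdr.
have sg : (size g < size m)%N by rewrite (leq_ltn_trans sgd)// lt_size_deriv.
have /dvdpP[u uE] := gm.
have u0 : u != 0 by apply: contraNneq m0 => u0; rewrite uE u0 mul0r.
have : root (map_poly iota u) z || root (map_poly iota g) z.
  by move: mz; rewrite uE rmorphM rootM.
case/orP => [uz|gz]; last first.
  by have := dvdp_leq g0 (m_min gz); rewrite leqNgt sg.
have := dvdp_leq u0 (m_min uz); rewrite {1}uE size_mul//.
have : (0 < size u)%N by rewrite size_poly_gt0.
have : (0 < size g)%N by rewrite size_poly_gt0.
by move: (size g) (size u) => a b; lia.
Qed.

(** Kronecker: if all conjugates of the algebraic integer [t] have modulus one,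
   the coordinates of its powers are bounded, by inverting a Vandermonde matrix,
   and have bounded denominators: there are only finitely many powers. *)
Lemma kronecker (t : K) (p : {poly rat}) : t = (map_poly iota p).[z] ->
  integralOver (intr : int -> K) t -> t != 0 ->
  (forall w : C, root (map_poly j m) w -> cmod (map_poly j p).[w] = 1) ->
  exists2 n, (0 < n)%N & t ^+ n = 1.
Proof.
move=> tE [g gm gt] t0 conj1.
pose d := (size m).-1; have dE : size m = d.+1 by rewrite prednK// (ltnW m1).
pose r k := (p ^+ k %% m : {poly rat}).
have sr k : (size (r k) <= d)%N by rewrite -ltnS -dE ltn_modp.
have rz k : (map_poly iota (r k)).[z] = t ^+ k.
  rewrite [in RHS]tE -horner_exp -rmorphXn [in RHS](divp_eq (p ^+ k) m).
  by rewrite rmorphD rmorphM/= hornerD hornerM (eqP mz) mulr0 add0r.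
have [s ms] := cplx_split (map_poly j m).
have jm : map_poly j m \is monic by rewrite monic_map.
rewrite (monicP jm) scale1r in ms.
have us : uniq s by rewrite -separable_prod_XsubC -ms separable_map.
have ss : size s = d.
  by apply/eqP; rewrite -eqSS -(size_prod_XsubC s id) -ms size_map_poly dE.
have rw k w : w \in s -> (map_poly j (r k)).[w] = (map_poly j p).[w] ^+ k.
  move=> ws; have mw : root (map_poly j m) w by rewrite ms root_prod_XsubC.
  rewrite -horner_exp -rmorphXn [in RHS](divp_eq (p ^+ k) m).
  by rewrite rmorphD rmorphM/= hornerD hornerM (eqP mw) mulr0 add0r.
pose a : 'rV[C]_d := \row_i s`_i.
pose V := Vandermonde d a.
have as_ i : a 0 i \in s by rewrite mxE mem_nth// ss.
have Vu : V \in unitmx.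
  rewrite unitmxE det_Vandermonde unitfE; apply/prodf_neq0 => i _.
  apply/prodf_neq0 => i' ii'; rewrite subr_eq0 !mxE nth_uniq ?ss//.
  by rewrite neq_ltn ii' orbT.
pose c k : 'rV[C]_d := \row_i j (r k)`_i.
have cV k : c k *m V = \row_i (map_poly j p).[a 0 i] ^+ k.
  apply/rowP => i; rewrite [RHS]mxE -rw// [RHS](@horner_coef_wide _ d) ?size_map_poly//.
  by rewrite mxE; apply: eq_bigr => l _; rewrite !mxE coef_map.
pose Mx := \sum_i \sum_l cmod (invmx V i l).
have cM k i : cmod (c k 0 i) <= Mx.
  rewrite -[c k](mulmxK Vu) cV mxE (le_trans (cmod_sum _ _))// /Mx.
  apply: ler_sum => l _; rewrite mxE cmodM cmodX conj1 ?ms ?root_prod_XsubC//.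
  rewrite expr1n mul1r (bigD1 i)//= lerDl sumr_ge0// => l' _; exact: cmod_ge0.
pose e := (size g).-1.
have [N N0 NP] : exists2 N : int, N != 0 & forall k, (k < e)%N ->
    exists u : {poly int}, N%:~R *: r k = map_poly intr u.
  elim: e => [|e [N N0 NP]]; first by exists 1.
  have [u [b b0 rE]] := rat_poly_scale (r e).
  exists (N * b) => [|k]; first by rewrite mulf_neq0.
  rewrite ltnS leq_eqVlt => /predU1P[->|/NP[u' uE]].
    by exists (N *: u); rewrite map_polyZ intrM -scalerA rE scalerKV ?intr_eq0.
  by exists (b *: u'); rewrite map_polyZ mulrC intrM -scalerA uE.
have rE k : exists u : {poly int}, N%:~R *: r k = map_poly intr u.
  pose n := Pdiv.Ring.rmodp 'X^k g.
  have sn : (size n <= e)%N.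
    rewrite -ltnS prednK ?size_poly_gt0 ?monic_neq0//.
    by rewrite Pdiv.Ring.ltn_rmodp monic_neq0.
  have -> : r k = \sum_(i < e) (n`_i)%:~R *: r i.
    apply/eqP; rewrite -subr_eq0; apply: contraT => D0.
    have : root (map_poly iota (r k - \sum_(i < e) (n`_i)%:~R *: r i)) z.
      rewrite rootE rmorphB rmorph_sum/= hornerD hornerN horner_sum rz subr_eq0.
      rewrite (monic_power_mod k gm gt) -/n (@horner_coef_wide _ e); last first.
        by rewrite (leq_trans (size_poly _ _)).
      apply/eqP/eq_bigr => i _; rewrite map_polyZ hornerZ rz coef_map /=.
      by rewrite rmorph_int.
    move=> /m_min/(dvdp_leq D0); rewrite dE ltnNge (leq_trans (size_polyD _ _))//.
    rewrite size_polyN geq_max sr/= (leq_trans (size_sum _ _ _))//.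
    by apply/bigmax_leqP => i _; rewrite (leq_trans (size_scale_leq _ _)).
  have /choice[u uP] : forall i : 'I_e, exists u : {poly int}, N%:~R *: r i = map_poly intr u.
    by move=> i; exact: NP.
  exists (\sum_(i < e) n`_i *: u i); rewrite rmorph_sum scaler_sumr; apply: eq_bigr => i _.
  by rewrite /= map_polyZ -uP !scalerA mulrC.
have /choice[u uP] := rE.
have [B BP] : exists B : nat, `|N|%N%:R * Mx <= B%:R.
  exists (Num.truncn (`|N|%N%:R * Mx)).+1.
  by apply/ltW/truncnS_gt.
have ufin := bounded_int_polys_finite d B.
have uin k : [set q : {poly int} | (size q <= d)%N /\ forall i, (`|(q`_i)%R|%N <= B)%N] (u k).
  split.
    by rewrite -(size_rat_int_poly (u k)) -uP size_scale ?intr_eq0.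
  move=> i; have [id|di] := ltnP i d; last first.
    rewrite nth_default// -(size_rat_int_poly (u k)) -uP size_scale ?intr_eq0//.
    by rewrite (leq_trans (sr k)).
  have := congr1 (fun q : {poly rat} => cmod (j q`_i)) (uP k).
  rewrite coefZ coef_map rmorphM !rmorph_int cmodM /= !cmod_int => uE.
  rewrite -(ler_nat R) -uE (le_trans _ BP)// ler_wpM2l//.
  by have := cM k (Ordinal id); rewrite mxE.
have [k [l [kl ukl]]] := finite_repeat ufin uin.
have tk n : (N%:~R : K) * t ^+ n = (map_poly intr (u n)).[z].
  rewrite -rz -[N%:~R](rmorph_int iota) -hornerZ -map_polyZ uP -map_poly_comp.
  by congr (_.[_]); apply: eq_map_poly => i /=; rewrite rmorph_int.
exists (l - k)%N; first by rewrite subn_gt0.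
have N0K : (N%:~R : K) != 0 by rewrite -(rmorph_int iota) fmorph_eq0 intr_eq0.
apply: (mulfI (expf_neq0 k t0)); rewrite -exprD subnKC ?(ltnW kl)// mulr1.
by apply: (mulfI N0K); rewrite !tk ukl.
Qed.

End Kronecker.

Lemma pairwise_in (T : eqType) (r : rel T) (s : seq T) : symmetric r -> pairwise r s ->
  {in s &, forall x y, x != y -> r x y}.
Proof.
move=> rs; elim: s => //= t s IH /andP[/allP rt ps] x y.
rewrite !inE => /predU1P[->|xs] /predU1P[->|ys] xy; first by rewrite eqxx in xy.
- exact: rt.
- by rewrite rs; exact: rt.
- exact: IH.
Qed.

Section Lacunary.
Context {R : realType} {T : eqType} (f : T -> cplx R).

Let lac s t := 2 * cmod (f t) <= cmod (f s).

Let signs (e : T -> cplx R) := forall t, e t \in [:: -1; 0; 1].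

Let path_lt e t V : signs e -> f t != 0 -> (forall s, s \in V -> f s != 0) ->
  path lac t V -> cmod (\sum_(s <- V) e s * f s) < cmod (f t).
Proof.
move=> e1; elim: V t => [|s V IH] t t0 V0 /=; first by rewrite big_nil cmod0 cmod_gt0.
move=> /andP[ts sV]; rewrite big_cons (le_lt_trans (cmodD _ _))// cmodM.
have := IH s (V0 s (mem_head _ _)) (fun u uV => V0 u (mem_behead (s := s :: V) uV)) sV.
have : cmod (e s) * cmod (f s) <= cmod (f s).
  rewrite ler_piMl ?cmod_ge0//.
  by have := e1 s; rewrite !inE => /or3P[]/eqP->; rewrite ?cmodN ?cmod1 ?cmod0.
by move: ts; rewrite /lac; lra.
Qed.

Let sorted_indep e V : signs e -> (forall s, s \in V -> f s != 0) -> sorted lac V ->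
  \sum_(s <- V) e s * f s = 0 -> forall s, s \in V -> e s = 0.
Proof.
move=> e1; elim: V => //= t V IH V0 pV; rewrite big_cons => E.
have V0' u : u \in V -> f u != 0 by move=> uV; apply: V0; rewrite inE uV orbT.
have et : e t = 0.
  apply/eqP; apply: contraT => et0; have := path_lt e1 (V0 t (mem_head _ _)) V0' pV.
  move/eqP: E; rewrite addr_eq0 => /eqP/(congr1 (@cmod R)); rewrite cmodN cmodM => <-.
  have -> : cmod (e t) = 1.
    by have := e1 t; rewrite !inE => /or3P[]/eqP ee; rewrite ?ee ?cmodN ?cmod1//; rewrite ee eqxx in et0.
  by rewrite mul1r ltxx.
move=> s; rewrite inE => /predU1P[->//|]; apply: IH => //; first exact: path_sorted pV.
by move: E; rewrite et mul0r add0r.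
Qed.

(** In decreasing order of modulus each term dominates the sum of the following
   ones. *)
Lemma lacunary_independent e V : (forall t, e t \in [:: -1; 0; 1]) -> uniq V ->
  (forall s, s \in V -> f s != 0) ->
  {in V &, forall s t, s != t -> lac s t \/ lac t s} ->
  \sum_(s <- V) e s * f s = 0 -> forall s, s \in V -> e s = 0.
Proof.
move=> e1 uV V0 sep E s sV.
pose le s t := cmod (f t) <= cmod (f s).
have le_tr : transitive le by move=> t s' u; rewrite /le => h1 h2; exact: le_trans h2 h1.
have le_tot : total le by move=> t u; rewrite /le; exact: le_total.
have pV : perm_eq (sort le V) V by rewrite perm_sort.
apply: (@sorted_indep e (sort le V)) => //; [| |by rewrite (perm_big _ pV)|by rewrite mem_sort].
  by move=> t; rewrite mem_sort; exact: V0.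
apply: pairwise_sorted; apply/(pairwiseP s) => i k; rewrite !inE size_sort => iV kV ik.
have : pairwise le (sort le V) by rewrite -sorted_pairwise ?sort_sorted.
move=> /(pairwiseP s)/(_ i k); rewrite !inE size_sort => /(_ iV kV ik).
set a := nth _ _ i; set b := nth _ _ k => ab.
have aV : a \in V by rewrite -(mem_sort le) mem_nth ?size_sort.
have bV : b \in V by rewrite -(mem_sort le) mem_nth ?size_sort.
have neq : a != b by rewrite /a /b nth_uniq ?size_sort ?sort_uniq// ltn_eqF.
have [//|ba] := sep _ _ aV bV neq.
by have := cmod_gt0 (V0 _ aV); move: ab ba; rewrite /le /lac; lra.
Qed.

End Lacunary.

Section ArchimedeanLevel.
Context {R : realType} {K : fieldType} (iota : {rmorphism rat -> K}).
Local Notation C := (cplx R).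

(** By Kronecker's theorem some complex embedding [phi] of [Q(z)] gives [t] a modulus
   other than 1. For [log2 (cmod phi)] separated elements have lacunary images. *)
Lemma archimedean_level (z t : K) (H : set K) :
  algebraicOver iota z -> mulgroup H -> H `<=` in_adjoin iota z ->
  H t -> integralOver (intr : int -> K) t -> (forall n, (0 < n)%N -> t ^+ n != 1) ->
  exists chi : K -> R, [/\ forall x y, H x -> H y -> chi (x * y) = chi x + chi y,
    chi t != 0 &
    forall V : seq (kstar K), (forall s, s \in V -> H (kval s)) ->
      pairwise (fun s s' => 1 <= `|chi (kval s) - chi (kval s')|) V -> dissociated V].
Proof.
move=> z_alg gH Hz Ht t_int t_inf.
have charC : [pchar C] =i pred0.
  apply/pcharf0P => n; apply/eqP/eqP => [/(congr1 (@cmod R))|->//].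
  by rewrite cmod_nat cmod0 => /eqP; rewrite pnatr_eq0 => /eqP.
have [j _] := rat_embedding charC.
have [m [m_mon mz m1 m_min]] := minimal_poly z_alg.
have /choice[P PE] : forall x, exists p, H x -> x = (map_poly iota p).[z].
  by move=> x; have [/Hz[p xE]|nHx] := pselect (H x); [exists p|exists 0].
have [w mw wt] : exists2 w : C, root (map_poly j m) w & cmod (map_poly j (P t)).[w] != 1.
  apply: contrapT => nex.
  have [n n0 tn] := @kronecker _ _ _ j _ _ m_mon mz m1 m_min _ _ (PE _ Ht) t_int
    (mulgroup_neq0 gH Ht) (fun w mw => contrapT (fun ne => nex (ex_intro2 _ _ w mw (introN eqP ne)))).
  by have := t_inf _ n0; rewrite tn eqxx.
pose phi x := (map_poly j (P x)).[w].
have trans (q q' : {poly rat}) : (map_poly iota q).[z] = (map_poly iota q').[z] ->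
    (map_poly j q).[w] = (map_poly j q').[w].
  move=> qq'; have /m_min/dvdpP[u uE] : root (map_poly iota (q - q')) z.
    by rewrite rootE rmorphB hornerD hornerN qq' subrr.
  by apply/eqP; rewrite -subr_eq0 -hornerN -hornerD -rmorphB uE rmorphM hornerM (eqP mw) mulr0.
have phiM x y : H x -> H y -> phi (x * y) = phi x * phi y.
  move=> Hx Hy; rewrite /phi -hornerM -rmorphM; apply: trans.
  by rewrite rmorphM hornerM -!PE//; exact: mulgroupM.
have phi1 : phi 1 = 1.
  rewrite /phi (trans _ 1) ?rmorph1 ?hornerC// -PE//; exact: mulgroup1.
have phi0 x : H x -> phi x != 0.
  move=> Hx; apply/eqP => phix; have := phiM _ _ Hx (mulgroupV gH Hx).
  rewrite divff ?(mulgroup_neq0 gH Hx)// phi1 phix mul0r => /eqP.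
  by rewrite oner_eq0.
have pos x : H x -> 0 < cmod (phi x) by move=> /phi0; exact: cmod_gt0.
have ln2 : 0 < ln (2 : R) by rewrite ln_gt0// ltr1n.
exists (fun x => ln (cmod (phi x)) / ln 2); split.
- move=> x y Hx Hy; rewrite -mulrDl phiM// cmodM lnM ?posrE//; exact: pos.
- by apply: mulf_neq0; [rewrite ln_eq0 ?pos|rewrite invr_eq0 lt0r_neq0].
- move=> V VH sepV e e1 e0.
  have uV : uniq V.
    apply: pairwise_uniq sepV => s; rewrite subrr normr0 ler10; exact/negbTE.
  pose er s : rat := if e s == 1 then 1 else if e s == -1 then -1 else 0.
  have erE s : iota (er s) = e s.
    rewrite /er; have := e1 s; rewrite !inE.
    case: (e s =P 1) => [-> _|_]; first by rewrite rmorph1.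
    case: (e s =P -1) => [-> _|_]; first by rewrite rmorphN1.
    by rewrite orbF rmorph0 => /eqP.
  have ers s : j (er s) \in [:: -1; 0; 1].
    by rewrite /er; do 2?case: ifP => _; rewrite ?rmorph1 ?rmorphN1 ?rmorph0 !inE eqxx ?orbT.
  have sum0 : \sum_(s <- V) j (er s) * phi (kval s) = 0.
    have := @trans (\sum_(s <- V) er s *: P (kval s)) 0.
    rewrite !rmorph_sum !rmorph0 !horner0 !horner_sum => H0.
    rewrite -[RHS]H0.
      by apply: eq_bigr => s _; rewrite /= map_polyZ hornerZ.
    rewrite -[RHS]e0 !big_seq; apply: eq_bigr => s sV.
    by rewrite /= map_polyZ hornerZ erE -PE//; exact: VH.
  have sep : {in V &, forall s s', s != s' ->
      2 * cmod (phi (kval s')) <= cmod (phi (kval s)) \/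
      2 * cmod (phi (kval s)) <= cmod (phi (kval s'))}.
    move=> s s' sV s'V ss'.
    have sep1 : 1 <= `|ln (cmod (phi (kval s))) / ln 2 - ln (cmod (phi (kval s'))) / ln 2|.
      apply: (pairwise_in _ sepV) => //.
      by move=> u v; rewrite distrC.
    have lnle (u v : R) : 0 < u -> 0 < v -> ln v / ln 2 + 1 <= ln u / ln 2 -> 2 * v <= u.
      move=> u0 v0 le_uv; have := ler_wpM2r (ltW ln2) le_uv.
      rewrite mulrDl !divfK ?lt0r_neq0// mul1r => le_uv'.
      have two0 : 0 < (2 : R) by [].
      rewrite -ler_ln ?posrE ?mulr_gt0// lnM ?posrE// addrC; exact: le_uv'.
    have ps := pos _ (VH _ sV); have ps' := pos _ (VH _ s'V).
    move: sep1; rewrite lter_normr => /orP[le1|le1]; [left|right]; apply: lnle => //; lra.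
  move=> s sV; rewrite -erE.
  have := lacunary_independent ers uV _ sep sum0 sV.
  move=> /(_ (fun s sV => phi0 _ (VH s sV)))/eqP; rewrite fmorph_eq0 => /eqP->.
  by rewrite rmorph0.
Qed.

End ArchimedeanLevel.

(** * Level characters *)

Section FinitelyGenerated.
Context {R : realType} {K : fieldType}.
Implicit Types (H V : set K) (gs : seq K).

Definition is_torsion (t : K) : Prop := exists2 n, (0 < n)%N & t ^+ n = 1.

(** Powers of an integral element are integral combinations of finitely many of
   them, and in positive characteristic the coefficients take finitely many
   values. *)
Lemma integral_torsion (q : nat) (t : K) : q \in [pchar K] -> t != 0 ->
  integralOver (intr : int -> K) t -> is_torsion t.
Proof.
move=> qK t0 [g gm gt].
have q0 : (0 < q)%N by rewrite prime_gt0// (pcharf_prime qK).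
have modq (n : int) : (n %% q)%Z%:~R = n%:~R :> K.
  by rewrite [in RHS](divz_eq n q) [RHS]intrD intrM -pmulrn (pcharf0 qK) mulr0 add0r.
pose u k : {poly int} := \poly_(i < size g) ((Pdiv.Ring.rmodp 'X^k g)`_i %% q)%Z.
have uin k : [set e : {poly int} | (size e <= size g)%N /\
    forall i, (`|(e`_i)%R|%N <= q)%N] (u k).
  split=> [|i]; first exact: size_poly.
  rewrite coef_poly; case: ifP => // _.
  by have := @modz_ge0 ((Pdiv.Ring.rmodp 'X^k g)`_i) q; have := @ltz_pmod ((Pdiv.Ring.rmodp 'X^k g)`_i) q; lia.
have uE k : t ^+ k = (map_poly intr (u k)).[t].
  rewrite (monic_power_mod k gm gt); congr (_.[_]); apply/polyP => i.
  rewrite !coef_map_id0// coef_poly; case: ifPn => [_|]; first by rewrite modq.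
  by rewrite -leqNgt => gi; rewrite nth_default// (leq_trans _ gi)// ltnW// Pdiv.Ring.ltn_rmodp monic_neq0.
have [k [l [kl ukl]]] := finite_repeat (bounded_int_polys_finite (size g) q) uin.
exists (l - k)%N; first by rewrite subn_gt0.
by apply: (mulfI (expf_neq0 k t0)); rewrite -exprD subnKC ?(ltnW kl)// mulr1 !uE ukl.
Qed.

Lemma torsion_mulgroup H : mulgroup H -> mulgroup [set x | H x /\ is_torsion x].
Proof.
move=> gH; split=> [|x y [Hx [n n0 xn]] [Hy [m m0 ym]]|x [Hx _]].
- by split; [exact: mulgroup1|exists 1%N].
- split; first by case: (gH) => _ + _; apply.
  exists (n * m)%N; first by rewrite muln_gt0 n0.
  by rewrite exprMn exprVn exprM xn mulnC exprM ym !expr1n invr1 mulr1.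
- exact: mulgroup_neq0 Hx.
Qed.

Lemma torsion_finite H gs : (forall g, g \in gs -> g != 0) -> mulgroup H ->
  H `<=` spn gs -> finite_set [set x | H x /\ is_torsion x].
Proof.
move=> gs0 gH Hgs.
have [x [Hx _]|hs hsT sub] := @subgroup_fg _ gs [set x | H x /\ is_torsion x] gs0 (torsion_mulgroup gH).
  exact: Hgs.
apply: sub_finite_set sub _; apply: torsion_spn_finite => h /hsT[_ [n n0 hn]].
by exists n.
Qed.

Lemma integral_algebraic (iota : {rmorphism rat -> K}) t :
  integralOver (intr : int -> K) t -> algebraicOver iota t.
Proof.
move=> [g gm gt]; exists (map_poly intr g).
  by rewrite monic_neq0// monic_map.
rewrite -map_poly_comp (eq_map_poly (g := intr)) // => i /=.
by rewrite rmorph_int.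
Qed.

Lemma algebraic_part_in_adjoin (iota : {rmorphism rat -> K}) H gs :
  (forall g, g \in gs -> g != 0) -> mulgroup H -> H `<=` spn gs ->
  exists2 z, algebraicOver iota z &
    forall x, H x -> algebraicOver iota x -> in_adjoin iota z x.
Proof.
move=> gs0 gH Hgs; pose A := [set x | H x /\ algebraicOver iota x].
have gA : mulgroup A.
  split=> [|x y [Hx ax] [Hy ay]|x [Hx _]].
  - by split; [exact: mulgroup1|exact: algebraic1].
  - by split; [case: (gH) => _ + _; apply|apply: algebraic_div].
  - exact: mulgroup_neq0 Hx.
have [x [Hx _]|hs hsA sub] := @subgroup_fg _ gs A gs0 gA; first exact: Hgs.
have [|z z_alg zhs] := @primitive_element _ iota (hs ++ map GRing.inv hs).
  move=> x; rewrite mem_cat => /orP[/hsA[]//|/mapP[h /hsA[_ ah] ->]].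
  exact: algebraic_inv.
exists z => // x Hx ax; pose Z := [set x | [/\ in_adjoin iota z x, in_adjoin iota z x^-1 & x != 0]].
have gZ : mulgroup Z.
  split=> [|{Hx ax}x y [zx zx' x0] [zy zy' y0]|{Hx ax}x [_ _]//].
    by split; rewrite ?invr1 ?oner_neq0//; exact: in_adjoin1.
  by split; rewrite ?mulf_neq0 ?invr_eq0// ?invfM ?invrK; apply: in_adjoinM.
have [] // : Z x; apply: (spn_sub gZ (gs := hs)); last exact: sub.
move=> h hh; have [Hh _] := hsA h hh; split; last exact: mulgroup_neq0 Hh.
  by apply: zhs; rewrite mem_cat hh.
by apply: zhs; rewrite mem_cat map_f ?orbT.
Qed.

(** In positive characteristic flat roots are roots of unity; in characteristic
   zero they are algebraic integers of bounded height in one number field. *)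
Lemma flat_roots_finite H gs : (forall g, g \in gs -> g != 0) -> mulgroup H ->
  H `<=` spn gs -> finite_set [set x | H x /\ flat_root x].
Proof.
move=> gs0 gH Hgs.
have [[q qK]|char0] := pselect (exists q, q \in [pchar K]).
  apply: sub_finite_set (torsion_finite gs0 gH Hgs) => x [Hx fx]; split=> //.
  apply: (integral_torsion qK); [exact: mulgroup_neq0 Hx|exact: flat_root_integral].
have [iota _] : exists f : {rmorphism rat -> K}, True.
  by apply: rat_embedding => q; apply/negbTE/negP => qK; apply: char0; exists q.
have [z z_alg zP] := algebraic_part_in_adjoin iota gs0 gH Hgs.
apply: sub_finite_set (flat_roots_in_adjoin_finite R z_alg) => x [Hx fx].
by split=> //; apply: zP => //; apply/integral_algebraic/flat_root_integral.
Qed.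

Definition additive_on H (chi : K -> R) : Prop :=
  forall x y, H x -> H y -> chi (x * y) = chi x + chi y.

Lemma additive_on1 H chi : mulgroup H -> additive_on H chi -> chi 1 = 0.
Proof.
by move=> /mulgroup1 H1 /(_ 1 1 H1 H1); rewrite mulr1 => /eqP; rewrite -subr_eq subrr eq_sym => /eqP.
Qed.

Lemma additive_onV H chi x : mulgroup H -> additive_on H chi -> H x -> chi x^-1 = - chi x.
Proof.
move=> gH aH Hx; have Hx' := mulgroupV gH Hx; apply/eqP; rewrite -addr_eq0 -aH//.
by rewrite mulVf ?(mulgroup_neq0 gH Hx)// (additive_on1 gH aH).
Qed.

Lemma additive_onX H chi x (k : int) : mulgroup H -> additive_on H chi -> H x ->
  chi (x ^ k) = k%:~R * chi x.
Proof.
move=> gH aH Hx.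
have X n : chi (x ^+ n) = n%:R * chi x.
  elim: n => [|n IH]; first by rewrite expr0 mul0r (additive_on1 gH aH).
  by rewrite exprS aH//; [rewrite IH mulrSr mulrDl mul1r addrC|exact: mulgroupXn].
case: k => n; first by rewrite -exprnP X.
by rewrite NegzE -exprnN (additive_onV gH aH (mulgroupXn gH _ Hx)) X mulrNz mulNr.
Qed.

Let adjoin g V : set K := [set x | exists k : int, exists2 v, V v & x = g ^ k * v].

Let adjoin_mulgroup g V : g != 0 -> mulgroup V -> mulgroup (adjoin g V).
Proof.
move=> g0 gV; split=> [|_ _ [k [v Vv ->]] [l [w Vw ->]]|_ [k [v Vv ->]]].
- by exists 0, 1; rewrite ?expr0z ?mulr1//; exact: mulgroup1.
- exists (k - l), (v / w); first by case: (gV) => _ + _; apply.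
  by rewrite expfzDr// -invr_expz invfM mulrACA.
- by rewrite mulf_neq0 ?expfz_neq0 ?(mulgroup_neq0 gV Vv).
Qed.

Let adjoin_sub g V : V `<=` adjoin g V.
Proof. by move=> v Vv; exists 0, v; rewrite ?expr0z ?mul1r. Qed.

(** The representation [x = g ^ k * v] is not unique, but the condition on the powers
   of [g] lying in [V] makes the value at [x] independent of the choice. *)
Let extend_by_value g V chi c : g != 0 -> mulgroup V -> additive_on V chi ->
  (forall k : int, V (g ^ k) -> chi (g ^ k) = k%:~R * c) ->
  exists2 psi, additive_on (adjoin g V) psi &
    (forall v, V v -> psi v = chi v) /\ psi g = c.
Proof.
move=> g0 gV aV gc.
pose rep x (u : int * K) := V u.2 /\ x = g ^ u.1 * u.2.
have /choice[f fP] : forall x, exists u, adjoin g V x -> rep x u.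
  move=> x; have [[k [v Vv xE]]|nx] := pselect (adjoin g V x).
    by exists (k, v).
  by exists (0, 0).
pose psi x := (f x).1%:~R * c + chi (f x).2.
have psiE k v : V v -> psi (g ^ k * v) = k%:~R * c + chi v.
  move=> Vv; have /fP : adjoin g V (g ^ k * v) by exists k, v.
  rewrite /psi; case: (f _) => l w [/= Vw E].
  have E' : g ^ (l - k) = v / w.
    apply/eqP; rewrite expfzDr// -invr_expz eqr_div ?expfz_neq0//.
      by rewrite -E mulrC.
    exact: mulgroup_neq0 Vw.
  have Vvw : V (v / w) by case: (gV) => _ + _; apply.
  have := gc (l - k); rewrite E' => /(_ Vvw).
  rewrite aV//; last exact: mulgroupV.
  rewrite (additive_onV gV aV Vw) rmorphB mulrBl.
  by move=> E''; apply/eqP; move/eqP: E''; rewrite subr_eq addrAC -subr_eq opprK addrC [chi v + _]addrC => /eqP->.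
exists psi; last split=> [v Vv|].
- move=> _ _ [k [v Vv ->]] [l [w Vw ->]].
  rewrite mulrACA -expfzDr// !psiE// ?aV// ?rmorphD; last exact: mulgroupM.
  by rewrite mulrDl addrACA.
- by have := psiE 0 v Vv; rewrite expr0z mul1r mul0r add0r.
- have := psiE 1 1 (mulgroup1 gV); rewrite expr1z mulr1 mul1r => ->.
  by rewrite (additive_on1 gV aV) addr0.
Qed.

(** [R] is divisible: a power of [g] in [V] prescribes the value at [g]. *)
Let extend_character g V chi : g != 0 -> mulgroup V -> additive_on V chi ->
  exists2 psi, additive_on (adjoin g V) psi & forall v, V v -> psi v = chi v.
Proof.
move=> g0 gV aV.
have [[k [k0 Vgk]]|nk] := pselect (exists k : int, k != 0 /\ V (g ^ k)).
  have [l Vgl|psi apsi [psiV _]] := @extend_by_value g V chi (chi (g ^ k) / k%:~R) g0 gV aV.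
    have k0' : k%:~R != 0 :> R by rewrite intr_eq0.
    have E : k%:~R * chi (g ^ l) = l%:~R * chi (g ^ k).
      by rewrite -!(additive_onX _ gV aV)// !exprz_exp mulrC.
    by apply: (mulfI k0'); rewrite E mulrCA [k%:~R * _]mulrC divfK.
  by exists psi.
have [k Vgk|psi apsi [psiV _]] := @extend_by_value g V chi 0 g0 gV aV; last by exists psi.
have -> : k = 0 by apply: contrapT => /eqP k0; apply: nk; exists k.
by rewrite expr0z mul0r (additive_on1 gV aV).
Qed.

Let extend_to_spn gs V chi : (forall g, g \in gs -> g != 0) -> mulgroup V -> additive_on V chi ->
  exists2 psi, additive_on [set x | exists v s, [/\ V v, spn gs s & x = v * s]] psi &
    forall v, V v -> psi v = chi v.
Proof.
elim: gs V chi => [|g gs IH] V chi gs0 gV aV.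
  exists chi => // _ _ [v [_ [Vv -> ->]]] [w [_ [Vw -> ->]]].
  by rewrite !mulr1 aV.
have g0 : g != 0 by apply: gs0; rewrite inE eqxx.
have [psi apsi psiV] := extend_character g0 gV aV.
have [h hgs||psi' apsi' psi'V] := IH _ _ _ _ apsi.
- by apply: gs0; rewrite inE hgs orbT.
- exact: adjoin_mulgroup.
- exists psi' => [|v Vv]; last by rewrite psi'V ?psiV//; exact: adjoin_sub.
  move=> _ _ [v [_ [Vv [k [s ss ->]] ->]]] [w [_ [Vw [l [s' ss' ->]] ->]]].
  by apply: apsi'; [exists (g ^ k * v), s|exists (g ^ l * w), s']; split=> //;
    rewrite ?mulrA ?[_ * g ^ _]mulrC//; [exists k, v|exists l, w].
Qed.

(** A valuation provides a character that separates elements of different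
   valuation when some element of [H] is not integral. Otherwise [H] lies in a
   number field and an archimedean absolute value does. *)
Lemma level_character H gs : (forall g, g \in gs -> g != 0) -> mulgroup H ->
  H `<=` spn gs -> (exists2 t, H t & ~ is_torsion t) ->
  exists chi, [/\ additive_on H chi, exists2 t, H t & chi t != 0 &
    forall V : seq (kstar K), (forall s, s \in V -> H (kval s)) ->
      pairwise (fun s s' => 1 <= `|chi (kval s) - chi (kval s')|) V -> dissociated V].
Proof.
move=> gs0 gH Hgs [t Ht t_inf].
have [Hint|/existsNP[s /not_implyP[Hs ns]]] :=
  pselect (forall s, H s -> integralOver (intr : int -> K) s).
  have [iota _] : exists f : {rmorphism rat -> K}, True.
    apply: rat_embedding => q; apply/negbTE/negP => qK; apply: t_inf.
    apply: (integral_torsion qK); [exact: mulgroup_neq0 Ht|exact: Hint].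
  have [z z_alg zP] := algebraic_part_in_adjoin iota gs0 gH Hgs.
  have [x Hx|n n0|chi [chiM chit chiV]] := archimedean_level (R := R) z_alg gH _ Ht (Hint _ Ht).
  - by apply: zP => //; apply/integral_algebraic/Hint.
  - by apply/eqP => tn; apply: t_inf; exists n.
  - by exists chi; split=> //; exists t.
have s0 := mulgroup_neq0 gH Hs.
have [B [vB nBs]] := exists_valuation_ring s0 ns.
have [rB totB] := vB.
pose U := [set x | [/\ H x, B x & B x^-1]].
have gU : mulgroup U.
  split=> [|x y [Hx Bx Bx'] [Hy By By']|x [Hx _ _]].
  - by split; rewrite ?invr1; [exact: mulgroup1|exact: (subring1 rB)|exact: (subring1 rB)].
  - split; first by case: (gH) => _ + _; apply.
      exact: (subringM rB).
    by rewrite invfM invrK; exact: (subringM rB).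
  - exact: mulgroup_neq0 Hx.
have Bs' : B s^-1 by have [] := totB _ s0.
have nU (k : int) : U (s ^ k) -> k = 0.
  have pos n : ~ B (s ^+ n.+1).
    move=> Bsn; apply: nBs; rewrite (_ : s = s ^+ n.+1 * s^-1 ^+ n).
      apply: (subringM rB) => //; exact: (subringX rB).
    by rewrite exprS exprVn mulfK ?expf_neq0.
  case: k => [[//|n]|n]; rewrite ?NegzE -?exprnP -?exprnN => -[_ b1 b2]; first by have := pos n.
  by rewrite invrK in b2; have := pos n.
have [k /nU->|psi apsi [psiU psis]] := @extend_by_value s U (fun=> 0) 1 s0 gU (fun x y _ _ => esym (addr0 0)).
  by rewrite mul0r.
have [chi achi chiU] := extend_to_spn gs0 (adjoin_mulgroup s0 gU) apsi.
have sub : H `<=` [set x | exists v s0, [/\ adjoin s U v, spn gs s0 & x = v * s0]].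
  move=> x /Hgs xs; exists 1, x; rewrite mul1r; split=> //.
  exact: (mulgroup1 (adjoin_mulgroup s0 gU)).
have achiH : additive_on H chi by move=> x y /sub Hx /sub Hy; exact: achi.
exists chi; split=> //.
  exists s => //; rewrite chiU ?psis ?oner_neq0//.
  by exists 1, 1; rewrite ?expr1z ?mulr1//; exact: mulgroup1.
move=> V VH sepV.
have uV : uniq V.
  apply: pairwise_uniq sepV => u; rewrite subrr normr0 ler10; exact/negbTE.
apply: (valuation_dissociated vB uV) => u v uU vV uv [B1 B2].
have Uuv : U (kval u / kval v).
  split=> //; last by rewrite invfM invrK mulrC.
  exact: (mulgroupM gH (VH _ uU) (mulgroupV gH (VH _ vV))).
have : 1 <= `|chi (kval u) - chi (kval v)|.
  by apply: (pairwise_in _ sepV) => // x y; rewrite distrC.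
rewrite -(additive_onV gH achiH (VH _ vV)) -achiH; [|exact: VH|exact: (mulgroupV gH (VH _ vV))].
rewrite chiU ?psiU//; last exact: adjoin_sub.
by rewrite normr0 ler10.
Qed.

End FinitelyGenerated.

(** * Coordinates on the group of linear parts *)

Section FreeRank.
Context {K : fieldType}.
Implicit Types (s t : kstar K) (A : set (kstar K)).

Lemma kstar_mulC s t : (s * t = t * s)%g.
Proof. by apply: val_inj; rewrite /= mulrC. Qed.

Lemma kval_expg s n : kval (s ^+ n)%g = kval s ^+ n.
Proof. by elim: n => [|n IH]; rewrite ?expg0 ?expgS ?expr0 ?exprS//= IH. Qed.

Lemma gen_group_sub (E : set (kstar K)) : E `<=` gen_group E.
Proof. exact: sub_smallest. Qed.

Lemma gen_group_min (E H : set (kstar K)) : H 1%g ->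
  (forall s t, H s -> H t -> H (s * t)%g) -> (forall s, H s -> H s^-1%g) ->
  E `<=` H -> gen_group E `<=` H.
Proof.
move=> H1 HM HV EH; apply: smallest_sub => //=; split.
  by rewrite inE.
by move=> x y; rewrite !inE => Hx Hy; exact/HM/HV.
Qed.

Lemma gen_group_closed (E : set (kstar K)) :
  [/\ gen_group E 1%g, forall s t, gen_group E s -> gen_group E t -> gen_group E (s * t)%g &
      forall s, gen_group E s -> gen_group E s^-1%g].
Proof.
split=> [H [[]]|s t Es Et H HE|s Es H HE]; first by rewrite inE.
  have [gH _] := HE; have := group_closedM gH; move=> /(_ s t); rewrite !inE; apply.
    exact: Es.
  exact: Et.
have [gH _] := HE; have := group_closedV gH; move=> /(_ s); rewrite !inE; apply.
exact: Es.
Qed.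

Lemma free_rank_coordinates A r : A 1%g ->
  (forall s t, A s -> A t -> A (s * t)%g) -> (forall s, A s -> A s^-1%g) ->
  is_free_rank A r -> exists v : kstar K -> 'rV[int]_r,
  [/\ forall s t, A s -> A t -> v (s * t)%g = v s + v t,
      forall s, A s -> v s = 0 -> is_torsion (kval s) &
      forall z, exists2 s, A s & v s = z].
Proof.
move=> A1 AM AV [psi [[_ psi_inj psi_surj] psiM]].
pose C s := setmul [set s] (torsion A).
have torM x y : torsion A x -> torsion A y -> torsion A (x * y)%g.
  move=> [Ax [n n0 xn]] [Ay [m m0 ym]]; split; first exact: AM.
  exists (n * m)%N; first by rewrite muln_gt0 n0.
  rewrite expgMn; last exact: kstar_mulC.
  by rewrite expgnA xn expg1n mulnC expgnA ym expg1n mulg1.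
have tor1 : torsion A 1%g by split=> //; exists 1%N.
have CM s t : setmul (C s) (C t) = C (s * t)%g.
  apply/seteqP; split=> [_ [_ [_ -> [x xT <-]] [_ [_ -> [y yT <-]] <-]]|_ [_ -> [x xT <-]]].
    exists (s * t)%g => //; exists (x * y)%g; first exact: torM.
    by rewrite !mulgA; congr (_ * _)%g; rewrite -!mulgA; congr (_ * _)%g; exact: kstar_mulC.
  exists (s * x)%g; first by exists s => //; exists x.
  exists (t * 1)%g; first by exists t => //; exists 1%g.
  by rewrite mulg1 -!mulgA; congr (_ * _)%g; exact: kstar_mulC.
have inC s : A s -> cosets A (torsion A) (C s) by exists s.
have psi1 : psi (C 1%g) = 0.
  by apply: (addrI (psi (C 1%g))); rewrite addr0 -psiM ?CM ?mulg1//; exact: inC.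
exists (fun s => psi (C s)); split=> [s t As At|s As s0|z].
- by rewrite -CM psiM//; exact: inC.
- have : C s = C 1%g by apply: psi_inj; rewrite ?inE ?psi1//; exact: inC.
  have Css : C s s by exists s => //; exists 1%g; rewrite ?mulg1.
  move=> CE; move: Css; rewrite CE => -[_ -> [x [_ [n n0 xn]]]]; rewrite mul1g => <-.
  by exists n => //; rewrite -kval_expg xn.
- by have [_ [s As <-] <-] := psi_surj z I; exists s.
Qed.

End FreeRank.

(** * Free semigroups of affine maps *)

Section FreeSemigroups.
Context {K : fieldType}.
Implicit Types (a : kstar K) (w : seq bool).

Let bits w : {poly int} := Poly (map (fun b : bool => b%:R) w).

Let coef_bits w i : (bits w)`_i = (nth false w i)%:R.
Proof.
rewrite coef_Poly; have [iw|wi] := ltnP i (size w); first by rewrite (nth_map false).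
by rewrite !nth_default// size_map.
Qed.

Lemma unity_flat_root (t : K) n : (0 < n)%N -> t ^+ n = 1 -> flat_root t.
Proof.
move=> n0 tn; exists ('X^n - 1); last first.
  by rewrite rmorphB/= map_polyXn rmorph1 rootE !hornerE tn subrr.
split=> [|i]; first by rewrite -lead_coef_eq0 lead_coefXnsubC ?oner_eq0.
rewrite coefB coefXn coef1; case: i => [|i]; first by rewrite (ltn_eqF n0).
by case: eqP; rewrite subr0 !inE eqxx ?orbT.
Qed.

Let word_valueE a b1 b2 w :
  word_value (Aff a b1) (Aff a b2) w = Aff (a ^+ size w)%g
    ((b1 - b2) * (map_poly intr (bits w)).[kval a] + b2 * \sum_(i < size w) kval a ^+ i).
Proof.
rewrite /word_value; elim: w => [|b w IH].
  by rewrite big_nil /= big_ord0 /bits/= map_poly0 horner0 !mulr0 addr0.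
have -> : bits (b :: w) = bits w * 'X + (b%:R)%:P by rewrite -cons_poly_def.
rewrite big_cons IH /=.
set S := \sum_(i < size w) _; set P := horner _ _.
rewrite big_ord_recl expr0 rmorphD rmorphM/= map_polyX map_polyC/= !hornerE expgS -/P.
have -> : \sum_(i < size w) kval a ^+ bump 0 i = kval a * S.
  by rewrite mulr_sumr; apply: eq_bigr => i _; rewrite -exprS.
have E : kval a * ((b1 - b2) * P + b2 * S) + (if b then b1 else b2) =
    (b1 - b2) * (P * kval a + b%:~R) + b2 * (1 + kval a * S).
  rewrite mulrDr [in RHS]mulrDr [b2 * (1 + _)]mulrDr mulr1 -!addrA mulrCA [P * _]mulrC.
  rewrite [kval a * (b2 * S)]mulrCA; congr (_ + _); rewrite addrC addrA; congr (_ + _).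
  by case: (b); rewrite ?mulr1 ?mulr0 ?add0r ?subrK.
case: b E => E; congr Aff; exact: E.
Qed.

(** Two words of different lengths differ in their linear parts. For words of the
   same length the difference of the translation parts is a multiple of a
   polynomial in [a] with coefficients in [{-1, 0, 1}]. *)
Lemma free_of_not_flat_root a (b1 b2 : K) : b1 != b2 -> ~ flat_root (kval a) ->
  free_semigroup (Aff a b1) (Aff a b2).
Proof.
move=> b12 na v w _ _ vw; rewrite !word_valueE => -[E1 E2]; apply: na.
have key m n : (m < n)%N -> (a ^+ m)%g = (a ^+ n)%g -> flat_root (kval a).
  move=> mn /(congr1 val); rewrite /= !kval_expg => amn.
  apply: (@unity_flat_root _ (n - m)); first by rewrite subn_gt0.
  apply: (mulfI (expf_neq0 m (kval_neq0 a))).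
  by rewrite -exprD subnKC ?(ltnW mn)// mulr1.
have [/key/(_ E1)//|/key/(_ (esym E1))//|svw] := ltngtP (size v) (size w).
move: E2; rewrite svw => /addIr/(mulfI _) E2.
exists (bits v - bits w); last first.
  by rewrite rmorphB rootE hornerD hornerN E2 ?subr_eq0// subrr.
split=> [|i]; last first.
  by rewrite coefB !coef_bits; do 2?case: nth; rewrite ?subrr ?subr0 ?sub0r !inE eqxx ?orbT.
rewrite subr_eq0; apply: contra_notN vw => /eqP E.
apply: (@eq_from_nth _ false) => // i _.
have := congr1 (fun q : {poly int} => q`_i) E; rewrite /= !coef_bits.
by do 2?case: nth.
Qed.

Lemma unipotent_not_free (g h : aff K) : lin g = 1%g -> lin h = 1%g ->
  ~ free_semigroup g h.
Proof.
case: g h => [a b] [c e] /= -> ->; move=> /(_ [:: true; false] [:: false; true]).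
rewrite /word_value !big_cons !big_nil !mulg1; apply=> //.
by congr Aff; rewrite /aff_fun/= !mul1r addrC.
Qed.

End FreeSemigroups.

(** * From probabilities of paths to the transfer operator *)

Section PathLaw.
Context {R : realType} d d' {Omega : measurableType d} {T : measurableType d'}
  {P : probability Omega R} {X : nat -> {RV P >-> T}} {ls : seq T} {p : T -> R}.
Hypotheses (pP : weights ls p) (ls_uniq : uniq ls)
  (ls_measurable : forall l, measurable [set l : T])
  (X_law : forall j l, l \in ls -> P (X j @^-1` [set l]) = (p l)%:E)
  (X_indep : independent_seq X).

Definition path_event S (step : S -> T -> S) (b : S -> bool) (js : seq nat) (x : S) : set Omega :=
  [set w | all (fun j => X j w \in ls) js /\ b (foldl step x [seq X j w | j <- js])].

Let cylinder (J : {fset nat}) (g : nat -> T) : set Omega :=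
  \bigcap_(j in [set` J]) (X j @^-1` [set g j]).

Let cylinder_law J g : (forall j, j \in J -> g j \in ls) ->
  measurable (cylinder J g) /\ P (cylinder J g) = (\prod_(j <- J) p (g j))%:E.
Proof.
move=> gls; split.
  apply: fin_bigcap_measurable => // j _; rewrite -[X in measurable X]setTI.
  by apply: measurable_funP => //; exact: measurable_set1.
rewrite /cylinder (X_indep J (fun j => ls_measurable (g j))) -prodEFin !big_seq.
by apply: eq_bigr => j jJ; rewrite X_law// gls.
Qed.

Let cylinder_path S (step : S -> T -> S) b js x J g : uniq js ->
  (forall j, j \in js -> j \notin J) -> (forall j, j \in J -> g j \in ls) ->
  measurable (cylinder J g `&` path_event step b js x) /\
  P (cylinder J g `&` path_event step b js x) =
    ((\prod_(j <- J) p (g j)) * iter (size js) (transfer ls p step) (fun x => (b x)%:R) x)%:E.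
Proof.
elim: js x J g => [|j js IH] x J g /=.
  move=> _ _ /cylinder_law[mC PC]; case bx : (b x).
    rewrite (_ : path_event _ _ _ _ = setT) ?setIT ?mulr1//.
    by apply/seteqP; split=> // w _; rewrite /path_event/= bx.
  have -> : path_event step b [::] x = set0.
    by apply/seteqP; split=> // w [_]; rewrite /= bx.
  by rewrite setI0 mulr0 measure0.
move=> /andP[jjs ujs] jsJ gls.
pose h l i := if i == j then l else g i.
pose F l := cylinder (j |` J)%fset (h l) `&` path_event step b js (step x l).
have jJ : j \notin J by apply: jsJ; rewrite inE eqxx.
have HF l : l \in ls -> measurable (F l) /\ P (F l) =
    ((p l * \prod_(j <- J) p (g j)) * iter (size js) (transfer ls p step)
      (fun x => (b x)%:R) (step x l))%:E.
  move=> lls; have [//|i ijs|i|mF PF] := IH (step x l) (j |` J)%fset (h l).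
  - by rewrite !inE negb_or jsJ ?inE ?ijs ?orbT// andbT; apply: contraNneq jjs => <-.
  - by rewrite !inE /h; case: eqP => //= _; exact: gls.
  - split=> //; rewrite PF big_fsetU1//= {1}/h eqxx; congr ((_ * _ * _)%:E).
    rewrite !big_seq; apply: eq_bigr => i iJ; rewrite /h; case: eqP => // ij.
    by rewrite -ij iJ in jJ.
have -> : cylinder J g `&` path_event step b (j :: js) x = \bigcup_(l in [set` ls]) F l.
  apply/seteqP; split=> w.
    move=> [Cw [/= /andP[Xls als] bw]]; exists (X j w) => //; split; last by [].
    move=> i /=; rewrite !inE /h => /predU1P[->|iJ]; first by rewrite eqxx.
    by case: eqP => [->//|_]; exact: Cw.
  move=> [l /= lls [Cw [als bw]]].
  have Xj : X j w = l by have := Cw j; rewrite /= !inE eqxx /h eqxx; apply.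
  split; last by split; rewrite /= Xj ?lls.
  move=> i /= iJ; have := Cw i; rewrite /= !inE iJ orbT /h => /(_ isT).
  by case: eqP => // ij; rewrite -ij iJ in jJ.
have mF l : [set` ls] l -> measurable (F l) by move=> /HF[].
split; first by apply: fin_bigcup_measurable => //; exact: finite_seq.
rewrite measure_fin_bigcup//=; last first.
  apply/trivIsetP => l l' _ _ ll'; apply/seteqP; split=> // w [[+ _] [+ _]].
  move=> /(_ j) + /(_ j); rewrite /= !inE eqxx /h eqxx => /(_ isT) -> /(_ isT) E.
  by rewrite E eqxx in ll'.
rewrite -fsbig_seq// [RHS](_ : _ = \sum_(l <- ls) ((p l * \prod_(j <- J) p (g j)) *
    iter (size js) (transfer ls p step) (fun x => (b x)%:R) (step x l))%:E)%E; last first.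
  rewrite sumEFin; congr EFin; rewrite {1}/transfer /avg mulr_sumr; apply: eq_bigr => l _.
  by rewrite mulrCA mulrA.
by rewrite [LHS]big_seq [RHS]big_seq; apply: eq_bigr => l /HF[].
Qed.

(** The letters read along distinct times are independent, so that any functional
   computed letter by letter has the law given by the transfer operator. *)
Lemma path_event_law S (step : S -> T -> S) b js x : uniq js ->
  measurable (path_event step b js x) /\
  P (path_event step b js x) =
    (iter (size js) (transfer ls p step) (fun x => (b x)%:R) x)%:E.
Proof.
move=> ujs.
have C0 : cylinder fset0 (fun=> point) = setT by apply/seteqP; split=> // w _ j; rewrite /= inE.
have := @cylinder_path S step b js x fset0 (fun=> point) ujs.
by rewrite C0 setTI big_seq_fset0 mul1r; apply=> j; rewrite inE.
Qed.

Lemma ae_letters : {ae P, forall w, forall j, X j w \in ls}.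
Proof.
apply/ae_foralln => j; pose F := path_event (fun _ _ => tt) (fun=> true) [:: j] tt.
have [//|mF PF] := @path_event_law unit (fun _ _ => tt) (fun=> true) [:: j] tt.
rewrite (iter_transfer_cst pP) in PF.
exists (~` F); split; [exact: measurableC| |].
  by have := probability_setC P mF; rewrite PF subee.
by move=> w /= nj [/andP[Xj _] _]; exact: nj.
Qed.

(** Borel-Cantelli. The [n] times read for the [n]-th event are arbitrary, so that the
   letters may be read from the newest to the oldest. *)
Lemma path_events_eventually_false S (step : S -> T -> S) (b : S -> bool) (js : nat -> seq nat) x C :
  (forall n, uniq (js n)) -> (forall n, size (js n) = n) ->
  (forall N, \sum_(n < N) iter n (transfer ls p step) (fun x => (b x)%:R) x <= C) ->
  {ae P, forall w, exists n0, forall n, (n0 <= n)%N ->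
    ~~ b (foldl step x [seq X j w | j <- js n])}.
Proof.
move=> ujs sjs sumC; pose F n := path_event step b (js n) x.
have mF n : measurable (F n) by have [] := path_event_law step b x (ujs n).
have PF n : P (F n) = (iter n (transfer ls p step) (fun x => (b x)%:R) x)%:E.
  by have [_] := path_event_law step b x (ujs n); rewrite sjs.
have F0 : P (lim_sup_set F) = 0%E.
  apply: lim_sup_set_cvg0 => //; apply: (@le_lt_trans _ _ C%:E); last exact: ltry.
  apply: lime_le; first by apply: is_cvg_nneseries => n _ _; exact: measure_ge0.
  apply: nearW => N; rewrite big_mkord (eq_bigr _ (fun (n : 'I_N) _ => PF n)).
  by rewrite sumEFin lee_fin; exact: sumC.
have nF : {ae P, forall w, ~ lim_sup_set F w}.
  exists (lim_sup_set F); split=> // [|w /= /contrapT//].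
  by apply: bigcapT_measurable => n; apply: bigcup_measurable => k _; exact: mF.
apply: filterS2 ae_letters nF => w Xw nw.
have [n0 nn0] : exists n0, ~ (\bigcup_(j >= n0) F j) w.
  by apply: contrapT => nex; apply: nw => n _; apply: contrapT => nFn; apply: nex; exists n.
exists n0 => n n0n; apply/negP => bn; apply: nn0; exists n => //; split=> //.
by apply/allP => j _; exact: Xw.
Qed.

End PathLaw.

(** * Atoms of a finitely supported measure *)

Section Atoms.
Context {R : realType} d {T : measurableType d} (mu : probability T R).
Hypothesis set1_measurable : forall x, measurable [set x : T].

Lemma seq_measurable (s : seq T) : measurable [set` s].
Proof.
rewrite -(image_id [set` s]) -bigcup_imset1.
apply: fin_bigcup_measurable => [|x _]; [exact: finite_seq|exact: set1_measurable].
Qed.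

Let measure_seq (s : seq T) : uniq s -> mu [set` s] = (\sum_(x <- s) mu [set x])%E.
Proof.
move=> us; rewrite -{1}(image_id [set` s]) -bigcup_imset1 measure_fin_bigcup//; last 2 first.
- exact: finite_seq.
- by apply/trivIsetP => x y _ _ /eqP xy; apply/seteqP; split=> // _ [-> /xy].
by rewrite -fsbig_seq.
Qed.

Definition atom (x : T) : R := fine (mu [set x]).

Lemma atomE x : mu [set x] = (atom x)%:E.
Proof. by rewrite fineK// fin_num_measure. Qed.

Lemma atoms_enumeration : finitely_supported mu ->
  exists ls : seq T, [/\ uniq ls, forall x, x \in ls <-> supp mu x & mu [set` ls] = 1%E].
Proof.
move=> [F /finite_seqP[s0 ->] muF]; pose s := undup s0.
pose ls := [seq x <- s | (0 < mu [set x])%E].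
have uls : uniq ls by rewrite filter_uniq ?undup_uniq.
have mls : mu [set` ls] = 1%E.
  have mus : mu [set` s] = 1%E.
    have := probability_setC mu (seq_measurable s0); rewrite muF => /esym/eqP.
    rewrite sube_eq ?fin_num_measure// ?fin_num_adde_defl// add0e => /eqP E.
    by rewrite E; congr (mu _); apply/seteqP; split=> x /=; rewrite mem_undup.
  rewrite -mus !measure_seq ?undup_uniq// big_filter big_mkcond; apply: eq_bigr => x _.
  by case: ifPn => //; rewrite -leNgt measure_le0 => /eqP.
exists ls; split=> // x; split; first by rewrite mem_filter => /andP[].
rewrite /supp /= => x0; apply: contrapT => /negP xls.
have ls_meas := seq_measurable ls.
have : (mu [set x] <= mu (~` [set` ls]))%E.
  apply: le_measure; rewrite ?inE//; first exact: measurableC.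
  by move=> _ ->; exact/negP.
by rewrite probability_setC// mls subee// leNgt x0.
Qed.

Variable ls : seq T.
Hypotheses (ls_uniq : uniq ls) (ls_full : mu [set` ls] = 1%E).

Let ls_measurable : measurable [set` ls]. Proof. exact: seq_measurable. Qed.

Let outside0 : mu (~` [set` ls]) = 0%E.
Proof. by rewrite probability_setC// ls_full subee. Qed.

Lemma measure_atoms B : measurable B -> mu B = (\sum_(x <- ls) (atom x * (x \in B)%:R)%:E)%E.
Proof.
move=> mB; have lsB_meas := seq_measurable [seq x <- ls | x \in B].
have -> : mu B = mu [set` [seq x <- ls | x \in B]].
  apply/eqP; rewrite eq_le; apply/andP; split; last first.
    by rewrite le_measure ?inE// => x /=; rewrite mem_filter => /andP[/set_mem].
  apply: (@le_trans _ _ (mu ([set` [seq x <- ls | x \in B]] `|` ~` [set` ls]))).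
    rewrite le_measure ?inE//; first by apply: measurableU => //; exact: measurableC.
    move=> x Bx; have [xls|/negP xls] := boolP (x \in ls); [left|by right].
    by rewrite /= mem_filter xls andbT; exact: mem_set.
  have mC : measurable (~` [set` ls]) by exact: measurableC.
  apply: (le_trans (measureU2 _ (seq_measurable _) mC)).
  by have /= -> := outside0; rewrite adde0.
rewrite measure_seq ?filter_uniq// big_filter big_mkcond; apply: eq_bigr => x _.
by rewrite atomE; case: ifP; rewrite ?mulr1 ?mulr0.
Qed.

Lemma atom_weights : weights ls atom.
Proof.
split=> [x|]; first by rewrite fine_ge0.
apply: EFin_inj; rewrite -sumEFin -[RHS]ls_full measure_seq//.
by apply: eq_bigr => x _; rewrite -atomE.
Qed.

Lemma integral_atoms A (f : T -> R) : measurable A -> [set` ls] `<=` A ->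
  measurable_fun [set: T] f ->
  (\int[mu]_(x in A) (f x)%:E = (\sum_(x <- ls) atom x * f x)%:E)%E.
Proof.
move=> mA lsA mf.
have mfE (D : set T) : measurable_fun D (fun x => (f x)%:E).
  by apply/measurable_EFinP; apply: measurable_funS mf.
rewrite -(setDUK lsA) integral_setU//=; last 2 first.
- exact: measurableD.
- by apply/disj_setPS => x [xls [_ /=]].
rewrite (ae_eq_integral (cst 0%E) (D := A `\` _)) ?integral0 ?adde0//; last 2 first.
- exact: measurableD.
- exists (~` [set` ls]); split=> // [|x /= /not_implyP[[] //]].
  exact: measurableC.
have -> : [set` ls] = \big[setU/set0]_(x <- ls) [set x].
  by rewrite -bigcup_seq bigcup_imset1 image_id.
rewrite integral_bigsetU_EFin//; last first.
  by apply/trivIsetP => x y _ _ /eqP xy; apply/seteqP; split=> // _ [-> /xy].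
rewrite -sumEFin; apply: eq_bigr => x _.
rewrite (eq_integral (cst (f x)%:E)) => [|y]; last by rewrite inE => ->.
by rewrite integral_cst//; have /= -> := atomE x; rewrite -EFinM mulrC.
Qed.

End Atoms.

Section Letters.
Context {R : realType} {K : fieldType} (eta : probability (aff K * aff K)%type R).

Lemma aff2_set1_measurable (g : aff K * aff K) : measurable [set g].
Proof.
rewrite (_ : [set g] = [set g.1] `*` [set g.2]).
  exact: measurableX.
by apply/seteqP; split=> [_ ->//|[g1 g2] [/= -> ->]]; case: g.
Qed.

Variable ls : seq (aff K * aff K).
Hypotheses (ls_uniq : uniq ls) (ls_supp : forall g, g \in ls <-> supp eta g)
  (ls_full : eta [set` ls] = 1%E).
Local Notation p := (atom eta).

Lemma atom_gt0 : {in ls, forall g, 0 < p g}.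
Proof.
move=> g /ls_supp; rewrite /supp /= => g0; rewrite /atom fine_gt0// g0.
by rewrite ltey_eq fin_num_measure//; exact: aff2_set1_measurable.
Qed.

Let lin_lawE B : lin_law eta B = (\sum_(g <- ls) (p g * (lin2 g \in B)%:R)%:E)%E.
Proof.
have mB : measurable (@lin2 K @^-1` B).
  by rewrite -[X in measurable X]setTI; exact: measurable_lin2.
rewrite [LHS](measure_atoms aff2_set1_measurable ls_uniq ls_full mB).
by apply: eq_bigr => g _; congr (_ * _%:R)%:E; congr nat_of_bool; apply/idP/idP; rewrite !inE.
Qed.

Lemma lin_law_supp : supp (lin_law eta) = [set` map (@lin2 K) ls].
Proof.
apply/seteqP; split=> t; rewrite /supp /= lin_lawE sumEFin lte_fin.
  apply: contraPP => /negP tls; rewrite big1_seq ?ltxx// => g /= gls.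
  rewrite (memNset (A := [set t])) ?mulr0// => gt; move: tls.
  by rewrite -gt map_f.
move=> /mapP[g gls ->]; rewrite (big_rem g)//= mem_set// mulr1.
rewrite ltr_pwDl ?atom_gt0// sumr_ge0// => h _.
by rewrite mulr_ge0// (atom_weights aff2_set1_measurable ls_uniq ls_full).1.
Qed.

Lemma lin_law_integral (f : kstar K -> R) (A : set (kstar K)) :
  [set` map (@lin2 K) ls] `<=` A ->
  (\int[lin_law eta]_(t in A) (f t)%:E = (avg ls p (fun g => f (lin2 g)))%:E)%E.
Proof.
move=> lsA; pose s := undup (map (@lin2 K) ls).
rewrite (@integral_atoms _ _ _ (lin_law eta) _ s) ?undup_uniq//; first last.
- by move=> t; rewrite /= mem_undup => /lsA.
- rewrite lin_lawE sumEFin; congr EFin; rewrite -[RHS](atom_weights aff2_set1_measurable ls_uniq ls_full).2.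
  rewrite !big_seq; apply: eq_bigr => g gls.
  have gs : lin2 g \in s by rewrite mem_undup map_f.
  by rewrite (@mem_set _ [set` s])// mulr1.
congr EFin; transitivity (\sum_(t <- s) \sum_(g <- ls) p g * (lin2 g == t)%:R * f t).
  apply: eq_bigr => t _; rewrite -mulr_suml; congr (_ * _).
  rewrite /atom lin_lawE sumEFin; apply: eq_bigr => g _; congr (_ * _%:R).
  by congr nat_of_bool; apply/idP/idP; rewrite in_setE => /eqP.
rewrite exchange_big /avg !big_seq; apply: eq_bigr => g gls.
have gs : lin2 g \in s by rewrite mem_undup map_f.
rewrite (bigD1_seq _ gs) ?undup_uniq//= eqxx mulr1 big1 ?addr0// => t tg.
by rewrite eq_sym (negPf tg) mulr0 mul0r.
Qed.

End Letters.

(** * The random walk *)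

Lemma sum_half_le (R : realType) N :
  \sum_(n < N) ((n./2).+1%:R * (n./2).+2%:R)^-1 <= 2 :> R.
Proof.
have f0 n : 0 <= ((n./2).+1%:R * (n./2).+2%:R)^-1 :> R by rewrite invr_ge0.
have E M : \sum_(0 <= n < M.*2) ((n./2).+1%:R * (n./2).+2%:R)^-1 = 2 - 2 / M.+1%:R :> R.
  elim: M => [|M IH]; first by rewrite big_geq// divr1 subrr.
  rewrite doubleS !big_nat_recr//= IH uphalf_double doubleK.
  have M1 : M.+1%:R != 0 :> R by [].
  have M2 : M.+2%:R != 0 :> R by [].
  have -> : (M.+1%:R * M.+2%:R)^-1 = M.+1%:R^-1 - M.+2%:R^-1 :> R.
    apply: (mulIf (mulf_neq0 M1 M2)); rewrite mulVf ?mulf_neq0// mulrBl mulKf//.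
    by rewrite mulrCA mulVf// mulr1 -natrB// subSnn.
  by move: (M.+1%:R^-1 : R) (M.+2%:R^-1 : R) => u1 u2; lra.
rewrite -(big_mkord xpredT (fun n => ((n./2).+1%:R * (n./2).+2%:R)^-1)).
apply: (@le_trans _ _ (2 - 2 / N.+1%:R)); last by rewrite gerBl divr_ge0.
rewrite -E (@big_cat_nat _ _ _ N 0 N.*2)//=; last by rewrite -addnn leq_addr.
by rewrite lerDl sumr_ge0.
Qed.

Section RandomWalkOnPairs.
Context {R : realType} {K : fieldType} (eta : probability (aff K * aff K)%type R).
Context d (Omega : measurableType d) (P : probability Omega R)
  (X : nat -> {RV P >-> (aff K * aff K)%type}).
Variable ls : seq (aff K * aff K).
Hypotheses (ls_uniq : uniq ls) (ls_supp : forall g, g \in ls <-> supp eta g)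
  (ls_full : eta [set` ls] = 1%E)
  (eta_lin : forall g, supp eta g -> lin g.1 = lin g.2)
  (X_indep : independent_seq X)
  (X_law : forall (n : nat) (B : set (aff K * aff K)), measurable B ->
      distribution P (X n) B = eta B).
Local Notation p := (atom eta).
Local Notation a := (@lin2 K).
Local Notation A := (lin_group eta).

Definition offset (g : aff K * aff K) : K := trans g.1 - trans g.2.

Let pP : weights ls p := atom_weights aff2_set1_measurable ls_uniq ls_full.

Let X_atoms j l : l \in ls -> P (X j @^-1` [set l]) = (p l)%:E.
Proof.
move=> _; rewrite -(atomE _ aff2_set1_measurable).
by rewrite -(X_law j (aff2_set1_measurable l)).
Qed.

Let iota_last n : iota 0 n.+1 = rcons (iota 0 n) n.
Proof. by rewrite -addn1 iotaD cats1. Qed.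

Let walk_lin n w : (forall j, X j w \in ls) ->
  lin (walk X n w).1 = foldl (group_step a) 1%g [seq X j w | j <- iota 0 n] /\
  lin (walk X n w).2 = lin (walk X n w).1.
Proof.
move=> Xw; elim: n => // n [IH IH2]; rewrite iota_last map_rcons foldl_rcons -IH /=.
rewrite /group_step kstar_mulC; split=> //.
by rewrite IH2 kstar_mulC (eta_lin (proj1 (ls_supp _) (Xw n))).
Qed.

(** Read from the newest letter to the oldest, the state [(t, c)] of [affine_step]
   accumulates the offset of the walk. *)
Let walk_offset n w t c : (forall j, X j w \in ls) ->
  (foldl (affine_step a offset) (t, c) [seq X j w | j <- rev (iota 0 n)]).2 =
  c - kval t * offset (walk X n w).
Proof.
move=> Xw; elim: n t c => [|n IH] t c.
  by rewrite /= /offset/= subrr mulr0 subr0.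
rewrite iota_last rev_rcons /= [affine_step _ _ _ _]surjective_pairing IH /=.
rewrite /offset /= /aff_fun -(eta_lin (proj1 (ls_supp _) (Xw n))) /lin2.
rewrite -addrA -opprD; congr (_ - _); rewrite -mulrA -mulrDr; congr (_ * _).
by rewrite opprD addrACA mulrBr addrC.
Qed.

Lemma lin_group_gen (H : set (kstar K)) : H 1%g -> (forall s t, H s -> H t -> H (s * t)%g) ->
  (forall s, H s -> H s^-1%g) -> {in ls, forall g, H (a g)} -> A `<=` H.
Proof.
move=> H1 HM HV Hls; apply: gen_group_min => //.
by rewrite (lin_law_supp ls_uniq ls_supp ls_full) => _ /mapP[g gls ->]; exact: Hls.
Qed.

Lemma letter_in_group : {in ls, forall g, A (a g)}.
Proof.
move=> g gls; apply: gen_group_sub.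
by rewrite (lin_law_supp ls_uniq ls_supp ls_full); exact: map_f.
Qed.

Let H := @kval K @` A.

Let H_mulgroup : mulgroup H.
Proof.
have [A1 AM AV] := gen_group_closed (supp (lin_law eta)).
split=> [|_ _ [s As <-] [t At <-]|_ [s _ <-]]; last exact: kval_neq0.
  by exists 1%g.
by exists (s * t^-1)%g => //; apply: AM => //; exact: AV.
Qed.

Let H_spn : exists2 gs, (forall x, x \in gs -> x != 0) & H `<=` spn gs.
Proof.
pose gs := map (fun g => kval (a g)) ls.
have gs0 x : x \in gs -> x != 0 by move=> /mapP[g _ ->]; exact: kval_neq0.
have sG := spn_mulgroup gs0.
exists gs => // _ [s As <-]; move: s As.
apply: (@lin_group_gen (fun s => spn gs (kval s))) => [|s t ss st|s ss|g gls].
- exact: (mulgroup1 sG).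
- exact: (mulgroupM sG ss st).
- exact: (mulgroupV sG ss).
- by apply: mem_spn => //; exact: (map_f (fun g => kval (a g))) gls.
Qed.

Let group_fiber_finite (Q : set K) : finite_set [set x | H x /\ Q x] ->
  finite_set [set s : kstar K | A s /\ Q (kval s)].
Proof.
move=> /(finite_image (insubd (1%g : kstar K))); apply: sub_finite_set => s [As Qs].
by exists (kval s); [split=> //; exists s|exact: valKd].
Qed.

Lemma torsion_group_finite : finite_set [set s : kstar K | A s /\ is_torsion (kval s)].
Proof.
have [gs gs0 Hgs] := H_spn.
exact: group_fiber_finite (torsion_finite gs0 H_mulgroup Hgs).
Qed.

Let flat_roots_seq : exists fs : seq (kstar K),
  forall s, A s -> flat_root (kval s) -> s \in fs.
Proof.
have [gs gs0 Hgs] := H_spn.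
have /finite_seqP[fs E] := group_fiber_finite (flat_roots_finite (R := R) gs0 H_mulgroup Hgs).
exists fs => s As fls; have : [set s : kstar K | A s /\ flat_root (kval s)] s by [].
by rewrite E.
Qed.

Let delayed_path N n w : foldl (delayed_step a) (N, 1%g, true) [seq X j w | j <- iota 0 n] =
  ((N - n)%N, foldl (group_step a) 1%g [seq X j w | j <- iota 0 n],
    all (fun k => (k < N)%N || (foldl (group_step a) 1%g [seq X j w | j <- iota 0 k] != 1%g))
      (iota 0 n)).
Proof.
elim: n => [|n IH]; first by rewrite subn0.
rewrite iota_last map_rcons !foldl_rcons IH all_rcons /delayed_step/= subnS.
congr (_, _, _); case E : (N - n)%N => [|k].
  by rewrite andbC ltnNge -subn_eq0 E.
by rewrite -subn_gt0 E.
Qed.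

(** If the walk of the linear parts is recurrent, it returns to [1] infinitely
   often, and then both maps are translations. *)
Lemma recurrent_not_eventually_free :
  (forall x (e : R), A x -> 0 < e -> exists m, miss ls p a m x < e) ->
  ~ {ae P, forall w, exists n0, forall n, (n0 <= n)%N ->
       free_semigroup (walk X n w).1 (walk X n w).2}.
Proof.
move=> miss0 free.
have [A1 AM _] := gen_group_closed (supp (lin_law eta)).
pose E N m := path_event (X := X) (ls := ls) (delayed_step a) (@no_visit _)
  (iota 0 (N + m)) (N, 1%g, true).
have EP N m : measurable (E N m) /\ P (E N m) = (iter (size (iota 0 (N + m)))
    (transfer ls p (delayed_step a)) (fun x => (no_visit x)%:R) (N, 1%g, true))%:E.
  by apply: (path_event_law ls_uniq aff2_set1_measurable X_atoms X_indep); exact: iota_uniq.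
have never N : {ae P, forall w, ~ (\bigcap_m E N m) w}.
  have mE : measurable (\bigcap_m E N m).
    by apply: bigcapT_measurable => m; have [] := EP N m.
  exists (\bigcap_m E N m); split=> //; last by move=> w /= /contrapT.
  apply/eqP; rewrite eq_le measure_ge0 andbT; apply/lee_addgt0Pr => e e0; rewrite add0e.
  have [m me] := delayed_no_visit_small pP AM letter_in_group miss0 N A1 e0.
  apply: (@le_trans _ _ (P (E N m))).
    by apply: le_measure; rewrite ?inE//; [have [] := EP N m|exact: bigcap_inf].
  have [_ ->] := EP N m; rewrite size_iota delayed_no_visit_law// lee_fin; exact: ltW.
have bad : {ae P, forall w, False}.
  have := ae_letters pP ls_uniq aff2_set1_measurable X_atoms X_indep.
  move: free (ae_foralln never); apply: filterS3 => w [n0 freew] nE Xw.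
  apply: (nE n0) => m _; split; first by apply/allP => j _; exact: Xw.
  have t1 n : (n0 <= n)%N -> foldl (group_step a) 1%g [seq X j w | j <- iota 0 n] != 1%g.
    move=> n0n; apply/eqP => t1; have [E1 E2] := walk_lin n Xw; rewrite t1 in E1.
    by apply: unipotent_not_free (freew n n0n); rewrite ?E2.
  rewrite delayed_path /no_visit/= t1 ?leq_addr// andbT.
  by apply/allP => k _; have [//|n0k] := ltnP k n0; exact: t1.
have [Z [mZ PZ ZT]] := bad.
have : (P setT <= P Z)%E by apply: le_measure; rewrite ?inE// => w _; apply: ZT.
by rewrite probability_setT PZ lee_fin ler10.
Qed.

Hypothesis transient : exists C : R, forall s N, \sum_(n < N)
    iter n (transfer ls p (group_step a)) (fun x => (x == s)%:R) 1%g <= C.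

Let lin_walk_leaves (fs : seq (kstar K)) :
  {ae P, forall w, exists n0, forall n, (n0 <= n)%N -> lin (walk X n w).1 \notin fs}.
Proof.
elim: fs => [|s fs IH]; first by apply: nearW => w; exists 0%N.
have [C CP] := transient.
have := path_events_eventually_false pP ls_uniq aff2_set1_measurable X_atoms X_indep
  (b := fun x : kstar K => x == s) (js := iota 0) (iota_uniq 0) (size_iota 0) (CP s).
have := ae_letters pP ls_uniq aff2_set1_measurable X_atoms X_indep.
move: IH; apply: filterS3 => w [n1 n1P] Xw [n2 n2P]; exists (maxn n1 n2) => n.
rewrite geq_max => /andP[/n1P nfs /n2P ns]; rewrite inE negb_or nfs andbT.
by rewrite (walk_lin _ Xw).1.
Qed.

Hypothesis eta_roots : exists2 g, g \in ls & ~ is_torsion (kval (a g)).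
Hypothesis eta_diag : exists2 g, g \in ls & offset g != 0.

Let offset_walkS n w : (forall j, X j w \in ls) ->
  offset (walk X n.+1 w) = offset (X n w) + kval (a (X n w)) * offset (walk X n w).
Proof.
move=> Xw; rewrite /offset /= /aff_fun -(eta_lin (proj1 (ls_supp _) (Xw n))) /lin2.
by rewrite opprD addrACA mulrBr addrC.
Qed.

Let level : exists chi : kstar K -> R,
  [/\ forall s t, A s -> A t -> chi (s * t)%g = chi s + chi t,
      exists2 g, g \in ls & (0 < p g) && (chi (a g) != 0) &
      forall V, (forall s, s \in V -> A s) ->
        pairwise (fun s t => 1 <= `|chi s - chi t|) V -> dissociated V].
Proof.
have [gs gs0 Hgs] := H_spn; have [g gls gtor] := eta_roots.
have [|chi [chiM chi_neq0 chiV]] := @level_character R K H gs gs0 H_mulgroup Hgs.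
  by exists (kval (a g)) => //; exists (a g) => //; exact: letter_in_group.
have inH s : A s -> H (kval s) by exists s.
have chiM' s t : A s -> A t -> chi (kval (s * t)%g) = chi (kval s) + chi (kval t).
  by move=> /inH Hs /inH Ht; exact: chiM.
exists (chi \o @kval K); split=> //; last first.
  by move=> V VA; apply: chiV => s /VA; exact: inH.
apply: contrapT => nex; have [_ [s As <-]] := chi_neq0; apply/negP; rewrite negbK.
have [A1 AM AV] := gen_group_closed (supp (lin_law eta)).
have [] // : [set s | A s /\ chi (kval s) == 0] s; last first.
apply: lin_group_gen As => [|u t [Au /eqP u0] [At /eqP t0]|u [Au /eqP u0]|h hls]; split.
- exact: A1.
- by rewrite (additive_on1 H_mulgroup chiM).
- exact: AM.
- by rewrite chiM' ?u0 ?t0 ?addr0.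
- exact: AV.
- by rewrite (additive_onV H_mulgroup chiM (inH _ Au)) u0 oppr0.
- exact: letter_in_group.
- apply: contrapT => /negP h0; apply: nex; exists h => //=.
  by rewrite h0 andbT (atom_gt0 ls_supp).
Qed.

(** A letter [g] acts on offsets by the map [x |-> a g * x + offset g]. If these maps
   have a common fixed point [c], the offset of the walk is [(1 - t) * c] with [t]
   its linear part, which leaves 1 for good. Otherwise two of them do not commute. *)
Let offset_walk_leaves0 :
  {ae P, forall w, exists n0, forall n, (n0 <= n)%N -> offset (walk X n w) != 0}.
Proof.
have [[c cP]|nc] := pselect (exists c, {in ls, forall g, offset g = (1 - kval (a g)) * c}).
  have c0 : c != 0.
    by have [g gls] := eta_diag; rewrite cP//; apply: contraNneq => ->; rewrite mulr0.
  have := ae_letters pP ls_uniq aff2_set1_measurable X_atoms X_indep.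
  move: (lin_walk_leaves [:: 1%g]); apply: filterS2 => w [n0 n0P] Xw; exists n0 => n /n0P.
  have -> : offset (walk X n w) = (1 - kval (lin (walk X n w).1)) * c.
    elim: n => [|n IH]; first by rewrite /offset /= !subrr mul0r.
    rewrite offset_walkS// IH cP// mulrA -mulrDl; congr (_ * _) => /=.
    by rewrite mulrBr mulr1 addrA subrK.
  rewrite inE => t1; rewrite mulf_neq0// subr_eq0 eq_sym; apply: contraNneq t1 => t1.
  exact/eqP/val_inj.
have [g gls gtor] := eta_roots; have [chi [chiM chi_neq0 chiV]] := level.
have a1 : 1 - kval (a g) != 0.
  by rewrite subr_eq0 eq_sym; apply: contra_notN gtor => /eqP ag; exists 1%N.
have [s [sls sg]] : exists s, s \in ls /\
    offset g + kval (a g) * offset s != offset s + kval (a s) * offset g.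
  apply: contrapT => nex; apply: nc; exists (offset g / (1 - kval (a g))) => s sls.
  apply: (mulIf a1); rewrite -mulrA divfK//.
  have /eqP : offset g + kval (a g) * offset s == offset s + kval (a s) * offset g.
    by apply: contrapT => /negP ne; apply: nex; exists s.
  move=> E; rewrite [LHS]mulrBr mulr1 [RHS]mulrBl mul1r; apply/eqP.
  by rewrite subr_eq addrAC eq_sym subr_eq [offset s * _]mulrC E.
have [A1 AM _] := gen_group_closed (supp (lin_law eta)).
have p0 h : h \in ls -> 0 < p h by exact: (atom_gt0 ls_supp).
have [C CP] := affine_return_summable pP A1 AM chiM letter_in_group chiV chi_neq0 gls sls
  (p0 _ gls) (p0 _ sls) sg.
have C0 : 0 <= C.
  have C1 : 1 <= C / 2 by have := CP 0%N 0; rewrite /affine_hit /= eqxx mul1r.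
  by lra.
have : {ae P, forall w, exists n0, forall n, (n0 <= n)%N ->
    (foldl (affine_step a offset) (1%g, 0) [seq X j w | j <- rev (iota 0 n)]).2 != 0}.
  apply: (path_events_eventually_false pP ls_uniq aff2_set1_measurable X_atoms X_indep
    (b := fun x => x.2 == 0) (js := rev \o iota 0) (C := C * 2)) => [n|n|N].
  - by rewrite /= rev_uniq iota_uniq.
  - by rewrite /= size_rev size_iota.
  - apply: le_trans (ler_wpM2l C0 (sum_half_le R N)); rewrite mulr_sumr.
    by apply: ler_sum => n _; exact: CP.
have := ae_letters pP ls_uniq aff2_set1_measurable X_atoms X_indep.
apply: filterS2 => w Xw [n0 n0P]; exists n0 => n /n0P.
by rewrite /= walk_offset// mul1r sub0r oppr_eq0.
Qed.

(** The linear part leaves the finitely many flat roots of the group, and the two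
   translation parts become and stay distinct. *)
Lemma transient_eventually_free :
  {ae P, forall w, exists n0, forall n, (n0 <= n)%N ->
     free_semigroup (walk X n w).1 (walk X n w).2}.
Proof.
have [fs fsP] := flat_roots_seq.
have := ae_letters pP ls_uniq aff2_set1_measurable X_atoms X_indep.
move: (lin_walk_leaves fs) offset_walk_leaves0; apply: filterS3 => w [n1 n1P] [n2 n2P] Xw.
exists (maxn n1 n2) => n; rewrite geq_max => /andP[/n1P nfs /n2P].
have [E1 E2] := walk_lin n Xw; move: E1 E2 nfs; rewrite /offset.
case: (walk X n w) => [[t1 b1] [t2 b2]] /= E1 -> t1fs; rewrite subr_eq0 => b12.
apply: free_of_not_flat_root => // ft; move: t1fs; rewrite fsP//.
have [A1 AM _] := gen_group_closed (supp (lin_law eta)).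
rewrite E1; elim: {E1} n => [//|n IH]; rewrite iota_last map_rcons foldl_rcons.
by apply: AM => //; exact: letter_in_group.
Qed.

End RandomWalkOnPairs.

Theorem corollary1p3 (R : realType) (K : fieldType)
    (eta : probability (aff K * aff K)%type R)
    (d : measure_display) (Omega : measurableType d) (P : probability Omega R)
    (X : nat -> {RV P >-> (aff K * aff K)%type}) (r : nat)
    (eta_fin : finitely_supported eta)
    (eta_lin : forall g, supp eta g -> lin g.1 = lin g.2)
    (eta_roots : (eta [set g | roots_of_unity (lin2 g)] < 1)%E)
    (eta_diag : ~ (supp eta `<=` range (fun g : aff K => (g, g))))
    (X_indep : independent_seq X)
    (X_law : forall (n : nat) (B : set (aff K * aff K)), measurable B ->
      distribution P (X n) B = eta B)
    (rank_r : is_free_rank (lin_group eta) r) :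
  ((3 <= r)%N ->
    {ae P, forall w, exists n0 : nat, forall n : nat, (n0 <= n)%N ->
      free_semigroup (walk X n w).1 (walk X n w).2}) /\
  (r = 1%N \/ r = 2%N ->
    ({ae P, forall w, exists n0 : nat, forall n : nat, (n0 <= n)%N ->
       free_semigroup (walk X n w).1 (walk X n w).2} <->
     ~ centered eta)).
Proof.
have [ls [ls_uniq ls_supp ls_full]] := atoms_enumeration (@aff2_set1_measurable K) eta_fin.
pose p := atom eta; pose a := @lin2 K; pose A := lin_group eta.
have pP : weights ls p := atom_weights (@aff2_set1_measurable K) ls_uniq ls_full.
have p_gt0 := atom_gt0 ls_supp.
have [A1 AM AV] := gen_group_closed (supp (lin_law eta)).
have aA : {in ls, forall g, A (a g)} := letter_in_group ls_uniq ls_supp ls_full.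
have A_gen := lin_group_gen ls_uniq ls_supp ls_full.
have [v [vM v_torsion v_surj]] := free_rank_coordinates A1 AM AV rank_r.
have v_fin : finite_set [set s | A s /\ v s = 0].
  apply: sub_finite_set (torsion_group_finite ls_uniq ls_supp ls_full) => s [As vs].
  by split=> //; exact: v_torsion.
have roots : exists2 g, g \in ls & ~ is_torsion (kval (a g)).
  apply: contrapT => nex; move: eta_roots; rewrite ltNge => /negP; apply.
  rewrite -ls_full; apply: le_measure; rewrite ?inE//.
  - exact: (seq_measurable (@aff2_set1_measurable K)).
  - rewrite -[X in measurable X]setTI.
    exact: (measurable_lin2 (K := K) measurableT (Y := @roots_of_unity K)).
  move=> g gls; have [n n0 gn] : is_torsion (kval (a g)).
    by apply: contrapT => ng; apply: nex; exists g.
  by exists n => //; apply/unity_rootP.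
have diag : exists2 g, g \in ls & offset g != 0.
  apply: contrapT => nex; apply: eta_diag => g /[dup] /eta_lin lg /ls_supp gls.
  exists g.1 => //; rewrite [RHS]surjective_pairing; congr (_, _).
  have /eqP : offset g == 0 by apply: contrapT => /negP g0; apply: nex; exists g.
  rewrite /offset => /eqP; rewrite subr_eq0 => /eqP.
  by case: g.1 g.2 lg => [u1 b1] [u2 b2] /= -> ->.
have free := transient_eventually_free ls_uniq ls_supp ls_full eta_lin X_indep X_law.
have centeredE : centered eta <-> forall chi : kstar K -> R,
    (forall s t, A s -> A t -> chi (s * t)%g = chi s + chi t) -> avg ls p (chi \o a) = 0.
  have intE chi : (\int[lin_law eta]_(t in A) (chi t)%:E = (avg ls p (chi \o a))%:E)%E.
    apply: (lin_law_integral ls_uniq ls_full) => _ /= /mapP[g gls ->]; exact: aA.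
  split=> [c chi chiM|c chi chiM].
    apply: EFin_inj; rewrite -intE c// => s t; rewrite !inE; exact: chiM.
  rewrite intE c// => s t As At; apply: chiM; exact: mem_set.
have noncentered : ~ centered eta -> exists C : R, forall s N, \sum_(n < N)
    iter n (transfer ls p (group_step a)) (fun x => (x == s)%:R) 1%g <= C.
  move=> nc; have [chi chiM chi0] : exists2 chi : kstar K -> R,
      (forall s t, A s -> A t -> chi (s * t)%g = chi s + chi t) & avg ls p (chi \o a) != 0.
    apply: contrapT => nex; apply: nc; apply/centeredE => chi chiM.
    by apply/eqP; apply: contrapT => /negP chi0; apply: nex; exists chi.
  exact: (noncentered_walk_transient pP A1 AM aA chiM chi0).
split=> [r3|r12].
  apply: free => //.
  have [c|/noncentered//] := pselect (centered eta).
  exact: (centered_walk_transient pP p_gt0 A1 AM AV aA A_gen vM v_surj (proj1 centeredE c) r3).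
split=> [ev_free c|/noncentered tr]; last exact: free.
apply: (recurrent_not_eventually_free ls_uniq ls_supp ls_full eta_lin X_indep X_law) ev_free.
move=> x e; apply: (centered_walk_recurrent pP p_gt0 A1 AM AV aA A_gen vM v_fin v_surj
  (proj1 centeredE c)).
by case: r12 => ->.
Qed.
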